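(* Let $(\mathcal{M},\|\cdot\|)$ be a $d$-dimensional metric space admitting locality-sensitive hashing with exponent function $\rho(\cdot)$ (see context), let $c>1$, $r>0$, $Q$ the number of queries and $\delta>0$. Let $\beta=\min_{k\in\mathbb{Z}_{\ge1}}\max\{\rho(c^{1/k}),1/k\}$. There exists a robust algorithm for solving the $(c,r)$-ANN problem on $n$-point datasets that uses space $\widetilde{O}(\sqrt{Q}\cdot n^{1+\beta})$ and whose query runtime is $\widetilde{O}(d\,n^{\beta})$ with probability at least $1-\delta$.
   Context: For a dataset $S\subseteq\mathcal{M}$ of $n$ points, $B_S(q,r):=\{p\in S:\|p-q\|\le r\}$. The $(c,r)$-ANN problem: for each query $q$, if $B_S(q,r)\neq\emptyset$ output a point of $B_S(q,cr)$; if $B_S(q,cr)=\emptyset$ output $\perp$; otherwise either is acceptable. For every approximation factor $c'>1$ and radius the space admits a monotone $(c',r,p_1,p_2)$-LSH family ($\|x-y\|\le r\Rightarrow \Pr_h[h(x)=h(y)]\ge p_1$, $\|x-y\|\ge c'r\Rightarrow\Pr_h[h(x)=h(y)]\le p_2$, $p_1>p_2$), computable in $O(d)$ time, with exponent $\rho(c')=\log(1/p_1)/\log(1/p_2)\in(0,1)$. Robustness is with respect to the game in which a computationally unbounded adversary, knowing the algorithm but not its private randomness, chooses the dataset and then adaptively chooses $Q$ queries, each depending on all previous queries and answers; the algorithm must answer all queries correctly with high probability. $\widetilde{O}$ hides polylogarithmic factors. *)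

(* Defs.v *)
From HB Require Import structures.
From mathcomp Require Import all_boot all_order all_algebra.
From mathcomp Require Import all_classical all_reals all_analysis.

Set Implicit Arguments.
Unset Strict Implicit.
Unset Printing Implicit Defensive.

Import Order.TTheory GRing.Theory Num.Theory.
Import numFieldNormedType.Exports.

Local Open Scope classical_set_scope.
Local Open Scope ring_scope.

Definition data_ball (R : realType) (M : metricType R) (n : nat)
    (S : 'I_n -> M) (q : M) (rad : R) : set M :=
  [set p | range S p /\ mdist p q <= rad].

(* [None] is the answer "bottom". *)
Definition ann_correct (R : realType) (M : metricType R) (n : nat)
    (S : 'I_n -> M) (c r : R) (q : M) (a : option M) : Prop :=
  [/\ data_ball S q r !=set0 ->
        exists2 p, a = Some p & data_ball S q (c * r) p,
      data_ball S q (c * r) = set0 -> a = None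
    & forall p, a = Some p -> data_ball S q (c * r) p].

(* Hash values are encoded as natural numbers. *)
Record hash_family (R : realType) (M : Type) := HashFamily {
  hf_display : measure_display;
  hf_type : measurableType hf_display;
  hf_prob : probability hf_type R;
  hf_eval : hf_type -> M -> nat;
  hf_measurable : forall x : M, measurable_fun setT (hf_eval ^~ x)
}.

Definition collision (R : realType) (M : Type) (F : hash_family R M)
    (x y : M) : \bar R :=
  hf_prob F [set h | hf_eval h x = hf_eval h y].

Definition is_monotone_lsh (R : realType) (M : metricType R)
    (F : hash_family R M) (c' r' p1 p2 : R) : Prop :=
  [/\ forall x y : M, mdist x y <= r' -> (p1%:E <= collision F x y)%E,
      forall x y : M, c' * r' <= mdist x y -> (collision F x y <= p2%:E)%E
    & forall x y x' y' : M, mdist x y <= mdist x' y' ->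
        (collision F x' y' <= collision F x y)%E].

(** A word RAM whose programs are finite texts in a while language.  Besides
    words, a program has access to the stored data points, the current query
    point and the stored hash functions, but only through two comparisons, each
    of which costs [d], the cost of reading a point of the [d]-dimensional
    space.  Every other elementary operation has unit cost.  In particular
    neither real numbers nor hash values can be packed into words. *)

Inductive binop := Add | Sub | Mul | Div | Leq.

Inductive expr :=
| Cst of nat
| Mem of expr
| Bin of binop & expr & expr.

(* In [Near a x y t] and [HashLeq a f j x y], [a] is the address that receives
   the resulting bit, [x] and [y] are point numbers, [t] is a position in the
   list of radii of the algorithm, [f] a position in its list of LSH families
   and [j] is the number of a stored hash function from that family.
   [Toss a] stores a fresh fair bit at address [a]. *)
Inductive cmd :=
| Skip
| Store of expr & expr
| Toss of expr
| Near of expr & expr & expr & nat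
| HashLeq of expr & nat & expr & expr & expr
| Seq of cmd & cmd
| If of expr & cmd & cmd
| While of expr & cmd.

(* The memory, and the number of random bits consumed so far. *)
Definition state : Type := (seq nat * nat)%type.

Record machine := Machine {
  dimension : nat;
  word_bits : nat;
  near_oracle : nat -> nat -> nat -> bool;             (* radius, points *)
  hash_oracle : nat -> nat -> nat -> nat -> bool;  (* family, index, points *)
  coin_oracle : nat -> bool
}.

Definition trunc (m : machine) (v : nat) : nat := (v %% 2 ^ word_bits m)%N.

Definition binop_sem (o : binop) (u v : nat) : nat :=
  match o with
  | Add => (u + v)%N
  | Sub => (u - v)%N
  | Mul => (u * v)%N
  | Div => (u %/ v)%N
  | Leq => (u <= v)%N
  end.

Fixpoint eval (m : machine) (mem : seq nat) (e : expr) : nat :=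
  match e with
  | Cst v => trunc m v
  | Mem a => nth 0%N mem (eval m mem a)
  | Bin o e1 e2 => trunc m (binop_sem o (eval m mem e1) (eval m mem e2))
  end.

Fixpoint cost (e : expr) : nat :=
  match e with
  | Cst _ => 1
  | Mem a => (cost a).+1
  | Bin _ e1 e2 => (cost e1 + cost e2).+1
  end.

(* Writing outside of the memory has no effect: the memory never grows. *)
Definition write (m : machine) (mem : seq nat) (a v : nat) : seq nat :=
  if (a < size mem)%N then set_nth 0%N mem a (trunc m v) else mem.

(* [exec m p s s' t]: started in state [s], [p] halts in state [s'] at cost
   [t].  For a given machine the relation is deterministic. *)
Inductive exec (m : machine) : cmd -> state -> state -> nat -> Prop :=
| ExecSkip s : exec m Skip s s 1
| ExecStore a e mem i :
    exec m (Store a e) (mem, i)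
      (write m mem (eval m mem a) (eval m mem e), i)
      (cost a + cost e).+1
| ExecToss a mem i :
    exec m (Toss a) (mem, i)
      (write m mem (eval m mem a) (coin_oracle m i), i.+1)
      (cost a).+1
| ExecNear a x y t mem i :
    exec m (Near a x y t) (mem, i)
      (write m mem (eval m mem a)
         (near_oracle m t (eval m mem x) (eval m mem y)), i)
      (cost a + cost x + cost y + dimension m).+1
| ExecHashLeq a f j x y mem i :
    exec m (HashLeq a f j x y) (mem, i)
      (write m mem (eval m mem a)
         (hash_oracle m f (eval m mem j) (eval m mem x) (eval m mem y)), i)
      (cost a + cost j + cost x + cost y + dimension m).+1
| ExecSeq p1 p2 s s1 s2 t1 t2 :
    exec m p1 s s1 t1 -> exec m p2 s1 s2 t2 ->
    exec m (Seq p1 p2) s s2 (t1 + t2)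
| ExecIfTrue e p1 p2 s s1 t :
    eval m s.1 e != 0%N -> exec m p1 s s1 t ->
    exec m (If e p1 p2) s s1 (cost e + t).+1
| ExecIfFalse e p1 p2 s s1 t :
    eval m s.1 e = 0%N -> exec m p2 s s1 t ->
    exec m (If e p1 p2) s s1 (cost e + t).+1
| ExecWhileTrue e p s s1 s2 t1 t2 :
    eval m s.1 e != 0%N -> exec m p s s1 t1 -> exec m (While e p) s1 s2 t2 ->
    exec m (While e p) s s2 (cost e + t1 + t2).+1
| ExecWhileFalse e p s :
    eval m s.1 e = 0%N -> exec m (While e p) s s (cost e).+1.

(* The two program texts, the radii and the requested LSH families [(c', r')]
   are fixed once and for all.  The resources, as well as a fixed number of
   precomputed integer parameters, depend on the number of data points, the
   number of queries and the failure probability, in this order. *)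
Record algorithm (R : realType) := Algorithm {
  preprocess : cmd;
  answer_query : cmd;
  radii : seq R;
  families : seq (R * R);
  nparams : nat;
  params : nat -> nat -> R -> nparams.-tuple nat;
  wbits : nat -> nat -> R -> nat;      (* bits per memory word *)
  memsize : nat -> nat -> R -> nat;    (* memory words *)
  nhash : nat -> nat -> R -> nat       (* stored hash functions per family *)
}.

(* Number of cells, a cell being able to hold a data point, a hash function or
   a memory word. *)
Definition space_used (R : realType) (A : algorithm R) (n Q : nat) (delta : R)
    : nat :=
  (n + size (families A) * nhash A n Q delta + memsize A n Q delta)%N.

Definition family_of (R : realType) (M : Type) (A : algorithm R)
    (fam : R -> R -> hash_family R M) (f : nat) : hash_family R M :=
  let cr := nth (0, 0) (families A) f in fam cr.1 cr.2.

(* Points are numbered by their position in the dataset; every number that is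
   not such a position denotes the current query, if there is one. *)
Definition point_at (M : Type) (n : nat) (S : 'I_n -> M) (q : option M) (x : nat)
    : option M :=
  if insub x is Some i then Some (S i) else q.

(* The hash functions are [hs f j], for [f] a position in [families A]. *)
Definition machine_of (R : realType) (M : metricType R) (A : algorithm R)
    (fam : R -> R -> hash_family R M) (d n Q : nat) (delta : R)
    (S : 'I_n -> M) (hs : forall f : nat, nat -> hf_type (family_of A fam f))
    (coins : nat -> bool) (q : option M) : machine :=
  {| dimension := d;
     word_bits := wbits A n Q delta;
     near_oracle t x y :=
       match point_at S q x, point_at S q y with
       | Some u, Some v => (t < size (radii A))%N
                           && (mdist u v <= nth 0 (radii A) t)
       | _, _ => false
       end;
     hash_oracle f j x y :=
       match point_at S q x, point_at S q y with
       | Some u, Some v => [&& (f < size (families A))%N,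
                               (j < nhash A n Q delta)%N
                             & (hf_eval (hs f j) u <= hf_eval (hs f j) v)%N]
       | _, _ => false
       end;
     coin_oracle := coins |}.

(* The precomputed parameters are in the first memory cells. *)
Definition initial_state (R : realType) (A : algorithm R) (n Q : nat)
    (delta : R) : state :=
  (mkseq (fun a => (nth 0 (params A n Q delta) a %% 2 ^ wbits A n Q delta)%N)
         (memsize A n Q delta), 0%N).

(* The answer is the number held by the first memory cell: a position in the
   dataset stands for that data point, any other number for "bottom". *)
Definition output (M : Type) (n : nat) (S : 'I_n -> M) (s : state)
    : option M :=
  point_at S None (nth 0%N s.1 0).

(* The adversary chooses its next query from all previous queries and
   answers, by an arbitrary function: quantifying over these functions covers
   randomized adversaries, by conditioning on their coins. *)
Definition adversary (M : Type) : Type := seq (M * option M) -> M.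

(* Each of the next [m] queries is answered correctly at cost at most [T]. *)
Fixpoint survives (R : realType) (M : metricType R) (mach : M -> machine)
    (p : cmd) (n : nat) (S : 'I_n -> M) (c r : R) (T : R) (adv : adversary M)
    (m : nat) (hist : seq (M * option M)) (s : state) : Prop :=
  match m with
  | 0 => True
  | m'.+1 =>
    let q := adv hist in
    exists s' t,
      [/\ exec (mach q) p s s' t, t%:R <= T, ann_correct S c r q (output S s')
        & survives mach p S c r T adv m' (rcons hist (q, output S s')) s']
  end.

Definition good_run (R : realType) (M : metricType R) (A : algorithm R)
    (fam : R -> R -> hash_family R M) (d n Q : nat) (delta : R)
    (S : 'I_n -> M) (hs : forall f : nat, nat -> hf_type (family_of A fam f))
    (coins : nat -> bool) (c r T : R) (adv : adversary M) : Prop :=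
  let mach := machine_of d Q delta S hs coins in
  exists s t,
    exec (mach None) (preprocess A) (initial_state A n Q delta) s t /\
    survives (fun q => mach (Some q)) (answer_query A) S c r T adv Q [::] s.

Definition mutually_independent (d : measure_display) (Omega : measurableType d)
    (R : realType) (P : probability Omega R) (I : eqType)
    (G : I -> set (set Omega)) : Prop :=
  forall (s : seq I) (E : I -> set Omega),
    uniq s -> (forall i, i \in s -> G i (E i)) ->
    P (\bigcap_(i in [set` s]) E i) = (\prod_(i <- s) P (E i))%E.

(* Events that only depend on one hash function, or on one coin. *)
Definition tape_events (d : measure_display) (Omega : measurableType d)
    (R : realType) (M : Type) (F : nat -> hash_family R M)
    (hs : forall f : nat, nat -> Omega -> hf_type (F f))
    (coins : nat -> Omega -> bool) (i : (nat * nat + nat)%type)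
    : set (set Omega) :=
  match i with
  | inl fj => [set hs fj.1 fj.2 @^-1` B | B in measurable]
  | inr k => [set coins k @^-1` B | B in setT]
  end.

(* Hash functions drawn from their families and fair coins, all mutually
   independent. *)
Definition random_tapes (d : measure_display) (Omega : measurableType d)
    (R : realType) (P : probability Omega R) (M : Type)
    (F : nat -> hash_family R M)
    (hs : forall f : nat, nat -> Omega -> hf_type (F f))
    (coins : nat -> Omega -> bool) : Prop :=
  [/\ forall f j, measurable_fun setT (hs f j),
      forall f j B, measurable B -> P (hs f j @^-1` B) = hf_prob (F f) B,
      forall k, measurable_fun setT (coins k),
      forall k, P (coins k @^-1` [set true]) = (2^-1)%:E
    & mutually_independent P (tape_events hs coins)].

Definition max_exponent (R : realType) (rho : R -> R) (c : R) (k : nat) : R :=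
  Num.max (rho (c `^ k%:R^-1)) k%:R^-1.

Definition is_min_exponent (R : realType) (rho : R -> R) (c beta : R) : Prop :=
  (exists2 k : nat, (0 < k)%N & beta = max_exponent rho c k) /\
  (forall k : nat, (0 < k)%N -> beta <= max_exponent rho c k).

(* The quantity of which soft-O hides a power; it is at least 1. *)
Definition logf (R : realType) (n Q : nat) (delta : R) : R :=
  ln (3 + n%:R + Q%:R + delta^-1).

(* Main.v *)
(* Choose k attaining the minimum and put c' = c^(1/k), so that c splits into k levels with
   radii r c'^i.  If every answer is drawn uniformly from a ball around the query, then the
   answers carry no information about the hash functions and labels drawn in advance, and
   a union bound over the queries defeats the adaptive adversary; this needs no dependence
   on Q beyond logarithms.

   Each point gets a random J-bit label, 2^J >= n.  At rate 2^-j the points are cut into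
   2^j segments by the leading bits of their labels.  A query runs through j = J, ..., 0
   while the level i = jk/(J + 1) goes down from k - 1 to 0, and stops at the first rate at
   which the ball of level i holds at least 2^j points.  As the last rate of level i + 1 was
   passed over, the ball of level i + 1 then has O(2^j n^(1/k)) points.  In an attempt one
   draws a random segment and a random rank u below a polylogarithmic bound lam, lists the
   points of the segment in the ball of level i by means of LSH tables sorted by (hash
   values, label), and returns the u-th one if it exists: any given point of the ball comes
   out with probability exactly 2^-j / lam.  The list is complete with overwhelming
   probability at the price of O(n^rho) tables and of reading the O(n^(1/k)) points of the
   segment between the two radii, which gives n^beta. *)

Require Import Defs.
From HB Require Import structures.
From mathcomp Require Import all_boot all_order all_algebra.
From mathcomp Require Import all_classical all_reals all_analysis.
From mathcomp Require Import zify ring lra.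
Import Defs.

Unset Lia Cache.
Set Implicit Arguments.
Unset Strict Implicit.
Unset Printing Implicit Defensive.

(** * Reasoning about programs *)

(** Past answers are never conditioned upon. With labels and hash functions fixed and only the coins
    of the current query random, a query whose tables are good has an answer whose law is exactly
    the functional [ideal], with weights read off the dataset and the query. This functional
    commutes with averaging over the tables, so the induction over rounds fixes a history first and
    averages over the tables afterwards, as if they were fresh. This calls for an exact law, hence a
    rank drawn below [lam] whatever the length of the list, at the price of attempts that return
    nothing.

    A complete list is costly when a near point collides rarely and points just outside the ball
    almost as often. The tables therefore form groups, each with its own reading budget: for a point
    colliding with probability w, the first 3/w tables or so of a group suffice, and monotonicity
    bounds what is read there. Independent groups amplify a constant success probability.

    Measure theory enters only at the end: as answers take finitely many values, finitely many
    queries can ever occur, and a hash function acts only through its collisions with these. *)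

Definition upd (f : nat -> nat) (a v : nat) : nat -> nat :=
  fun b => if b == a then v else f b.

Lemma updE f a v : upd f a v a = v.
Proof. by rewrite /upd eqxx. Qed.

Lemma updne f a v b : b != a -> upd f a v b = f b.
Proof. by rewrite /upd => /negbTE ->. Qed.

(* Values of expressions when no intermediate result overflows. *)
Fixpoint ev (f : nat -> nat) (e : expr) : nat :=
  match e with
  | Cst v => v
  | Mem a => f (ev f a)
  | Bin o e1 e2 => binop_sem o (ev f e1) (ev f e2)
  end.

(* A condition on the memory contents, the number of coins consumed and the cost. *)
Definition post : Type := (nat -> nat) -> nat -> nat -> Prop.

Section WeakestPrecondition.
Variables (m : machine) (N B : nat).
Hypothesis BE : B = 2 ^ word_bits m.
Hypothesis B_gt1 : 1 < B.

(** Only sums and products can leave the word range: a truncated difference or a quotient is at most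
    its left operand, and a comparison is at most 1. *)
Fixpoint safe (f : nat -> nat) (e : expr) : Prop :=
  match e with
  | Cst v => v < B
  | Mem a => safe f a /\ ev f a < N
  | Bin o e1 e2 =>
    [/\ safe f e1, safe f e2 &
        match o with
        | Add => ev f e1 + ev f e2 < B
        | Mul => ev f e1 * ev f e2 < B
        | _ => True
        end]
  end.

Definition bounded (f : nat -> nat) := forall a, f a < B.

Lemma bounded_upd f a v : bounded f -> v < B -> bounded (upd f a v).
Proof. by move=> bf vB b; rewrite /upd; case: ifP. Qed.

Lemma ev_lt f e : bounded f -> safe f e -> ev f e < B.
Proof.
move=> bf; elim: e => [v|a _|o e1 IH1 e2 IH2] //= [s1 s2].
move: (IH1 s1) (IH2 s2); case: o => //= h1 h2 _.
- exact: leq_ltn_trans (leq_subr _ _) h1.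
- exact: leq_ltn_trans (leq_div _ _) h1.
- exact: leq_ltn_trans (leq_b1 _) B_gt1.
Qed.

Lemma evalE f e : bounded f -> safe f e -> eval m (mkseq f N) e = ev f e.
Proof.
move=> bf; elim: e => [v|a IH|o e1 IH1 e2 IH2] /=.
- by move=> vB; rewrite /trunc -BE modn_small.
- by case=> sa aN; rewrite IH // nth_mkseq.
- move=> sf; have := ev_lt bf (e := Bin o e1 e2) sf.
  by case: sf => s1 s2 _ /= h; rewrite IH1 // IH2 // /trunc -BE modn_small.
Qed.

Lemma write_mkseq f a v : v < B -> a < N ->
  write m (mkseq f N) a v = mkseq (upd f a v) N.
Proof.
move=> vB aN; rewrite /write size_mkseq aN /trunc -BE modn_small //.
apply: (@eq_from_nth _ 0) => [|b].
  by rewrite size_set_nth !size_mkseq; apply/maxn_idPr.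
rewrite size_set_nth size_mkseq (maxn_idPr aN) => bN.
by rewrite nth_set_nth /= !nth_mkseq // /upd.
Qed.

(** Total correctness in the existential form that [survives] asks for. [bounded] is threaded
    through because [ev] is related to the machine's [eval] on memories of genuine words. *)
Definition runs (c : cmd) (f : nat -> nat) (i : nat)
    (Post : post) : Prop :=
  bounded f -> exists f' i' t,
    [/\ exec m c (mkseq f N, i) (mkseq f' N, i') t, bounded f' & Post f' i' t].

Lemma wp_conseq c f i (P1 P2 : post) :
  (forall f' i' t, bounded f' -> P1 f' i' t -> P2 f' i' t) ->
  runs c f i P1 -> runs c f i P2.
Proof.
move=> h w bf; case: (w bf) => f' [i' [t [e bf' p]]].
by exists f', i', t; split=> //; apply: h.
Qed.

Lemma wp_skip f i (P : post) :
  P f i 1 -> runs Skip f i P.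
Proof. by move=> p bf; exists f, i, 1; split=> //; constructor. Qed.

Lemma wp_store a e f i (P : post) :
  safe f a -> safe f e -> ev f a < N ->
  P (upd f (ev f a) (ev f e)) i (cost a + cost e).+1 -> runs (Store a e) f i P.
Proof.
move=> sa se aN p bf; exists (upd f (ev f a) (ev f e)), i, (cost a + cost e).+1.
have eB := ev_lt bf se.
split=> //; last exact: bounded_upd.
by rewrite -write_mkseq // -!evalE //; apply: ExecStore.
Qed.

Lemma wp_toss a f i (P : post) :
  safe f a -> ev f a < N ->
  P (upd f (ev f a) (coin_oracle m i)) i.+1 (cost a).+1 -> runs (Toss a) f i P.
Proof.
move=> sa aN p bf; exists (upd f (ev f a) (coin_oracle m i)), i.+1, (cost a).+1.
have cB : coin_oracle m i < B by case: (coin_oracle m i) => /=; lia.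
split=> //; last exact: bounded_upd.
by rewrite -write_mkseq // -[in write _ _ _ _]evalE //; apply: ExecToss.
Qed.

Lemma wp_near a x y r f i (P : post) :
  safe f a -> safe f x -> safe f y -> ev f a < N ->
  P (upd f (ev f a) (near_oracle m r (ev f x) (ev f y))) i
    (cost a + cost x + cost y + dimension m).+1 ->
  runs (Near a x y r) f i P.
Proof.
move=> sa sx sy aN p bf.
set v : nat := near_oracle m r (ev f x) (ev f y) in p *.
exists (upd f (ev f a) v), i, (cost a + cost x + cost y + dimension m).+1.
have vB : v < B by rewrite /v; case: near_oracle => /=; lia.
split=> //; last exact: bounded_upd.
by rewrite -write_mkseq // /v -!evalE //; apply: ExecNear.
Qed.

Lemma wp_hash a r j x y f i (P : post) :
  safe f a -> safe f j -> safe f x -> safe f y -> ev f a < N ->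
  P (upd f (ev f a) (hash_oracle m r (ev f j) (ev f x) (ev f y))) i
    (cost a + cost j + cost x + cost y + dimension m).+1 ->
  runs (HashLeq a r j x y) f i P.
Proof.
move=> sa sj sx sy aN p bf.
set v : nat := hash_oracle m r (ev f j) (ev f x) (ev f y) in p *.
exists (upd f (ev f a) v), i,
  (cost a + cost j + cost x + cost y + dimension m).+1.
have vB : v < B by rewrite /v; case: hash_oracle => /=; lia.
split=> //; last exact: bounded_upd.
by rewrite -write_mkseq // /v -!evalE //; apply: ExecHashLeq.
Qed.

Lemma wp_seq c1 c2 f i (P : post) :
  runs c1 f i (fun f1 i1 t1 => runs c2 f1 i1 (fun f2 i2 t2 => P f2 i2 (t1 + t2))) ->
  runs (Seq c1 c2) f i P.
Proof.
move=> w bf; case: (w bf) => f1 [i1 [t1 [e1 bf1 w2]]].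
case: (w2 bf1) => f2 [i2 [t2 [e2 bf2 p]]].
by exists f2, i2, (t1 + t2); split=> //; apply: ExecSeq e1 e2.
Qed.

Lemma wp_if e c1 c2 f i (P : post) :
  safe f e ->
  (ev f e != 0 -> runs c1 f i (fun f' i' t => P f' i' (cost e + t).+1)) ->
  (ev f e = 0 -> runs c2 f i (fun f' i' t => P f' i' (cost e + t).+1)) ->
  runs (If e c1 c2) f i P.
Proof.
move=> se w1 w2 bf; have [e0|e0] := eqVneq (ev f e) 0.
  case: (w2 e0 bf) => f' [i' [t [ex bf' p]]].
  exists f', i', (cost e + t).+1; split=> //.
  by apply: ExecIfFalse ex; rewrite evalE.
case: (w1 e0 bf) => f' [i' [t [ex bf' p]]].
exists f', i', (cost e + t).+1; split=> //.
by apply: ExecIfTrue ex; rewrite evalE.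
Qed.

(** [Leq] being the only comparison, [v < e] is tested as [v + 1 <= e], and [e] is evaluated anew in
    every round. *)
Definition For (v : nat) (e : expr) (body : cmd) : cmd :=
  Seq (Store (Cst v) (Cst 0))
    (While (Bin Leq (Bin Add (Mem (Cst v)) (Cst 1)) e)
       (Seq body (Store (Cst v) (Bin Add (Mem (Cst v)) (Cst 1))))).

(** The last argument of [Inv] is the cost of the completed rounds. A round adds [12 + cost e] to
    its body: [6 + cost e] for the test and 6 for the increment. The closing [9 + cost e] is the
    failing test plus the 3 of the initial assignment. [b.+1 < B] lets the failing test be computed
    without overflow. *)
Lemma wp_for v e body b f i
    (Inv : nat -> (nat -> nat) -> nat -> nat -> Prop)
    (P : post) :
  v < N -> v < B -> b.+1 < B ->
  Inv 0 (upd f v 0) i 0 ->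
  (forall q g j t, q <= b -> Inv q g j t -> g v = q -> safe g e /\ ev g e = b) ->
  (forall q g j t, q < b -> Inv q g j t -> g v = q ->
     runs body g j (fun g' j' t' =>
       g' v = q /\ Inv q.+1 (upd g' v q.+1) j' (t + (t' + (12 + cost e))))) ->
  (forall g j t, Inv b g j t -> g v = b -> P g j (t + (9 + cost e))) ->
  runs (For v e body) f i P.
Proof.
move=> vN vB bB I0 Ie Ib IP; apply: wp_seq.
apply: wp_store => //=; first exact: leq_trans _ (ltnW B_gt1).
have gen q g j t : q <= b -> Inv q g j t -> g v = q ->
    runs (While (Bin Leq (Bin Add (Mem (Cst v)) (Cst 1)) e)
         (Seq body (Store (Cst v) (Bin Add (Mem (Cst v)) (Cst 1))))) g j
       (fun g' j' t' => P g' j' (t + t' + 3)).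
  move Ed: (b - q) => d; elim: d q g j t Ed => [|d IH] q g j t Ed qb Iq gv bg.
    have Eq : q = b by lia.
    have [se ee] := Ie _ _ _ _ qb Iq gv.
    exists g, j, (4 + cost e).+2; split=> //.
      have -> : (4 + cost e).+2 =
        (cost (Bin Leq (Bin Add (Mem (Cst v)) (Cst 1)) e)).+1 by rewrite /=; lia.
      apply: ExecWhileFalse; rewrite evalE //=; last first.
        by repeat split=> //; rewrite gv; lia.
      by rewrite gv ee; lia.
    have -> : t + (4 + cost e).+2 + 3 = t + (9 + cost e) by lia.
    by apply: IP; rewrite ?gv -?Eq.
  have qb' : q < b by lia.
  have [se ee] := Ie _ _ _ _ qb Iq gv.
  have [g1 [j1 [t1 [e1 bg1 [g1v I1]]]]] := Ib _ _ _ _ qb' Iq gv bg.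
  have sB : q.+1 < B by lia.
  case: (IH q.+1 (upd g1 v q.+1) j1 (t + (t1 + (12 + cost e)))) => //.
  - by lia.
  - exact: updE.
  - exact: bounded_upd.
  move=> g2 [j2 [t2 [e2 bg2 p2]]].
  exists g2, j2, (cost (Bin Leq (Bin Add (Mem (Cst v)) (Cst 1)) e) +
    (t1 + 6) + t2).+1; split=> //.
    apply: ExecWhileTrue e2; rewrite ?evalE //=.
    - by rewrite gv ee; lia.
    - by repeat split=> //; rewrite gv; lia.
    apply: ExecSeq e1 _.
    have <- : write m (mkseq g1 N) (eval m (mkseq g1 N) (Cst v))
      (eval m (mkseq g1 N) (Bin Add (Mem (Cst v)) (Cst 1))) =
      mkseq (upd g1 v q.+1) N.
      have sv : safe g1 (Bin Add (Mem (Cst v)) (Cst 1)).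
        by repeat split=> //=; rewrite g1v; lia.
      by rewrite !evalE //= g1v addn1 write_mkseq.
    exact: ExecStore.
  have -> : t + (cost (Bin Leq (Bin Add (Mem (Cst v)) (Cst 1)) e) +
    (t1 + 6) + t2).+1 + 3 = t + (t1 + (12 + cost e)) + t2 + 3 by rewrite /=; lia.
  exact: p2.
apply: wp_conseq (gen 0 _ _ 0 _ I0 (updE _ _ _)) => // f' i' t _.
by rewrite add0n addnC.
Qed.

End WeakestPrecondition.

(** * The programs *)

Notation "a ⊕ b" := (Bin Add a b) (at level 50, left associativity).
Notation "a ⊖ b" := (Bin Sub a b) (at level 50, left associativity).
Notation "a ⊗ b" := (Bin Mul a b) (at level 40, left associativity).
Notation "a ⊘ b" := (Bin Div a b) (at level 40, left associativity).
Notation "a ⊑ b" := (Bin Leq a b) (at level 70).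
Notation "a ;; b" := (Seq a b) (at level 100, right associativity).
Notation "x ::= e" := (Store (Cst x) e) (at level 95).
Notation "# x" := (Mem (Cst x)) (at level 1, format "# x").

(* Registers; a subroutine only writes to registers with small numbers. *)
Notation rBit := 1.
Notation rBit' := 2.
Notation rA := 3.
Notation rLt := 4.
Notation rEq := 5.
Notation rX := 6.
Notation rY := 7.
Notation rB := 8.
Notation rStep := 9.
Notation rPos := 10.
Notation rTarget := 11.
Notation rP := 12.
Notation rSize := 13.
Notation rLo := 14.
Notation rHi := 15.
Notation rI := 16.
Notation rTau := 17.
Notation rBase := 18.
Notation rBudget := 19.
Notation rT := 20.
Notation rG := 21.
Notation rSegLo := 22.
Notation rSegHi := 23.
Notation rU := 24.
Notation rZ := 25.
Notation rAns := 26.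
Notation rAtt := 27.
Notation rJJ := 28.
Notation rLev := 29.
Notation rK := 30.
Notation rW := 31.
Notation cN := 32.
Notation cJ := 33.
Notation cLam := 34.
Notation cM := 35.
Notation cG := 36.
Notation cL := 37.
Notation cT := 38.
Notation cPow := 39.
Notation cD := 40.
Notation cTB := 41.
Notation cLB := 42.
Notation NR := 43.

Section Programs.
Variable k : nat.

(** The family in [HashLeq] is part of the program text, so the level held in [rLev] selects it
    through a chain of tests. Going down from the largest level makes the first success of
    [l' <= rLev] an equality, provided that [rLev < l]. *)
Fixpoint hash_leq (l : nat) (a : nat) (j x y : expr) : cmd :=
  if l is l'.+1 then
    If (Cst l' ⊑ #rLev) (HashLeq (Cst a) l' j x y) (hash_leq l' a j x y)
  else Skip.

Fixpoint near_query (l : nat) (a : nat) (x y : expr) : cmd :=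
  if l is l'.+1 then
    If (Cst l' ⊑ #rLev) (Near (Cst a) x y l') (near_query l' a x y)
  else Skip.

(** Hash values can only be compared, so equality is the conjunction of two opposite comparisons.
    [1 - rBit'] says that the value at [rX] is strictly smaller; it counts only while all earlier
    coordinates agree, which keeps [rLt] a bit. *)
Definition compare_keys : cmd :=
  rLt ::= Cst 0;;
  rEq ::= Cst 1;;
  For rA #rK (
    hash_leq k rBit (#rTau ⊗ #rK ⊕ #rA) #rX #rY;;
    hash_leq k rBit' (#rTau ⊗ #rK ⊕ #rA) #rY #rX;;
    rLt ::= #rLt ⊕ #rEq ⊗ (Cst 1 ⊖ #rBit');;
    rEq ::= #rEq ⊗ (#rBit ⊗ #rBit')).

Definition ext_at (e : expr) : expr := Mem (Cst (NR + k) ⊕ e).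

(** Descent by steps [2^J, ..., 1]: a step is kept when the last entry that it skips still precedes
    the pair formed by the key of the query and [rTarget]. [rY] is set to [n], which is no position
    of the dataset and hence denotes the query. *)
Definition search : cmd :=
  rPos ::= Cst 0;;
  rStep ::= #cPow;;
  rY ::= #cN;;
  For rB (#cJ ⊕ Cst 1) (
    If (#rPos ⊕ #rStep ⊑ #cN)
      (rX ::= Mem (#rBase ⊕ #rPos ⊕ #rStep ⊖ Cst 1);;
       compare_keys;;
       If (#rLt ⊕ #rEq ⊗ (ext_at #rX ⊕ Cst 1 ⊑ #rTarget))
          (rPos ::= #rPos ⊕ #rStep) Skip)
      Skip;;
    rStep ::= #rStep ⊘ Cst 2).

Definition process : cmd :=
  rP ::= Mem (#rBase ⊕ #rLo ⊕ #rI);;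
  near_query k rBit #rP #cN;;
  If #rBit
    (rBit' ::= Cst 0;;
     For rA #rSize
       (rBit' ::= #rBit' ⊕ (Mem (#cLB ⊕ #rA) ⊑ #rP) ⊗
                            (#rP ⊑ Mem (#cLB ⊕ #rA)));;
     If #rBit' Skip
       (If (#rSize ⊕ Cst 1 ⊑ #cLam)
          (Store (#cLB ⊕ #rSize) #rP;; rSize ::= #rSize ⊕ Cst 1) Skip))
    Skip.

Definition set_table : cmd :=
  rBase ::= #cTB ⊕ (#rLev ⊗ (#cG ⊗ #cL) ⊕ #rTau) ⊗ #cN.

(** A range is read in full or not at all, so a group reads at most [T] entries and no range is left
    half read. *)
Definition scan_table : cmd :=
  rTau ::= #rG ⊗ #cL ⊕ #rT;;
  set_table;;
  rTarget ::= #rSegLo;;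
  search;;
  rLo ::= #rPos;;
  rTarget ::= #rSegHi;;
  search;;
  rHi ::= #rPos;;
  If (#rHi ⊖ #rLo ⊑ #rBudget)
    (rBudget ::= #rBudget ⊖ (#rHi ⊖ #rLo);;
     For rI (#rHi ⊖ #rLo) process)
    Skip.

(** One number of [J + l] bits supplies both random choices: its quotient by [lam] is a label, whose
    segment of width [rW] is searched, and its remainder is the rank. Segment bounds carry a factor
    [n] because they are compared with [label * n + position]. *)
Definition attempt : cmd :=
  rSegLo ::= #rZ ⊘ #cLam;;
  rU ::= #rZ ⊖ #rSegLo ⊗ #cLam;;
  rSegLo ::= (#rSegLo ⊘ #rW) ⊗ (#rW ⊗ #cN);;
  rSegHi ::= #rSegLo ⊕ #rW ⊗ #cN;;
  rSize ::= Cst 0;;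
  For rG #cG (rBudget ::= #cT;; For rT #cL scan_table);;
  If (#rU ⊕ Cst 1 ⊑ #rSize) (rAns ::= Mem (#cLB ⊕ #rU)) Skip.

Definition draw (e : expr) : cmd :=
  rZ ::= Cst 0;;
  For rA e (Toss (Cst rBit);; rZ ::= #rZ ⊕ #rZ ⊕ #rBit).

(** Coins are drawn even once an answer is known: every query then consumes the same number of them,
    so its coins sit at an offset that does not depend on the past. The value [n] in [rAns] stands
    for no answer yet. *)
Definition query_prog : cmd :=
  rAns ::= #cN;;
  rW ::= Cst 1;;
  For rJJ (#cJ ⊕ Cst 1) (
    rLev ::= ((#cJ ⊖ #rJJ) ⊗ Cst k) ⊘ (#cJ ⊕ Cst 1);;
    rK ::= Mem (Cst NR ⊕ #rLev);;
    For rAtt #cM (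
      draw #cD;;
      If (#rAns ⊕ Cst 1 ⊑ #cN) Skip attempt);;
    rW ::= #rW ⊕ #rW);;
  0 ::= #rAns.

(* Every table is filled by rank: a point is stored at the position given by the
   number of points that precede it. *)
Definition preproc_prog : cmd :=
  For rP #cN (
    draw #cJ;;
    Store (Cst (NR + k) ⊕ #rP) (#rZ ⊗ #cN ⊕ #rP));;
  For rLev (Cst k) (
    rK ::= Mem (Cst NR ⊕ #rLev);;
    For rTau (#cG ⊗ #cL) (
      set_table;;
      For rY #cN (
        rPos ::= Cst 0;;
        For rX #cN (
          compare_keys;;
          rPos ::= #rPos ⊕ (#rLt ⊕ #rEq ⊗ (ext_at #rX ⊕ Cst 1 ⊑ ext_at #rY)));;
        Store (#rBase ⊕ #rPos) #rY))).

End Programs.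

(** * Correctness of the programs *)

(* Simulates the lexicographic order on the first [K] values by the order of
   numbers written in a large base [b]. *)
Definition lexkey (b : nat) (h : nat -> nat) (K : nat) : nat :=
  foldl (fun acc a => acc * b + h a) 0 (iota 0 K).

Lemma lexkeyS b h K : lexkey b h K.+1 = lexkey b h K * b + h K.
Proof. by rewrite /lexkey -addn1 iotaD foldl_cat. Qed.

Lemma lexkey_ltn b h h' K : (forall a, a < K.+1 -> h a < b /\ h' a < b) ->
  (lexkey b h K.+1 < lexkey b h' K.+1) =
    (lexkey b h K < lexkey b h' K) ||
    (lexkey b h K == lexkey b h' K) && (h K < h' K).
Proof.
move=> hb; rewrite !lexkeyS; have [h1 h2] := hb K (ltnSn K).
case: (ltngtP (lexkey b h K) (lexkey b h' K)) => [lt|gt|->] /=.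
- apply/idP; have : (lexkey b h K).+1 * b <= lexkey b h' K * b by rewrite leq_mul2r lt orbT.
  by lia.
- apply/negbTE; have : (lexkey b h' K).+1 * b <= lexkey b h K * b by rewrite leq_mul2r gt orbT.
  by lia.
- by rewrite ltn_add2l.
Qed.

Lemma lexkey_eq b h h' K : (forall a, a < K -> h a < b /\ h' a < b) ->
  (lexkey b h K == lexkey b h' K) = all (fun a => h a == h' a) (iota 0 K).
Proof.
elim: K => [|K IH] hb; first by rewrite /lexkey /= eqxx.
rewrite -[in iota _ _]addn1 iotaD all_cat /= andbT -IH => [|a aK]; last first.
  by apply: hb; lia.
have [h1 h2] := hb K (ltnSn K); rewrite !lexkeyS.
have d x y : (x * b + y) %/ b = x + y %/ b by rewrite divnMDl //; lia.
have e x y : (x * b + y) %% b = y %% b by rewrite modnMDl.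
apply/eqP/andP => [E|[/eqP -> /eqP -> //]].
have := congr1 (divn^~ b) E; have := congr1 (modn^~ b) E.
by rewrite /= !d !e !modn_small // !divn_small // !addn0 => -> ->.
Qed.

Definition bin (s : seq bool) : nat := foldl (fun v (b : bool) => v + v + b) 0 s.

Lemma bin_rcons s b : bin (s ++ [:: b]) = bin s + bin s + b.
Proof. by rewrite /bin foldl_cat. Qed.

Lemma bin_lt s : bin s < 2 ^ size s.
Proof.
elim/last_ind: s => // s b; rewrite -cats1 bin_rcons size_cat addn1 expnS.
by case: b; lia.
Qed.

(** * Ranks for keys with an injective tie-break *)

Section Ranks.
Variables (n : nat) (a b : nat -> nat).
Hypothesis b_inj : forall p p', p < n -> p' < n -> b p = b p' -> p = p'.

Definition below (x t p : nat) : bool := (a p < x) || (a p == x) && (b p < t).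

Definition rank (p : nat) : nat := count (below (a p) (b p)) (iota 0 n).

Lemma count_lt (T : eqType) (P1 P2 : pred T) (s : seq T) z :
  z \in s -> P2 z -> ~~ P1 z -> {in s, subpred P1 P2} -> count P1 s < count P2 s.
Proof.
elim: s => //= y s IH; rewrite inE => /orP[/eqP <-|zs] P2z P1z h.
  rewrite P2z (negbTE P1z) add0n add1n ltnS.
  elim: s {IH} h => //= w s IH h; apply: leq_add.
    by have := h w; rewrite !inE eqxx orbT => /(_ isT); case: (P1 w) => //= ->.
  apply: IH => v; rewrite inE => /orP[/eqP ->|vs]; apply: h; rewrite !inE ?eqxx //.
  by rewrite vs !orbT.
rewrite -addnS; apply: leq_add; last first.
  by apply: IH => // v vs; apply: h; rewrite inE vs orbT.
by have := h y; rewrite inE eqxx => /(_ isT); case: (P1 y) => //= ->.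
Qed.

Lemma sub_count_in (T : eqType) (P1 P2 : pred T) (s : seq T) :
  {in s, subpred P1 P2} -> count P1 s <= count P2 s.
Proof.
elim: s => //= w s IH h; apply: leq_add.
  by have := h w; rewrite inE eqxx => /(_ isT); case: (P1 w) => //= ->.
by apply: IH => v vs; apply: h; rewrite inE vs orbT.
Qed.

(** Lower sets of a lexicographic order are nested, so comparing their sizes compares their bounds.
    A binary search may thus look at a single table entry instead of counting. *)
Lemma belowE x t p : p < n -> below x t p = (rank p < count (below x t) (iota 0 n)).
Proof.
move=> pn; apply/idP/idP => [bp|].
  apply: (count_lt (z := p)) => //; first by rewrite mem_iota.
    by rewrite /below; lia.
  by move=> p' _; move: bp; rewrite /below; lia.
apply: contraLR => bp; rewrite -leqNgt; apply: sub_count_in => p' _.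
by move: bp; rewrite /below; lia.
Qed.

Lemma rank_lt p : p < n -> rank p < n.
Proof.
move=> pn; rewrite -[X in _ < X](size_iota 0 n) -count_predT.
apply: (count_lt (z := p)) => //; first by rewrite mem_iota.
by rewrite /below; lia.
Qed.

Lemma rank_inj p p' : p < n -> p' < n -> rank p = rank p' -> p = p'.
Proof.
move=> pn pn' e; apply: b_inj => //.
have := belowE (a p') (b p') pn; have := belowE (a p) (b p) pn'.
by rewrite -/(rank p) -/(rank p') e /below; lia.
Qed.

(** Pigeonhole for an injective map of [0, ..., n - 1] into itself; it guarantees that every table
    cell holds a point. *)
Lemma rank_surj r : r < n -> exists2 p, p < n & rank p = r.
Proof.
move=> rn; have u : uniq (map rank (iota 0 n)).
  rewrite map_inj_in_uniq ?iota_uniq // => p p'; rewrite !mem_iota /= !add0n.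
  exact: rank_inj.
have sub : {subset map rank (iota 0 n) <= iota 0 n}.
  move=> x /mapP[p]; rewrite !mem_iota /= !add0n => pn ->; exact: rank_lt.
have [|_ e] := uniq_min_size u sub; first by rewrite size_map size_iota.
have : r \in map rank (iota 0 n) by rewrite e mem_iota.
by case/mapP => p; rewrite mem_iota /= add0n => pn ->; exists p.
Qed.

End Ranks.

(** * Effect and cost of the programs on a fixed memory layout *)

Section Correctness.
Variables (m : machine) (N B : nat).
Hypothesis BE : B = 2 ^ word_bits m.
Hypothesis B_gt1 : 1 < B.
Let wp := runs m N B.

Ltac arith :=
  match goal with
  | |- is_true (leq _ _) =>
      first [assumption | match goal with h : forall c, is_true (leq (S c) NR) -> _ |- _ => by apply: h end | lia]
  | |- @eq nat _ _ => lia
  end.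

(* Discharges overflow and address conditions, leaving other goals alone. *)
Ltac sc :=
  match goal with
  | |- runs _ _ _ _ _ _ _ => fail 1
  | |- forall _, _ => fail 1
  | |- _ => rewrite /upd /=; repeat split; try arith
  end.

Lemma wp_hash_leq l dst j x y f i (P : post) :
  f rLev < l -> l <= B -> rLev < N -> rLev < B -> dst < N -> dst < B ->
  safe N B f j -> safe N B f x -> safe N B f y ->
  (forall t, t <= 5 * l + (cost j + cost x + cost y + dimension m + 2) ->
   P (upd f dst (hash_oracle m (f rLev) (ev f j) (ev f x) (ev f y))) i t) ->
  wp (hash_leq l dst j x y) f i P.
Proof.
move=> + + LN LB dN dB sj sx sy.
elim: l P => [|l IH] P lev lB h; first by rewrite ltn0 in lev.
apply: wp_if => //.
- move=> /= c; apply: wp_hash => //=.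
  have E : f rLev = l by move: c; rewrite eqb0 negbK; lia.
  by rewrite -E; apply: h => /=; lia.
- move=> /= c; apply: IH => [||t ht].
  + by move: c; case: leqP => //=; lia.
  + by lia.
  + by apply: h => /=; lia.
Qed.

Lemma wp_near_query l dst x y f i (P : post) :
  f rLev < l -> l <= B -> rLev < N -> rLev < B -> dst < N -> dst < B ->
  safe N B f x -> safe N B f y ->
  (forall t, t <= 5 * l + (cost x + cost y + dimension m + 2) ->
   P (upd f dst (near_oracle m (f rLev) (ev f x) (ev f y))) i t) ->
  wp (near_query l dst x y) f i P.
Proof.
move=> + + LN LB dN dB sx sy.
elim: l P => [|l IH] P lev lB h; first by rewrite ltn0 in lev.
apply: wp_if => //.
- move=> /= c; apply: wp_near => //=.
  have E : f rLev = l by move: c; rewrite eqb0 negbK; lia.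
  by rewrite -E; apply: h => /=; lia.
- move=> /= c; apply: IH => [||t ht].
  + by move: c; case: leqP => //=; lia.
  + by lia.
  + by apply: h => /=; lia.
Qed.

Variables (k n J l G L T M H bs : nat) (Kf : nat -> nat).
(** [dom] selects the numbers that denote a point: during preprocessing there is no query, and [n]
    denotes nothing. The values [hv] belong to the analysis; the machine sees only their
    comparisons. *)
Variables (hv : nat -> nat -> nat -> nat) (dom : pred nat).
Let lam := 2 ^ l.
Hypothesis hash_oracleE : forall lev j x y, lev < k -> j < H -> dom x -> dom y ->
  hash_oracle m lev j x y = (hv lev j x <= hv lev j y).
Hypothesis hv_lt : forall lev j x, dom x -> hv lev j x < bs.
(** Memory layout: registers and constants below [NR], then the [k] key lengths, the extended labels
    from [EB], the [k * (G * L)] tables of [n] cells from [TB], and the candidate list from [LB]. *)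
Let EB := NR + k.
Let TB := EB + n.
Let LB := TB + k * (G * L) * n.
Hypothesis N_ge : LB + lam <= N.
Hypothesis B_mem : N + J + l + M + T + 2 < B.
Hypothesis B_tab : G * L + G + L + 2 < B.
Hypothesis B_lev : k * (J + 1) + 2 < B.
Hypothesis B_hash : H + 2 < B.
Hypothesis B_seg : 2 ^ J.+1 * n.+1 + 2 < B.
Hypothesis B_draw : 2 ^ (J + l).+1 + 2 < B.
Hypothesis H_ge : forall lev, lev < k -> G * L * Kf lev <= H.

Definition key lev tau x := lexkey bs (fun a => hv lev (tau * Kf lev + a) x) (Kf lev).

Definition frame (c : nat) (f f' : nat -> nat) := forall a, c <= a -> f' a = f a.

Definition cK := 10 * k + 2 * dimension m + 100.

Lemma compare_keysP f i (P : post) :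
  f rLev < k -> f rK = Kf (f rLev) -> f rTau < G * L -> dom (f rX) -> dom (f rY) ->
  (forall f' t, frame rX f f' ->
     f' rLt = (key (f rLev) (f rTau) (f rX) < key (f rLev) (f rTau) (f rY)) ->
     f' rEq = (key (f rLev) (f rTau) (f rX) == key (f rLev) (f rTau) (f rY)) ->
     t <= Kf (f rLev) * cK + 40 -> P f' i t) ->
  wp (compare_keys k) f i P.
Proof.
move=> levk fK ftau dx dy h.
set lev := f rLev in levk fK h *; set tau := f rTau in ftau h *.
have Hle := H_ge levk.
have KH : tau.+1 * Kf lev <= H by apply: leq_trans Hle; rewrite leq_mul2r ftau orbT.
have KH' : tau * Kf lev + Kf lev <= H by rewrite addnC -mulSn.
have LN : NR + k <= N by have := N_ge; rewrite /LB /TB /EB; lia.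
have NB : N < B by lia.
have litN c : c < NR -> c < N by lia.
have litB c : c < NR -> c < B by lia.
apply: wp_seq; apply: wp_store => //; try by sc.
apply: wp_seq; apply: wp_store => //; try by sc.
set hx := fun a => hv lev (tau * Kf lev + a) (f rX).
set hy := fun a => hv lev (tau * Kf lev + a) (f rY).
apply: (wp_for BE B_gt1 (b := Kf lev) (Inv := fun q g j t =>
  [/\ frame rX f g, g rLt = (lexkey bs hx q < lexkey bs hy q),
      g rEq = (lexkey bs hx q == lexkey bs hy q), j = i & t <= q * cK])) => //; try arith.
- by split=> // a ha; rewrite !updne //=; lia.
- by move=> q g j t qK [fr _ _ _ _] _; rewrite /= fr //; sc.
- move=> q g j t qK [fr gl ge -> ht] ga.
  have gX : g rX = f rX by rewrite fr.
  have gY : g rY = f rY by rewrite fr.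
  have gT : g rTau = tau by rewrite fr.
  have gK : g rK = Kf lev by rewrite fr.
  have gL : g rLev = lev by rewrite fr.
  have hle : tau * Kf lev + q < H by lia.
  apply: wp_seq; apply: wp_hash_leq; rewrite ?gL //; try lia;
    try by rewrite /= ?gT ?gK ?ga; sc.
  move=> t1 /= ht1; rewrite gT gK ga gX gY hash_oracleE // -/(hx q) -/(hy q).
  apply: wp_seq; apply: wp_hash_leq => //; rewrite /upd /= ?gL //; try lia;
    try by rewrite /= ?gT ?gK ?ga; sc.
  rewrite ?gL gT gK ga gX gY hash_oracleE // -/(hx q) -/(hy q) => t2 ht2.
  apply: wp_seq; apply: wp_store => //; rewrite /upd /= ?gl ?ge; try by sc.
  apply: wp_store => //; rewrite /upd /= ?gl ?ge; try by sc.
  split=> //; split=> //.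
  + by move=> a ha; rewrite /upd; do 5 (case: eqP => [?|_]; first lia); apply: fr.
  + rewrite /= lexkey_ltn //; last by move=> a _; split; apply: hv_lt.
    by case: (ltngtP (lexkey bs hx q)) => //= _; case: (leqP (hy q) (hx q)).
  + rewrite /= !lexkeyS.
    have := @lexkey_eq bs hx hy q.+1; rewrite !lexkeyS.
    have := @lexkey_eq bs hx hy q.
    move=> e1 e2; rewrite e2; last by move=> a _; split; apply: hv_lt.
    rewrite -addn1 iotaD all_cat /= andbT -e1; last by move=> a _; split; apply: hv_lt.
    by case: (lexkey bs hx q == _) => //=; case: (ltngtP (hx q) (hy q)).
  + rewrite /cK mulSn; move: ht ht1 ht2; rewrite /cK /=; lia.
- move=> g j t [fr gl ge -> ht] _; apply: h => //; by rewrite /=; lia.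
Qed.


Variables (lab : nat -> nat).
Hypothesis lab_lt : forall p, lab p < 2 ^ J.
Hypothesis n_le : n <= 2 ^ J.
Hypothesis n_gt0 : 0 < n.
Hypothesis dom_n : forall x, x <= n -> dom x.

(** The label is the leading digit and the position breaks ties: the values are distinct, and a
    block of labels is an interval of values. *)
Definition ext p := lab p * n + p.

Lemma ext_inj p p' : p < n -> p' < n -> ext p = ext p' -> p = p'.
Proof.
move=> pn pn' /(congr1 (modn^~ n)).
by rewrite /ext !modnMDl !modn_small.
Qed.

Lemma ext_lt p : p < n -> ext p < 2 ^ J * n.
Proof.
move=> pn; rewrite /ext; apply: (@leq_trans ((lab p).+1 * n)).
  by rewrite mulSn addnC ltn_add2r.
by rewrite leq_mul2r lab_lt orbT.
Qed.

Definition consts (f : nat -> nat) :=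
  [/\ [/\ f cN = n, f cJ = J, f cLam = lam, f cM = M & f cG = G],
      [/\ f cL = L, f cT = T, f cPow = 2 ^ J, f cD = J + l & f cTB = TB],
      f cLB = LB & forall lev, lev < k -> f (NR + lev) = Kf lev].

Definition base lev tau := TB + (lev * (G * L) + tau) * n.

Lemma base_le lev tau : lev < k -> tau < G * L -> base lev tau + n <= LB.
Proof.
move=> levk tauGL; rewrite /base /LB -addnA leq_add2l addnC -mulSn leq_mul2r.
apply/orP; right; apply: (@leq_trans (lev.+1 * (G * L))); first by rewrite mulSn; lia.
by rewrite leq_mul2r levk orbT.
Qed.

Definition table_at (f : nat -> nat) lev tau := forall p, p < n ->
  f (base lev tau + rank n (key lev tau) ext p) = p.

Definition labels_at (f : nat -> nat) := forall p, p < n -> f (EB + p) = ext p.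

Definition cS := fun lev => Kf lev * cK + 200.

Definition position lev tau target :=
  count (below (key lev tau) ext (key lev tau n) target) (iota 0 n).

Lemma position_le lev tau target : position lev tau target <= n.
Proof. by rewrite -[X in _ <= X](size_iota 0 n) count_size. Qed.

(** Cells from [LB] on are exempt because they hold the candidate list, rewritten by every attempt,
    whereas tables and constants must persist. *)
Definition frameL (c : nat) (f f' : nat -> nat) :=
  forall a, c <= a -> a < LB -> f' a = f a.

Definition data (f : nat -> nat) :=
  [/\ consts f, labels_at f &
      forall lev tau, lev < k -> tau < G * L -> table_at f lev tau].

Lemma data_frame c f f' : c <= cN -> frameL c f f' -> data f -> data f'.
Proof.
move=> cn fr [[[f1 f2 f3 f4 f5] [f6 f7 f8 f9 f10] f11 f12] fl ft].
have LN : NR + k + n <= LB by rewrite /LB /TB /EB; lia.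
split; first split.
- by split; rewrite fr //; lia.
- by split; rewrite fr //; lia.
- by rewrite fr //; lia.
- by move=> lev levk; rewrite fr ?f12 //; lia.
- by move=> p pn; rewrite fr ?fl // /EB; lia.
- move=> lev tau levk taul p pn.
  have := base_le levk taul; have := rank_lt (key lev tau) ext pn => r b.
  by rewrite fr ?ft //; rewrite /base /TB /EB in b *; lia.
Qed.

Lemma searchP f i (P : post) :
  f rLev < k -> f rK = Kf (f rLev) -> f rTau < G * L ->
  f rBase = base (f rLev) (f rTau) -> data f ->
  (forall f' t, frame rTarget f f' ->
     f' rPos = position (f rLev) (f rTau) (f rTarget) ->
     t <= J.+1 * cS (f rLev) + 40 -> P f' i t) ->
  wp (search k) f i P.
Proof.
move=> levk fK ftau fB [[[fn fJ _ _ _] [_ _ fpow _ _] _ _] flab ftabs] h.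
have ftab := ftabs _ _ levk ftau; clear ftabs.
set lev := f rLev in levk fK fB ftab h *; set tau := f rTau in ftau fB ftab h *.
have LN : NR + k <= N by have := N_ge; rewrite /LB /TB /EB; lia.
have NB : N < B by lia.
have litN c : c < NR -> c < N by lia.
have litB c : c < NR -> c < B by lia.
have bLB := base_le levk ftau.
have LBN : LB <= N by apply: leq_trans N_ge; apply: leq_addr.
have EBn : EB + n <= N.
  by apply: leq_trans LBN; rewrite /LB /TB; lia.
set tgt := f rTarget in h *; set cnt := position lev tau tgt in h *.
have cntn : cnt <= n := position_le _ _ _.
do 3 (apply: wp_seq; apply: wp_store => //; try by sc).
rewrite /upd /= fn fpow.
(* The sought position stays in a window of length [2^(J+1-q)] that starts at [rPos]; at first
   [cnt <= n <= 2^J]. [rStep] is described for [q <= J] only, since the last halving takes 1 to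
   0. *)
apply: (wp_for BE B_gt1 (b := J.+1) (Inv := fun q g j t =>
  [/\ frame rTarget f g, g rY = n, (q <= J -> g rStep = 2 ^ (J - q)), j = i &
    [/\ t <= q * cS lev, g rPos <= cnt & cnt < g rPos + 2 ^ (J.+1 - q)]])) => //; try arith.
- split=> //=; try by rewrite subn0.
    by move=> a ha; rewrite /upd; do ? (case: eqP => [?|_]; first lia).
  by split=> //; rewrite subn0 expnS /=; lia.
- move=> q g j t qJ [fr _ _ _ _] _; rewrite /= fr // fJ; sc.
- move=> q g j t qJ [fr gY gS -> [ht p1 p2]] gq.
  have gN : g cN = n by rewrite fr.
  have gtau : g rTau = tau by rewrite fr.
  have gK : g rK = Kf lev by rewrite fr.
  have gL : g rLev = lev by rewrite fr.
  have gB : g rBase = base lev tau by rewrite fr.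
  have gT : g rTarget = tgt by rewrite fr.
  have [st Est] : {st | st = 2 ^ (J - q)} by exists (2 ^ (J - q)).
  have {}gS : g rStep = st by rewrite gS // Est.
  have {}p2 : cnt < g rPos + 2 * st by rewrite Est -expnS -subSn.
  have s0 : 0 < st by rewrite Est expn_gt0.
  have stB : n + st < B.
    have sJ : st <= 2 ^ J by rewrite Est leq_exp2l // leq_subr.
    have : 2 ^ J + 2 ^ J <= 2 ^ J.+1 * n.+1 by rewrite addnn -mul2n -expnS leq_pmulr.
    by move: n_le B_seg sJ; clear; lia.
  have psB : g rPos + st < B by move: stB p1 cntn; clear; lia.
  have Sq : q < J -> st %/ 2 = 2 ^ (J - q.+1).
    by move=> qJ'; rewrite Est -(subnSK qJ') expnS mulKn.
  have Sq' : st = 2 ^ (J.+1 - q.+1) by rewrite subSS.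
  clear Est.
  have cSE : cS lev = Kf lev * cK + 200 by [].
  have fin g' t' : frame rTarget f g' -> g' rY = n -> g' rB = q ->
      g' rStep = st -> t' <= Kf lev * cK + 120 -> g' rPos <= cnt ->
      cnt < g' rPos + st ->
      wp (rStep ::= #rStep ⊘ Cst 2) g' i (fun f' j' t2 => f' rB = q /\
        [/\ frame rTarget f (upd f' rB q.+1), upd f' rB q.+1 rY = n,
          q < J -> upd f' rB q.+1 rStep = 2 ^ (J - q.+1), j' = i &
          [/\ t + ((t' + t2) + (12 + cost (#cJ ⊕ Cst 1))) <= q.+1 * cS lev,
            upd f' rB q.+1 rPos <= cnt &
            cnt < upd f' rB q.+1 rPos + 2 ^ (J.+1 - q.+1)]]).
    move=> fr' Y' B' S' ht' q1 q2; apply: wp_store => //=; try by sc.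
    rewrite /upd /=; split=> //; split=> //.
    + move=> a ha; rewrite !ifF ?fr' //; move: ha; clear; lia.
    + by move=> qJ'; rewrite S' Sq.
    + rewrite -Sq'; split=> //; rewrite mulSn cSE; move: ht ht'; rewrite cSE; clear; lia.
  clear Sq Sq'.
  apply: wp_seq; apply: wp_if => //=; rewrite ?gN ?gS ?gY.
  + by sc.
  + rewrite eqb0 negbK => le.
    have rn : g rPos + st - 1 < n by move: le s0; clear; lia.
    have [p pn rp] := rank_surj (key lev tau) ext_inj rn.
    have b43 : NR <= base lev tau by rewrite /base /TB /EB -!addnA leq_addr.
    have tp : g (base lev tau + g rPos + st - 1) = p.
      have -> : base lev tau + g rPos + st - 1 = base lev tau + (g rPos + st - 1).
        by move: s0; clear; lia.
      by rewrite -rp fr ?ftab //; move: b43; clear; lia.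
    have aB : base lev tau + g rPos + st < B by move: le bLB LBN NB; clear; lia.
    have aN : base lev tau + g rPos + st - 1 < N by move: le s0 bLB LBN; clear; lia.
    have aB' : base lev tau + g rPos < B by move: aB; clear; lia.
    apply: wp_seq; apply: wp_store => //=; rewrite ?gN ?gS ?gB; try by sc.
    rewrite tp; apply: wp_seq.
    apply: compare_keysP; rewrite /upd /= ?gL ?gtau ?gY //; try by apply: dom_n; rewrite ?(ltnW pn).
    move=> g1 t1 fr1 lt1 eq1 ht1.
    have fr1' a : rX < a -> g1 a = g a.
      by move=> ha; rewrite fr1 ?(ltnW ha) //; case: eqP ha => // ->.
    have X1 : g1 rX = p by rewrite fr1.
    have pN : EB + p < N by move: pn EBn; clear; lia.
    have pB : EB + p < B by move: pN NB; clear; lia.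
    have EBB : EB < B by move: pB; clear; lia.
    have Xe : g1 (EB + p) = ext p by rewrite fr1' ?fr ?flab //.
    have eB : ext p + 1 < B.
      have := ext_lt pn; have : 2 ^ J * n <= 2 ^ J.+1 * n.+1 by rewrite leq_mul // leq_exp2l.
      by move: B_seg; clear; lia.
    (* The probed entry has rank [rPos + st - 1], so [belowE] turns the comparison of keys into the
       comparison of positions that halves the window. *)
    have E : (g1 rLt + g1 rEq * (ext p + 1 <= g1 rTarget) != 0) =
       (g rPos + st <= cnt).
      rewrite lt1 eq1 fr1' // gT.
      have := belowE (key lev tau) ext (key lev tau n) tgt pn.
      rewrite rp -/(position _ _ _) -/cnt /below addn1 => be.
      transitivity (g rPos + st - 1 < cnt); last by move: s0; clear; lia.
      rewrite -be; case: (ltngtP (key lev tau p)) => //=; by case: (ext p < tgt).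
    have h4 : g1 rLt <= 1 by rewrite lt1 leq_b1.
    have h5 : g1 rEq * (ext p + 1 <= g1 rTarget) <= 1.
      by rewrite -[1]muln1 leq_mul // ?eq1 leq_b1.
    have h5B : g1 rEq * (ext p + 1 <= g1 rTarget) < B by apply: leq_ltn_trans h5 B_gt1.
    have h45B : g1 rLt + g1 rEq * (ext p + 1 <= g1 rTarget) < B.
      by move: h4 h5 B_hash; clear; lia.
    clear lt1 eq1.
    apply: wp_if => //=; rewrite ?X1 ?Xe ?E.
    * by rewrite -/EB; sc.
    * move=> le'; clear E.
      apply: wp_store => //=; rewrite ?fr1' ?gS //; try by sc.
      apply: fin; rewrite /upd /= ?fr1' ?gY ?gS //.
      - by move=> a ha; rewrite ifF ?fr1' ?fr //; move: ha; clear; lia.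
      - by move: ht1; clear; lia.
      - by move: p2; clear; lia.
    * move=> /eqP; rewrite -[_ == 0]negbK E => gt'; clear E; apply: wp_skip.
      apply: fin; rewrite ?fr1' ?gY ?gS //.
      - by move=> a ha; rewrite fr1' ?fr //; move: ha; clear; lia.
      - by move: ht1; clear; lia.
      - by move: gt'; clear; lia.
  + move=> /eqP; rewrite eqb0 => gt; apply: wp_skip.
    apply: fin; rewrite ?gS //; first by clear; lia.
    by move: gt cntn; clear; lia.
- move=> g j t [fr _ _ -> [ht p1 p2]] _; apply: h => //.
  + by move: p1 p2; rewrite subnn expn0; clear; lia.
  + by rewrite /=; move: ht; clear; lia.
Qed.

Variable near : nat -> nat -> bool.
Hypothesis near_oracleE : forall lev p, lev < k -> p < n ->
  near_oracle m lev p n = near lev p.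

Definition addp lev (s : seq nat) p :=
  if [&& near lev p, p \notin s & size s < lam] then rcons s p else s.

Definition list_at (f : nat -> nat) (s : seq nat) :=
  [/\ f rSize = size s, size s <= lam & forall z, z < size s -> f (LB + z) = nth 0 s z].

Definition cP := 5 * k + dimension m + lam * 50 + 100.

Lemma processP f i (P : post) s p :
  f rLev < k -> f rBase + f rLo + f rI < LB -> f (f rBase + f rLo + f rI) = p ->
  p < n -> consts f -> list_at f s ->
  (forall f' t, frameL rLo f f' -> list_at f' (addp (f rLev) s p) ->
     t <= cP -> P f' i t) ->
  wp (process k) f i P.
Proof.
move=> levk aLB fp pn [[fn _ flam _ _] _ fLB _] [fs sl fl] h.
have LN : NR + k <= LB by rewrite /LB /TB /EB; lia.
have NB : N < B by lia.
have litN c : c < NR -> c < N by lia.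
have litB c : c < NR -> c < B by lia.
have lam0 : 0 < lam by rewrite expn_gt0.
apply: wp_seq; apply: wp_store => //=; try by sc.
rewrite fp; apply: wp_seq; apply: wp_near_query; rewrite /upd /= ?fn //; try lia; try by sc.
rewrite near_oracleE // => t1 ht1.
apply: wp_if => //=; first by sc.
- rewrite eqb0 negbK => np.
  apply: wp_seq; apply: wp_store => //=; try by sc.
  rewrite /upd /=; apply: wp_seq.
  apply: (wp_for BE B_gt1 (b := size s) (Inv := fun q g j t =>
    [/\ forall a, rA < a -> g a = upd f rP p a,
        g rBit' = count_mem p (take q s), j = i & t <= q * 50])) => //; try arith.
  + split=> //; last by rewrite take0.
    by move=> a ha; rewrite /upd; do 4 (case: eqP => [?|_]; first lia).
  + by move=> q g j t qs [fr _ _ _] _; rewrite /= fr // /upd /= fs; sc.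
  + move=> q g j t qs [fr gb -> ht] gq.
    have gp : g rP = p by rewrite fr.
    have gLB : g cLB = LB by rewrite fr // /upd /= fLB.
    have gl : g (LB + q) = nth 0 s q.
      by rewrite fr ?updne ?fl //; lia.
    have cq : count_mem p (take q.+1 s) = count_mem p (take q s) + (nth 0 s q == p).
      by rewrite (take_nth 0) // -cats1 count_cat /= addn0.
    have cB : count_mem p (take q s) <= q.
      by rewrite (leq_trans (count_size _ _)) // size_take qs.
    have eqb : (nth 0 s q <= p) * (p <= nth 0 s q) = (nth 0 s q == p).
      by rewrite mulnb -eqn_leq.
    have qlam : q < lam by lia.
    have LBq : LB + q < N by lia.
    have LBqB : LB + q < B by lia.
    have cntB : count_mem p (take q s) + (nth 0 s q == p) < B by lia.
    apply: wp_store => //=; rewrite ?gLB ?gq ?gl ?gp ?gb ?eqb; try by sc.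
    split; first by rewrite updne.
    split=> //.
    * by move=> a ha; rewrite /upd; do 2 (case: eqP => [?|_]; first lia); apply: fr.
    * by rewrite /=; lia.
  move=> g j t [fr gb -> ht] _.
  have gp : g rP = p by rewrite fr.
  have gs : g rSize = size s by rewrite fr // /upd /= fs.
  have gLB : g cLB = LB by rewrite fr // /upd /= fLB.
  have glam : g cLam = lam by rewrite fr // /upd /= flam.
  have frL : frameL rLo f g.
    by move=> a a1 a2; rewrite fr ?updne //; lia.
  have lL : list_at g s.
    split=> // z zs; rewrite fr; last by lia.
    by rewrite updne ?fl //; lia.
  rewrite take_size in gb.
  apply: wp_if => //=; rewrite ?gb.
  + by sc.
  + move=> ps; apply: wp_skip; apply: h => //; last by rewrite /cP; lia.
    by rewrite /addp np -has_pred1 has_count lt0n ps.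
  + move=> ps; have pns : p \notin s by rewrite -has_pred1 has_count ps.
    apply: wp_if => //=; rewrite ?gs ?glam.
    * by sc.
    * rewrite eqb0 negbK => sz.
      apply: wp_seq; apply: wp_store => //=; rewrite ?gLB ?gs ?gp; try by sc.
      apply: wp_store => //=; try by rewrite /upd /=; sc.
      rewrite [upd g _ _ rSize]updne; last by lia.
      rewrite gs; apply: h; last by rewrite /cP; lia.
      - move=> a a1 a2; rewrite !updne; try lia; exact: frL.
      - rewrite /addp np pns /= ifT; last by lia.
        split; rewrite ?size_rcons ?updE; try by lia.
        move=> z zs; rewrite updne; last by lia.
        rewrite nth_rcons; case: ltngtP => zc; last by rewrite zc updE.
          by rewrite updne ?fr ?updne ?fl //; lia.
        by lia.
    * move/eqP; rewrite eqb0 => sz; apply: wp_skip; apply: h => //.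
        by rewrite /addp np pns /= ifF //; apply/negbTE; rewrite -addn1.
      by rewrite /cP; lia.
- move/eqP; rewrite eqb0 => np; apply: wp_skip.
  apply: h; last by rewrite /cP; lia.
  + by move=> a a1 a2; do 2 (case: eqP => [?|_]; first lia).
  + by rewrite /addp (negbTE np).
Qed.

Definition byext : seq nat := sort (fun p p' => ext p <= ext p') (iota 0 n).

Variable col : nat -> nat -> nat -> bool.
Hypothesis colE : forall lev tau p, lev < k -> tau < G * L -> p < n ->
  col lev tau p = (key lev tau p == key lev tau n).

Definition inrange lo hi p := lo <= ext p < hi.

(** Points with equal keys are ordered by [ext], so this list depends on the hash functions only
    through [col], their collisions with the query. This is what later allows each hash function to
    be replaced by a finite collision pattern. *)
Definition ents lev tau lo hi : seq nat :=
  [seq p <- byext | col lev tau p && inrange lo hi p].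

Lemma mem_ents lev tau lo hi p :
  (p \in ents lev tau lo hi) = [&& p < n, col lev tau p & inrange lo hi p].
Proof. by rewrite mem_filter mem_sort mem_iota /= add0n andbC. Qed.

Lemma size_ents lev tau lo hi : lev < k -> tau < G * L -> lo <= hi ->
  size (ents lev tau lo hi) = position lev tau hi - position lev tau lo.
Proof.
move=> levk taul lohi; rewrite size_filter /position /below.
have -> : count (fun p => col lev tau p && inrange lo hi p) byext =
  count (fun p => col lev tau p && inrange lo hi p) (iota 0 n).
  by apply/permP; rewrite perm_sort.
apply/eqP; rewrite eq_sym -(eqn_add2r (count (below (key lev tau) ext (key lev tau n) lo) (iota 0 n))).
rewrite subnK; last first.
  by apply: sub_count => p; rewrite /below; lia.
apply/eqP; have : {in iota 0 n, forall p, p < n} by move=> p; rewrite mem_iota.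
elim: (iota 0 n) => //= p s IH h; rewrite IH; last by move=> x xs; apply: h; rewrite inE xs orbT.
rewrite colE //; last by apply: h; rewrite inE eqxx.
rewrite /below /inrange; case: (ltngtP (key lev tau p)) => //= _; lia.
Qed.

Lemma count_sorted_lt (g : nat -> nat) (s : seq nat) z : z < size s ->
  sorted (fun p p' => g p < g p') s ->
  count (fun p => g p < g (nth 0 s z)) s = z.
Proof.
have tr : transitive (fun p p' => g p < g p') by move=> a b c; apply: ltn_trans.
move=> zs so; rewrite -{2}(cat_take_drop z s) count_cat.
have -> : count (fun p => g p < g (nth 0 s z)) (take z s) = z.
  rewrite -[RHS](size_takel (ltnW zs)); apply/eqP; rewrite -all_count.
  apply/(all_nthP 0) => i; rewrite size_takel ?(ltnW zs) // => iz.
  by rewrite nth_take //; apply: (sorted_ltn_nth tr) => //; rewrite inE //; lia.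
rewrite (_ : count _ (drop z s) = 0) ?addn0 //; apply/eqP; rewrite -leqn0 leqNgt -has_count.
apply/(has_nthP 0) => -[i]; rewrite size_drop nth_drop => iz.
case: i iz => [|i] iz; first by rewrite addn0 ltnn.
have := sorted_ltn_nth tr 0 so z (z + i.+1).
by rewrite !inE => /(_ zs); lia.
Qed.

Lemma byext_sorted : sorted (fun p p' => ext p < ext p') byext.
Proof.
have so : sorted (fun p p' => ext p <= ext p') byext.
  by apply: sort_sorted => p p'; apply: leq_total.
have u : uniq byext by rewrite sort_uniq iota_uniq.
have hn : {in byext, forall p, p < n} by move=> p; rewrite mem_sort mem_iota.
move: so u hn; rewrite /sorted; case: byext => // x s.
elim: s x => //= y s IH x /andP[xy so] /andP[xn u] hn.
rewrite IH // ?andbT; last by move=> p ps; apply: hn; rewrite inE ps orbT.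
rewrite ltn_neqAle xy andbT; apply: contraNneq xn => e.
by rewrite (ext_inj _ _ e) ?mem_head //; apply: hn; rewrite ?inE ?eqxx ?orbT.
Qed.

(** The points that precede an entry are those below the range and those earlier within it; hence
    the range fills consecutive cells, in the order of [ext]. *)
Lemma rank_ents lev tau lo hi z : lev < k -> tau < G * L ->
  z < size (ents lev tau lo hi) ->
  rank n (key lev tau) ext (nth 0 (ents lev tau lo hi) z) = position lev tau lo + z.
Proof.
move=> levk taul zs; set p := nth 0 _ z.
have tr : transitive (fun p p' => ext p < ext p') by move=> a b c; apply: ltn_trans.
have so : sorted (fun p p' => ext p < ext p') (ents lev tau lo hi).
  exact: (sorted_filter tr _ byext_sorted).
rewrite -[in RHS](count_sorted_lt zs so) -/p.
have : p \in ents lev tau lo hi by apply: mem_nth.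
rewrite mem_ents colE => [|//|//|]; last first.
  by have : p \in ents lev tau lo hi by [apply: mem_nth]; rewrite mem_ents => /andP[].
case/and3P => pn /eqP kp /andP[lop hip].
rewrite /rank /position.
rewrite [count _ (ents _ _ _ _)]count_filter.
have -> : count (predI (fun x => ext x < ext p) (fun x => col lev tau x && inrange lo hi x)) byext =
  count (predI (fun x => ext x < ext p) (fun x => col lev tau x && inrange lo hi x)) (iota 0 n).
  by apply/permP; rewrite perm_sort.
have : {in iota 0 n, forall p, p < n} by move=> x; rewrite mem_iota.
elim: (iota 0 n) => //= x s IH h; rewrite IH; last by move=> y ys; apply: h; rewrite inE ys orbT.
rewrite colE //; last by apply: h; rewrite inE eqxx.
rewrite /below /inrange kp; case: (ltngtP (key lev tau x)) => //= _; lia.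
Qed.

Lemma entry_at f lev tau lo hi z : data f -> lev < k -> tau < G * L ->
  z < size (ents lev tau lo hi) ->
  f (base lev tau + position lev tau lo + z) = nth 0 (ents lev tau lo hi) z.
Proof.
move=> [_ _ ft] levk taul zs; rewrite -addnA -(rank_ents levk taul zs) ft //.
by have := mem_nth 0 zs; rewrite mem_ents => /andP[].
Qed.

Definition scan lev lo hi (acc : seq nat * nat) tau :=
  let e := ents lev tau lo hi in
  if size e <= acc.2 then (foldl (addp lev) acc.1 e, acc.2 - size e) else acc.

Definition cE := cP + 40.
Definition cT' lev := 2 * (J.+1 * cS lev) + 300.

(** The remaining budget serves as a potential: an entry costs at most [cE], paid by the decrease of
    [rBudget]. Summed over a group, reading costs [T * cE] besides the overhead of the [L]
    searches. *)
Lemma scan_tableP f i (P : post) s :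
  f rLev < k -> f rK = Kf (f rLev) -> f rG < G -> f rT < L ->
  f rSegLo <= f rSegHi -> data f -> list_at f s ->
  (forall f' t, frameL rT f f' ->
     let acc := scan (f rLev) (f rSegLo) (f rSegHi) (s, f rBudget) (f rG * L + f rT) in
     list_at f' acc.1 -> f' rBudget = acc.2 ->
     t + f' rBudget * cE <= f rBudget * cE + cT' (f rLev) -> P f' i t) ->
  wp (scan_table k) f i P.
Proof.
move=> levk fK fG fT lohi df ls h.
have [[[fn _ _ _ fcG] [fcL _ _ _ fTB] _ _] _ _] := df.
set lev := f rLev in levk fK h *; set tau := f rG * L + f rT in h *.
have taul : tau < G * L.
  apply: (@leq_trans ((f rG).+1 * L)); first by rewrite mulSn /tau; lia.
  by rewrite leq_mul2r fG orbT.
have bLB := base_le levk taul.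
have LBN : LB <= N by apply: leq_trans N_ge; apply: leq_addr.
have NB : N < B by lia.
have litN c : c < NR -> c < N by lia.
have litB c : c < NR -> c < B by lia.
have LN : NR + k <= LB by rewrite /LB /TB /EB; lia.
have bE : base lev tau = TB + (lev * (G * L) + tau) * n by [].
have levGL : lev * (G * L) + tau <= k * (G * L).
  apply: (@leq_trans (lev.+1 * (G * L))); first by rewrite mulSn; lia.
  by rewrite leq_mul2r levk orbT.
have kGL : k * (G * L) < B.
  apply: leq_ltn_trans NB; apply: leq_trans LBN; rewrite /LB.
  by apply: leq_trans (leq_addl _ _); apply: leq_pmulr.
set lo := f rSegLo in lohi h *; set hi := f rSegHi in lohi h *.
set b := f rBudget in h *.
have tauL : tau = f rG * L + f rT by [].
have nk : (lev * (G * L) + tau) * n <= LB.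
  by have := bLB; rewrite /base; lia.
do 2 (apply: wp_seq; apply: wp_store => //=; rewrite /upd /= ?fn ?fcG ?fcL ?fTB -?tauL; try by sc).
apply: wp_seq; apply: wp_store => //=; rewrite /upd /= ?fn ?fcG ?fcL ?fTB -?tauL; try by sc.
apply: wp_seq; apply: searchP; rewrite /upd /= //.
move=> f1 t1 fr1 pos1 ht1.
have f1E a : rLo <= a -> a != rTau -> a != rBase -> f1 a = f a.
  by move=> a1 a2 a3; rewrite fr1 ?(negbTE a2) ?(negbTE a3) ?ifF //; lia.
have f1tau : f1 rTau = tau by rewrite fr1.
have f1base : f1 rBase = base lev tau by rewrite fr1.
do 2 (apply: wp_seq; apply: wp_store => //=; rewrite /upd /=; try by sc).
apply: wp_seq; apply: searchP; rewrite /upd /= ?f1tau ?f1base ?(f1E rLev) ?(f1E rK) ?(f1E rSegHi) //.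
  apply: (data_frame (leqnn cN) _ df) => a a1 a2; rewrite !ifF ?f1E //; lia.
move=> f2 t2 fr2 pos2 ht2.
have f2E a : rI <= a -> a != rTau -> a != rBase -> f2 a = f a.
  by move=> a1 a2 a3; rewrite fr2 ?ifF ?f1E //; lia.
have f2tau : f2 rTau = tau by rewrite fr2.
have f2base : f2 rBase = base lev tau by rewrite fr2.
have f2lo : f2 rLo = position lev tau lo by rewrite fr2.
have f2s : list_at f2 s.
  case: ls => s1 s2 s3; split=> //; first by rewrite fr2 //= fr1.
  by move=> z zs; rewrite f2E ?s3 //; lia.
have d2 : data f2.
  by apply: (data_frame (leqnn cN) _ df) => a a1 a2; rewrite f2E //; lia.
apply: wp_seq; apply: wp_store => //=; rewrite /upd /=; try by sc.
set e := ents lev tau lo hi.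
have se : size e = position lev tau hi - position lev tau lo by apply: size_ents.
apply: wp_if => //=; first by sc.
- rewrite eqb0 negbK pos2 f2lo -/hi -/lev -se (f2E rBudget) // => eb.
  have sen : size e <= n.
    by rewrite size_filter (leq_trans (count_size _ _)) // size_sort size_iota.
  apply: wp_seq; apply: wp_store => //=; rewrite /upd /= ?f2lo -?se; try by sc.
  set h0 := fun b0 => _.
  have h0E a : rI <= a -> a != rTau -> a != rBase -> a != rBudget -> h0 a = f a.
    by move=> a1 a2 a3 a4; rewrite /h0 !ifF ?f2E //; lia.
  apply: (wp_for BE B_gt1 (b := size e) (Inv := fun q g j t =>
    [/\ forall a, rLo <= a -> a < LB -> a != rI -> g a = h0 a,
        list_at g (foldl (addp lev) s (take q e)), j = i & t <= q * cE])) => //; try arith.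
  + split=> //; first by move=> a a1 a2 a3; rewrite updne.
    by case: f2s => s1 s2 s3; rewrite take0.
  + move=> q g j t qe [fr _ _ _] gq; rewrite /= !fr //; try lia.
    by rewrite /h0 /= f2lo se; sc.
  + move=> q g j t qe [fr gl -> ht] gq.
    have gbase : g rBase = base lev tau by rewrite fr //; lia.
    have glo : g rLo = position lev tau lo by rewrite fr //; lia.
    have glev : g rLev = lev by rewrite fr ?h0E //; lia.
    have qpn : position lev tau lo + q < n.
      by have := position_le lev tau hi; lia.
    have gp : g (base lev tau + position lev tau lo + q) = nth 0 e q.
      have b43 : NR <= base lev tau by rewrite /base /TB /EB -!addnA leq_addr.
      by rewrite -(entry_at d2 levk taul qe) fr //; lia.
    have pn : nth 0 e q < n by have := mem_nth 0 qe; rewrite mem_ents => /andP[].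
    have dg : data g.
      apply: (data_frame (leqnn cN) _ d2) => a a1 a2.
      by rewrite fr /h0 /= ?ifF //; lia.
    apply: (@processP g i _ _ (nth 0 e q)); rewrite ?glev ?gbase ?glo ?gq //; first by lia.
    * by case: dg.
    * exact: gl.
    move=> f' t' fr' ls' ht'; split; first by rewrite fr' //; lia.
    split=> //.
    * move=> a a1 a2 a3; rewrite updne // fr' // fr //.
    * rewrite (take_nth 0) // -cats1 foldl_cat /=.
      case: ls' => s1 s2 s3; split=> // z zs; rewrite updne ?s3 //; lia.
    * have cEE : cE = cP + 40 by [].
      by rewrite mulSn /=; lia.
  + move=> g j t [fr gl -> ht] _; rewrite take_size in gl.
    have gb : g rBudget = b - size e.
      by rewrite fr; try lia; rewrite /h0 /= f2E.
    have sc' : scan lev lo hi (s, b) tau = (foldl (addp lev) s e, b - size e).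
      by rewrite /scan -/e eb.
    apply: h; rewrite ?sc' //.
    * by move=> a a1 a2; rewrite fr ?h0E //; lia.
    * rewrite gb /=; have : (b - size e) * cE + size e * cE = b * cE.
        by rewrite -mulnDl subnK.
      by move: ht1 ht2; rewrite -/lev /cT'; lia.
- move/eqP; rewrite eqb0 pos2 f2lo -/hi -/lev -se (f2E rBudget) // => eb.
  apply: wp_skip.
  have sc' : scan lev lo hi (s, b) tau = (s, b) by rewrite /scan -/e (negbTE eb).
  apply: h; rewrite ?sc' //=.
  + by move=> a a1 a2; rewrite ifF ?f2E //; lia.
  + by rewrite f2E.
  + by rewrite f2E //; move: ht1 ht2; rewrite -/lev /cT'; lia.
Qed.

Definition scan_group lev lo hi (s : seq nat) g : seq nat :=
  (foldl (scan lev lo hi) (s, T) [seq g * L + t | t <- iota 0 L]).1.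

Definition found lev lo hi : seq nat :=
  foldl (scan_group lev lo hi) [::] (iota 0 G).

Definition pick_found (w z : nat) lev (ans : nat) : nat :=
  let lo := z %/ lam %/ w * (w * n) in
  let s := found lev lo (lo + w * n) in
  if z %% lam < size s then nth 0 s (z %% lam) else ans.

Definition cA lev := G * (L * (cT' lev + 40) + T * cE + 60) + 200.

Lemma attemptP f i (P : post) :
  f rLev < k -> f rK = Kf (f rLev) -> data f -> 0 < f rW -> f rW <= 2 ^ J ->
  f rZ < 2 ^ (J + l) ->
  (forall f' t, frameL rAtt f f' ->
     f' rAns = pick_found (f rW) (f rZ) (f rLev) (f rAns) ->
     t <= cA (f rLev) -> P f' i t) ->
  wp (attempt k) f i P.
Proof.
move=> levk fK df w0 wJ zJ h.
have [[[fn _ flam _ fcG] [fcL fcT _ _ fTB] fLB _] _ _] := df.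
set lev := f rLev in levk fK h *; set w := f rW in w0 wJ h *.
set z := f rZ in zJ h *.
have lam0 : 0 < lam by rewrite expn_gt0.
have LBN : LB <= N by apply: leq_trans N_ge; apply: leq_addr.
have LN : NR + k <= LB by rewrite /LB /TB /EB; lia.
have NB : N < B by lia.
have litN c : c < NR -> c < N by lia.
have litB c : c < NR -> c < B by lia.
have sJ : z %/ lam < 2 ^ J by rewrite ltn_divLR // -expnD.
have seg : 2 ^ J * n + 2 ^ J * n + 2 < B.
  have : 2 ^ J * n + 2 ^ J * n <= 2 ^ J.+1 * n.+1.
    by rewrite -mulnDl addnn -mul2n -expnS leq_mul.
  by lia.
have wn : w * n <= 2 ^ J * n by rewrite leq_mul.
have ww : z %/ lam %/ w * w <= 2 ^ J by apply: leq_trans (leq_divM _ _) (ltnW sJ).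
set lo := z %/ lam %/ w * (w * n).
have lo_le : lo <= 2 ^ J * n by rewrite /lo mulnA leq_mul.
have nwB : w * n < B by lia.
have zl : z %/ lam * lam <= z by apply: leq_divM.
have zB : z < B by have : 2 ^ (J + l) <= 2 ^ (J + l).+1 by [rewrite leq_exp2l]; lia.
apply: wp_seq; apply: wp_store => //=; rewrite /upd /= ?flam; try by sc.
apply: wp_seq; apply: wp_store => //=; rewrite /upd /= ?flam; try by sc.
apply: wp_seq; apply: wp_store => //=; rewrite /upd /= ?fn -/w -/z -/lo; try by sc.
apply: wp_seq; apply: wp_store => //=; rewrite /upd /= ?fn -/w -/z -/lo; try by sc.
apply: wp_seq; apply: wp_store => //=; rewrite /upd /=; try by sc.
set h0 := fun b0 => _.
set hi := lo + w * n in h0 *.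
have h0E a : rZ <= a -> h0 a = f a by move=> a1; rewrite /h0 /= !ifF //; lia.
have d0 : data h0.
  by apply: (data_frame (leqnn cN) _ df) => a a1 a2; rewrite h0E //; lia.
apply: wp_seq.
apply: (wp_for BE B_gt1 (b := G) (Inv := fun q g j t =>
  [/\ forall a, rSegLo <= a -> a < LB -> g a = h0 a,
      list_at g (foldl (scan_group lev lo hi) [::] (iota 0 q)),
      j = i & t <= q * (L * (cT' lev + 40) + T * cE + 60)])) => //; try arith.
- by split=> // a a1 a2; rewrite updne //; lia.
- by move=> q g j t qG [fr _ _ _] _; rewrite /= fr; try lia; rewrite /h0 /= fcG; sc.
- move=> q g j t qG [fr gl -> ht] gq.
  have gT : g cT = T by rewrite fr; [rewrite /h0 /= fcT | lia | lia].
  apply: wp_seq; apply: wp_store => //=; rewrite /upd /= ?gT; try by sc.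
  set g0 := fun b0 => _.
  set s0 := foldl (scan_group lev lo hi) [::] (iota 0 q) in gl *.
  have gl0 : list_at g0 s0 by [].
  have g0E a : rG <= a -> g0 a = g a by move=> a1; rewrite /g0 ifF //; lia.
  pose acc q' := foldl (scan lev lo hi) (s0, T) [seq q * L + t | t <- iota 0 q'].
  apply: (wp_for BE B_gt1 (b := L) (Inv := fun q' g' j t =>
    [/\ forall a, rG <= a -> a < LB -> g' a = g0 a, list_at g' (acc q').1,
        g' rBudget = (acc q').2, j = i &
        t + g' rBudget * cE <= q' * (cT' lev + 40) + T * cE])) => //; try arith.
  + by split=> // a a1 a2; rewrite updne //; lia.
  + by move=> q' g' j' t' _ [fr' _ _ _ _] _; rewrite /= fr'; try lia; rewrite g0E // fr; try lia; rewrite /h0 /= fcL; sc.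
  + move=> q' g' j' t' qL [fr' gl' gb' -> ht'] gq'.
    have E a : rSegLo <= a -> a < LB -> g' a = h0 a.
      by move=> a1 a2; rewrite fr' ?g0E ?fr //; lia.
    have d' : data g'.
      by apply: (data_frame (leqnn cN) _ d0) => a a1 a2; rewrite E //; lia.
    have gG : g' rG = q by rewrite fr' //; lia.
    apply: scan_tableP; rewrite ?(E rLev) ?(E rK) ?(E rSegLo) ?(E rSegHi) ?gG ?gq' //; try lia.
      by rewrite /h0 /= leq_addr.
      exact: gl'.
    move=> f' t1 fr1; rewrite /h0 /= -/lo -/hi -/lev.
    have accS : scan lev lo hi ((acc q').1, g' rBudget) (q * L + q') = acc q'.+1.
      by rewrite gb' -surjective_pairing /acc -[in RHS]addn1 iotaD map_cat foldl_cat /= add0n.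
    rewrite accS => ls1 b1 ht1.
    split; first by rewrite fr1 //; lia.
    split=> //.
    * by move=> a a1 a2; rewrite updne ?fr1 ?fr' //; lia.
    * by rewrite updne // mulSn /= in ht1 *; lia.
  + move=> g' j' t' [fr' gl' gb' -> ht'] _; split; first by rewrite fr' //; lia.
    have sg : foldl (scan_group lev lo hi) [::] (iota 0 q.+1) = (acc L).1.
      by rewrite -addn1 iotaD foldl_cat /= add0n.
    split=> //.
    * by move=> a a1 a2; rewrite ifF ?fr' ?g0E ?fr //; lia.
    * by rewrite -[foldl _ _ _]/(foldl (scan_group lev lo hi) [::] (iota 0 q.+1)) sg.
    * by rewrite mulSn /=; lia.
- move=> g j t [fr gl -> ht] _.
  rewrite -/(found lev lo hi) in gl.
  have gs : g rSize = size (found lev lo hi) by case: gl.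
  have gu : g rU = z %% lam.
    by rewrite fr; [rewrite /h0 /= {1}(divn_eq z lam) addKn | lia | lia].
  have gLB : g cLB = LB by rewrite fr; [rewrite /h0 /= fLB | lia | lia].
  have gA : g rAns = f rAns by rewrite fr //; lia.
  have ul : z %% lam < lam by rewrite ltn_mod.
  have sl : size (found lev lo hi) <= lam by case: gl.
  have pf : pick_found w z lev (f rAns) = if z %% lam < size (found lev lo hi)
    then nth 0 (found lev lo hi) (z %% lam) else f rAns by [].
  have G0 : G * (L * (cT' lev + 40) + T * cE + 60) = cA lev - 200 by rewrite /cA addnK.
  have cA2 : 200 <= cA lev by rewrite /cA leq_addl.
  apply: wp_if => //=; rewrite ?gs ?gu.
  + by sc.
  + rewrite eqb0 negbK addn1 => us.
    have gn : g (LB + z %% lam) = nth 0 (found lev lo hi) (z %% lam) by case: gl => _ _ ->.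
    apply: wp_store => //=; rewrite ?gLB ?gu; try by sc.
    rewrite gn; apply: h.
    * by move=> a a1 a2; rewrite updne ?fr ?h0E //; lia.
    * by rewrite updE pf us.
    * by lia.
  + move/eqP; rewrite eqb0 addn1 => us; apply: wp_skip; apply: h.
    * by move=> a a1 a2; rewrite fr ?h0E //; lia.
    * by rewrite pf (negbTE us) gA.
    * by lia.
Qed.

Lemma all_foldl_addp (Q : pred nat) lev s e :
  all Q s -> all Q e -> all Q (foldl (addp lev) s e).
Proof.
elim: e s => //= p e IH s as_ /andP[qp ae]; apply: IH => //.
by rewrite /addp; case: ifP => // _; rewrite all_rcons qp.
Qed.

Lemma found_lt lev lo hi : all (fun p => p < n) (found lev lo hi).
Proof.
rewrite /found; elim/last_ind: (iota 0 G) => //= s g IH; rewrite -cats1 foldl_cat /=.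
rewrite /scan_group; set s0 := foldl _ _ s in IH *.
have : all (fun p => p < n) (s0, T).1 by [].
elim: [seq _ | _ <- _] (s0, T) => //= tau r IHr acc aacc.
apply: IHr; rewrite /scan; case: ifP => // _ /=.
apply: all_foldl_addp => //; apply/allP => p; rewrite mem_ents => /andP[] //.
Qed.

Lemma pick_found_le w z lev ans : ans <= n -> pick_found w z lev ans <= n.
Proof.
rewrite /pick_found; case: ifP => // us _.
by apply: ltnW; apply: (allP (found_lt _ _ _)); apply: mem_nth.
Qed.

Definition coinseq i D := [seq coin_oracle m j | j <- iota i D].

Lemma drawP r D f i (P : post) :
  rZ < r -> r < NR -> f r = D -> 2 ^ D.+1 < B -> D.+1 < B ->
  (forall f' t, (forall a, a != rBit -> a != rA -> a != rZ -> f' a = f a) ->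
     f' rZ = bin (coinseq i D) -> t <= D * 40 + 40 -> P f' (i + D) t) ->
  wp (draw #r) f i P.
Proof.
move=> r1 r2 fr0 DB DB' h.
have LBN : LB <= N by apply: leq_trans N_ge; apply: leq_addr.
have LN : NR + k <= LB by rewrite /LB /TB /EB; lia.
have NB : N < B by lia.
have litN c : c < NR -> c < N by lia.
have litB c : c < NR -> c < B by lia.
apply: wp_seq; apply: wp_store => //=; try by sc.
apply: (wp_for BE B_gt1 (b := D) (Inv := fun q g j t =>
  [/\ forall a, a != rBit -> a != rA -> a != rZ -> g a = f a,
      g rZ = bin (coinseq i q), j = i + q & t <= q * 40])) => //; try arith.
- split=> //; last by rewrite addn0.
  by move=> a a1 a2 a3; rewrite !updne.
- by move=> q g j t qD [fr _ _ _] _; rewrite /= fr //; try lia; sc.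
- move=> q g j t qD [fr gz -> ht] gq.
  have zq : bin (coinseq i q) < 2 ^ q.
    by have := bin_lt (coinseq i q); rewrite size_map size_iota.
  have qDe : 2 ^ q.+1 <= 2 ^ D.+1 by rewrite leq_exp2l //; lia.
  have q2 : 2 ^ q.+1 = 2 ^ q + 2 ^ q by rewrite expnS mul2n addnn.
  have binS : bin (coinseq i q.+1) = bin (coinseq i q) + bin (coinseq i q) + coin_oracle m (i + q).
    by rewrite /coinseq -[in LHS]addn1 iotaD map_cat /= bin_rcons.
  apply: wp_seq; apply: wp_toss => //=; try by sc.
  apply: wp_store => //=; rewrite /upd /= ?gz -?binS; try by sc.
  split=> //; split=> //.
  + by move=> a a1 a2 a3; rewrite !ifF ?fr //; lia.
  + by rewrite addnS.
  + by rewrite mulSn; lia.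
- by move=> g j t [fr gz -> ht] _; apply: h => //=; lia.
Qed.

Variable KM : nat.
Hypothesis KM_ge : forall lev, lev < k -> Kf lev <= KM.

Definition cAM := G * (L * (2 * (J.+1 * (KM * cK + 200)) + 300 + 40) + T * cE + 60) + 200.

Lemma cA_le lev : lev < k -> cA lev <= cAM.
Proof.
move=> levk; rewrite /cA /cAM leq_add2r leq_mul2l; apply/orP; right.
rewrite !leq_add2r leq_mul2l; apply/orP; right.
rewrite /cT' /cS !leq_add2r !leq_mul2l /= leq_add2r leq_mul2r.
by rewrite KM_ge ?orbT.
Qed.

Definition level j := (j * k) %/ (J + 1).

(** The attempts of all rates are numbered consecutively: [e %/ M] recovers the rate, and the coins
    of attempt [e] start at [i0 + e * (J + l)] whatever happened before. *)
Definition att_step i0 ans e :=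
  let jj := e %/ M in
  if ans < n then ans
  else pick_found (2 ^ jj) (bin (coinseq (i0 + e * (J + l)) (J + l))) (level (J - jj)) ans.

Definition query_ans i0 : nat := foldl (att_step i0) n (iota 0 (J.+1 * M)).

Definition cQ := J.+1 * (M * (cAM + (J + l) * 40 + 100) + 100) + 100.

Lemma foldl_att_le i0 s : foldl (att_step i0) n s <= n.
Proof.
elim/last_ind: s => //= s e IH; rewrite -cats1 foldl_cat /= {1}/att_step.
by case: ifP => // _; apply: pick_found_le.
Qed.

Hypothesis k_gt0 : 0 < k.

Lemma level_lt j : j <= J -> level j < k.
Proof.
by move=> jJ; rewrite /level ltn_divLR ?addn1 // mulnC ltn_mul2l k_gt0 ltnS.
Qed.

Lemma queryP f i (P : post) :
  data f ->
  (forall f' t, f' 0 = query_ans i -> data f' ->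
     t <= cQ -> P f' (i + J.+1 * M * (J + l)) t) ->
  wp (query_prog k) f i P.
Proof.
move=> df h.
have [[[fn fJ _ fM _] [_ _ _ fD _] _ fK] _ _] := df.
have LBN : LB <= N by apply: leq_trans N_ge; apply: leq_addr.
have LN : NR + k <= LB by rewrite /LB /TB /EB; lia.
have NB : N < B by lia.
have litN c : c < NR -> c < N by lia.
have litB c : c < NR -> c < B by lia.
have nN : n + n < B.
  have : 2 ^ J + 2 ^ J <= 2 ^ J.+1 * n.+1 by rewrite addnn -mul2n -expnS leq_pmulr.
  by lia.
do 2 (apply: wp_seq; apply: wp_store => //=; rewrite /upd /= ?fn; try by sc).
set h0 := fun b0 => _.
have h0E a : NR - 11 <= a -> a != rW -> h0 a = f a.
  by move=> a1 a2; rewrite /h0 /= !ifF //; lia.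
apply: wp_seq.
apply: (wp_for BE B_gt1 (b := J.+1) (Inv := fun q g j t =>
  [/\ forall a, cN <= a -> a < LB -> g a = f a,
      g rAns = foldl (att_step i) n (iota 0 (q * M)), g rW = 2 ^ q,
      j = i + q * M * (J + l) &
      t <= q * (M * (cAM + (J + l) * 40 + 100) + 100)])) => //; try arith.
- split=> //; last by rewrite addn0.
  by move=> a a1 a2; rewrite updne ?h0E //; lia.
- by move=> q g j t qJ [fr _ _ _ _] _; rewrite /= fr; try lia; rewrite fJ; sc.
- move=> q g j t qJ [fr gA gW -> ht] gq.
  have gJ : g cJ = J by rewrite fr //; lia.
  have gK lev : lev < k -> g (NR + lev) = Kf lev by move=> levk; rewrite fr ?fK //; lia.
  have qlev : level (J - q) < k by apply: level_lt; lia.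
  have JkB : (J - q) * k <= k * (J + 1) by rewrite mulnC leq_mul2l; apply/orP; right; lia.
  apply: wp_seq; apply: wp_store => //=; rewrite ?gJ ?gq; try by sc.
  rewrite -/(level (J - q)); apply: wp_seq; apply: wp_store => //=; rewrite /upd /=; try by sc.
  rewrite gK //; apply: wp_seq.
  set g0 := fun b0 => _.
  have g0E a : rW <= a -> g0 a = g a by move=> a1; rewrite /g0 /= !ifF //; lia.
  apply: (wp_for BE B_gt1 (b := M) (Inv := fun q' g' j t =>
    [/\ forall a, rJJ <= a -> a < LB -> g' a = g0 a,
        g' rAns = foldl (att_step i) n (iota 0 (q * M + q')),
        j = i + (q * M + q') * (J + l) &
        t <= q' * (cAM + (J + l) * 40 + 100)])) => //; try arith.
  + split=> //; last by rewrite addn0.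
      by move=> a a1 a2; rewrite updne //; lia.
    by rewrite addn0 -gA.
  + by move=> q' g' j' t' _ [fr' _ _ _] _; rewrite /= fr'; try lia; rewrite g0E // fr; try lia; rewrite fM; sc.
  + move=> q' g' j' t' qM [fr' gA' -> ht'] gq'.
    have gD : g' cD = J + l by rewrite fr'; try lia; rewrite g0E // fr //; lia.
    have dg' : data g'.
      apply: (data_frame (leqnn cN) _ df) => a a1 a2.
      by rewrite fr'; try lia; rewrite g0E ?fr //; lia.
    apply: wp_seq; apply: (@drawP _ (J + l)) => //; try arith.
    move=> g1 t1 fr1 gz1 ht1.
    have g1A : g1 rAns = foldl (att_step i) n (iota 0 (q * M + q')) by rewrite fr1.
    have g1n : g1 cN = n by rewrite fr1 // fr'; try lia; rewrite g0E // fr //; lia.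
    have aln := foldl_att_le i (iota 0 (q * M + q')).
    have stepS : foldl (att_step i) n (iota 0 (q * M + q'.+1)) =
      att_step i (foldl (att_step i) n (iota 0 (q * M + q'))) (q * M + q').
      by rewrite addnS -[in LHS]addn1 iotaD foldl_cat /= add0n.
    have M0 : 0 < M by lia.
    have qq : (q * M + q') %/ M = q by rewrite divnMDl // divn_small ?addn0.
    have fin g2 t2 : (forall a, rAtt <= a -> a < LB -> g2 a = g1 a) ->
        g2 rAns = foldl (att_step i) n (iota 0 (q * M + q'.+1)) ->
        t2 <= cAM + 20 ->
        g2 rAtt = q' /\
        [/\ forall a, rJJ <= a -> a < LB -> upd g2 rAtt q'.+1 a = g0 a,
            upd g2 rAtt q'.+1 rAns = foldl (att_step i) n (iota 0 (q * M + q'.+1)),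
            i + (q * M + q') * (J + l) + (J + l) = i + (q * M + q'.+1) * (J + l) &
            t' + (t1 + t2 + (12 + cost #cM)) <= q'.+1 * (cAM + (J + l) * 40 + 100)].
      move=> fr2 A2 ht2; split; first by rewrite fr2 // ?fr1 //; lia.
      split=> //.
      * by move=> a a1 a2; rewrite updne ?fr2 ?fr1 ?fr' //; lia.
      * by rewrite addnS mulSn; lia.
      * by rewrite mulSn /=; lia.
    apply: wp_if => //=; rewrite ?g1A ?g1n.
    * by sc.
    * rewrite eqb0 negbK addn1 => an; apply: wp_skip; apply: fin => //; try arith.
      by rewrite stepS /att_step an.
    * move/eqP; rewrite eqb0 addn1 => an.
      have g1lev : g1 rLev = level (J - q) by rewrite fr1 // fr' //; lia.
      have g1W : g1 rW = 2 ^ q by rewrite fr1 // fr' //; lia.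
      have dg1 : data g1.
        by apply: (data_frame (leqnn cN) _ dg') => a a1 a2; rewrite fr1 //; lia.
      have cAl := cA_le qlev.
      apply: attemptP; rewrite ?g1lev ?g1W //.
      - by rewrite fr1 // fr' //; lia.
      - by rewrite expn_gt0.
      - by rewrite leq_exp2l //; lia.
      - rewrite gz1; have := bin_lt (coinseq (i + (q * M + q') * (J + l)) (J + l)).
        by rewrite size_map size_iota.
      move=> g2 t2 fr2 A2 ht2; apply: fin => //; last by lia.
      by rewrite A2 stepS g1A gz1 /att_step (negbTE an) qq.
  + move=> g' j' t' [fr' gA' -> ht'] _.
    have q2 : 2 ^ q + 2 ^ q = 2 ^ q.+1 by rewrite expnS mul2n addnn.
    have q2J : 2 ^ q.+1 <= 2 ^ J.+1 * n.+1.
      by apply: (@leq_trans (2 ^ J.+1)); rewrite ?leq_exp2l ?leq_pmulr //; lia.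
    have g'W : g' rW = 2 ^ q by rewrite fr' //; lia.
    apply: wp_store => //=; rewrite ?g'W; try by sc.
    split; first by rewrite updne // fr' //; lia.
    split=> //.
    * by move=> a a1 a2; rewrite ifF ?updne ?fr' ?g0E ?fr //; lia.
    * by rewrite /= /upd /= gA' -[_ * M in RHS]/(q.+1 * M) mulSn addnC.
    * by rewrite mulSn [M + _]addnC.
    * by rewrite mulSn /=; lia.
- move=> g j t [fr gA gW -> ht] _.
  apply: wp_store => //=; try by sc.
  apply: h; rewrite /upd /=.
  + by rewrite gA.
  + by apply: (data_frame (leqnn cN) _ df) => a a1 a2; rewrite ifF ?fr //; lia.
  + by rewrite /cQ; lia.
Qed.

Section Preprocessing.
Hypothesis dom_lt : forall x, x < n -> dom x.
Variable i0 : nat.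
Hypothesis labE : forall p, p < n -> lab p = bin (coinseq (i0 + p * J) J).

Definition tables_upto (f : nat -> nat) (c : nat) := forall lev tau,
  lev < k -> tau < G * L -> lev * (G * L) + tau < c -> table_at f lev tau.

Lemma fill_tableP f i (P : post) :
  f rLev < k -> f rK = Kf (f rLev) -> f rTau < G * L -> consts f -> labels_at f ->
  (forall f' t,
     (forall a, rP <= a -> a != rBase ->
        a < base (f rLev) (f rTau) \/ LB <= a -> f' a = f a) ->
     table_at f' (f rLev) (f rTau) -> P f' i t) ->
  wp (set_table;;
      For rY #cN (
        rPos ::= Cst 0;;
        For rX #cN (
          compare_keys k;;
          rPos ::= #rPos ⊕ (#rLt ⊕ #rEq ⊗ (ext_at k #rX ⊕ Cst 1 ⊑ ext_at k #rY)));;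
        Store (#rBase ⊕ #rPos) #rY)) f i P.
Proof.
move=> levk fK taul cf lf h.
have [[fn _ _ _ fcG] [fcL _ _ _ fTB] _ _] := cf.
set lev := f rLev in levk fK h *; set tau := f rTau in taul h *.
have bLB := base_le levk taul.
have LBN : LB <= N by apply: leq_trans N_ge; apply: leq_addr.
have NB : N < B by lia.
have litN c : c < NR -> c < N by lia.
have litB c : c < NR -> c < B by lia.
have LN : NR + k + n <= LB by rewrite /LB /TB /EB; lia.
have b43 : EB + n <= base lev tau by rewrite /base /TB leq_addr.
have bE : base lev tau = TB + (lev * (G * L) + tau) * n by [].
have levGL : lev * (G * L) + tau <= k * (G * L).
  apply: (@leq_trans (lev.+1 * (G * L))); first by rewrite mulSn; lia.
  by rewrite leq_mul2r levk orbT.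
have kGL : k * (G * L) < B.
  apply: leq_ltn_trans NB; apply: leq_trans LBN; rewrite /LB.
  by apply: leq_trans (leq_addl _ _); apply: leq_pmulr.
have nk : (lev * (G * L) + tau) * n <= LB by have := bLB; rewrite /base; lia.
apply: wp_seq; apply: wp_store => //=; rewrite ?fTB ?fcG ?fcL ?fn -/lev -/tau; try by sc.
rewrite /upd /= -bE.
apply: (wp_for BE B_gt1 (b := n) (Inv := fun q g j t =>
  [/\ forall a, rP <= a -> a != rBase -> a < base lev tau \/ LB <= a -> g a = f a,
      g rBase = base lev tau, j = i &
      forall p, p < q -> g (base lev tau + rank n (key lev tau) ext p) = p])) => //; try arith.
- by split=> // a a1 a2 a3; rewrite updne /= ?ifF //; lia.
- move=> q g j t qn [fr _ _ _] _; rewrite /= fr //; last by left; lia.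
  by rewrite fn; sc.
- move=> q g j t qn [fr gB -> gt] gq.
  have gE a : NR <= a -> a < EB + n -> g a = f a.
    by move=> a1 a2; apply: fr; [lia | lia | left; lia].
  apply: wp_seq; apply: wp_store => //=; try by sc.
  rewrite /upd /=; apply: wp_seq.
  set c := fun x => count (below (key lev tau) ext (key lev tau q) (ext q)) (iota 0 x).
  have cx x : c x <= x by rewrite -[X in _ <= X](size_iota 0 x) count_size.
  apply: (wp_for BE B_gt1 (b := n) (Inv := fun x g' j t =>
    [/\ forall a, rY <= a -> a != rPos -> g' a = g a,
      g' rPos = c x & j = i])) => //; try arith.
  + by split=> // a a1 a2; rewrite updne /= ?ifF //; lia.
  + move=> x g' j' t' xn [fr' _ _] _; rewrite /= fr' // fr //; last by left; lia.
    by rewrite fn; sc.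
  + move=> x g' j' t' xn [fr' gP ->] gx.
    have g'lev : g' rLev = lev by rewrite fr' // fr //; left; lia.
    have g'tau : g' rTau = tau by rewrite fr' // fr //; left; lia.
    have g'K : g' rK = Kf lev by rewrite fr' // fr //; left; lia.
    have g'Y : g' rY = q by rewrite fr'.
    apply: wp_seq; apply: compare_keysP; rewrite ?g'lev ?g'tau ?gx ?g'Y //.
    * exact: dom_lt.
    * exact: dom_lt.
    move=> g1 t1 fr1 lt1 eq1 _.
    have E p : p < n -> g1 (EB + p) = ext p.
      move=> pn; rewrite fr1; last by rewrite /EB; lia.
      rewrite fr'; [|by rewrite /EB; lia|by rewrite /EB; lia].
      by rewrite gE ?lf // /EB; lia.
    have X1 : g1 rX = x by rewrite fr1.
    have Y1 : g1 rY = q by rewrite fr1.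
    have P1' : g1 rPos = c x by rewrite fr1.
    have exB p : p < n -> ext p + 1 < B.
      move=> pn; have := ext_lt pn.
      have : 2 ^ J * n <= 2 ^ J.+1 * n.+1 by rewrite leq_mul // leq_exp2l.
      by lia.
    have ex := exB _ xn; have exq := exB _ qn.
    have cS' : c x + (g1 rLt + g1 rEq * (ext x + 1 <= ext q)) = c x.+1.
      rewrite /c -[in RHS]addn1 iotaD count_cat /= add0n addn0 lt1 eq1 /below addn1.
      by case: (ltngtP (key lev tau x)) => //= _; case: (ext x < ext q).
    have h4 : g1 rLt <= 1 by rewrite lt1 leq_b1.
    have h5 : g1 rEq * (ext x + 1 <= ext q) <= 1.
      by rewrite -[1]muln1 leq_mul // ?eq1 leq_b1.
    have cxx := cx x.
    clear lt1 eq1.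
    apply: wp_store => //=; rewrite -?/EB ?X1 ?Y1 ?P1' ?E //; try by sc.
    rewrite cS'; split; first by rewrite updne.
    split=> //.
    * move=> a a1 a2; rewrite !updne ?fr1 ?fr' //; lia.
  + move=> g' j' t' [fr' gP ->] _.
    have g'Y : g' rY = q by rewrite fr'.
    have g'B : g' rBase = base lev tau by rewrite fr'.
    have rq : c n = rank n (key lev tau) ext q by [].
    have := rank_lt (key lev tau) ext qn; rewrite -rq => cqn.
    apply: wp_store => //=; rewrite ?g'B ?gP ?g'Y; try by sc.
    split; first by rewrite updne ?g'Y //; lia.
    split=> //.
    * by move=> a a1 a2 a3; rewrite ifF ?updne ?fr' ?fr //; lia.
    * move=> p; rewrite ltnS leq_eqVlt => pq.
      have [->|npq] := eqVneq p q; first by rewrite -rq updE.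
      have {}pq : p < q by move: pq; rewrite (negbTE npq).
      have pn : p < n by lia.
      (* Ranks are distinct, so the cell just written is none of those already filled. *)
      have rpq : rank n (key lev tau) ext p != c n.
        by rewrite rq; apply: contraNneq npq => /(rank_inj ext_inj pn qn) ->.
      by rewrite updne ?fr' ?gt //; lia.
- move=> g j t [fr gB -> gt] _; apply: h; last exact: gt.
  by move=> a a1 a2 a3; rewrite fr.
Qed.

Lemma preprocP f (P : post) :
  consts f -> (forall f' t, data f' -> P f' (i0 + n * J) t) ->
  wp (preproc_prog k) f i0 P.
Proof.
move=> cf h.
have LBN : LB <= N by apply: leq_trans N_ge; apply: leq_addr.
have NB : N < B by lia.
have litN c : c < NR -> c < N by lia.
have litB c : c < NR -> c < B by lia.
have LN : NR + k + n <= LB by rewrite /LB /TB /EB; lia.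
have cfr g : (forall a, cN <= a -> a < EB -> g a = f a) -> consts g.
  move=> fr; have [[f1 f2 f3 f4 f5] [f6 f7 f8 f9 f10] f11 f12] := cf.
  split.
  - by split; rewrite fr // /EB; lia.
  - by split; rewrite fr // /EB; lia.
  - by rewrite fr // /EB; lia.
  - by move=> lev levk; rewrite fr ?f12 // /EB; lia.
have EBTB : TB = EB + n by [].
have EBk : EB = NR + k by [].
apply: wp_seq.
apply: (wp_for BE B_gt1 (b := n) (Inv := fun q g j t =>
  [/\ forall a, cN <= a -> a < EB -> g a = f a,
      forall p, p < q -> g (EB + p) = ext p & j = i0 + q * J])) => //; try arith.
- by split=> // [a a1 a2|]; rewrite ?addn0 // updne //; lia.
- move=> q g j t qn [/cfr [[gn _ _ _ _] _ _ _] _ _] _.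
  by rewrite /= gn; sc.
- move=> q g j t qn [fr gl ->] gq.
  have [[gn gJ _ _ _] _ _ _] := cfr _ fr.
  have J2 : 2 ^ J.+1 <= 2 ^ J.+1 * n.+1 by rewrite leq_pmulr.
  apply: wp_seq; apply: (@drawP _ J) => //; try arith.
  move=> g1 t1 fr1 gz1 ht1.
  have g1n : g1 cN = n by rewrite fr1.
  have g1q : g1 rP = q by rewrite fr1.
  have exq : bin (coinseq (i0 + q * J) J) * n + q = ext q by rewrite /ext labE.
  have exB : ext q < B.
    have := ext_lt qn.
    have : 2 ^ J * n <= 2 ^ J.+1 * n.+1 by rewrite leq_mul // leq_exp2l.
    by lia.
  have zn : bin (coinseq (i0 + q * J) J) * n <= ext q by lia.
  apply: wp_store => //=; rewrite ?gz1 ?g1n ?g1q -?EBk; try by sc.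
  rewrite exq; split; first by rewrite updne //; lia.
  split.
  + by move=> a a1 a2; rewrite !updne ?fr1 ?fr //; lia.
  + move=> p; rewrite ltnS leq_eqVlt => pq; rewrite updne; last by lia.
    have [->|npq] := eqVneq p q; first by rewrite updE.
    have {}pq : p < q by move: pq; rewrite (negbTE npq).
    by rewrite updne ?fr1 ?gl //; lia.
  + by rewrite mulSn; lia.
move=> f1 j1 t1 [fr1 fl1 ->] _.
apply: (wp_for BE B_gt1 (b := k) (Inv := fun q g j t =>
  [/\ consts g, labels_at g, tables_upto g (q * (G * L)) & j = i0 + n * J])) => //; try arith.
- by split=> //; apply: cfr => a a1 a2; rewrite updne ?fr1 //; lia.
- by move=> q g j t qk _ _; sc.
- move=> q g j t qk [cg lg tg ->] gq.
  have [_ _ _ gK] := cg.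
  apply: wp_seq; apply: wp_store => //=; rewrite ?gq; try by sc.
  rewrite gK //.
  apply: (wp_for BE B_gt1 (b := G * L) (Inv := fun q' g j t =>
    [/\ consts g /\ labels_at g, tables_upto g (q * (G * L) + q'), g rLev = q,
        g rK = Kf q & j = i0 + n * J])) => //; try arith.
  + by rewrite addn0.
  + move=> q' g' j' t' qGL [[[[_ _ _ _ gG] [gL _ _ _ _] _ _] _] _ _ _ _] _.
    by rewrite /= gG gL; sc.
  + move=> q' g' j' t' qGL [[cg' lg'] tg' glev gK' ->] gq'.
    have b43 : EB + n <= base q q' by rewrite /base /TB leq_addr.
    apply: fill_tableP; rewrite ?glev ?gq' //.
    move=> f2 t2 fr2 ft2.
    split; first by rewrite fr2 //; left; lia.
    have fr2' a : cN <= a -> a < EB + n -> f2 a = g' a.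
      by move=> a1 a2; rewrite fr2 //; [lia | lia | left; lia].
    split=> //; last first.
    * by rewrite updne // fr2 //; left; lia.
    * by rewrite updne // fr2 //; left; lia.
    * move=> lev tau levk taul; rewrite addnS ltnS leq_eqVlt => e p pn.
      have := rank_lt (key lev tau) ext pn => rp.
      have b43' : EB + n <= base lev tau by rewrite /base /TB leq_addr.
      rewrite updne; last by lia.
      have [e1|e1] := eqVneq (lev * (G * L) + tau) (q * (G * L) + q').
        have GL0 : 0 < G * L by lia.
        have el : lev = q.
          have := congr1 (divn^~ (G * L)) e1.
          by rewrite /= !divnMDl // !divn_small // !addn0.
        have et : tau = q' by move: e1; rewrite el; lia.
        by rewrite el et in pn *; rewrite ft2.
      have {}e : lev * (G * L) + tau < q * (G * L) + q'.
        by move: e; rewrite (negbTE e1).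
      have be : base lev tau + n <= base q q'.
        rewrite /base -addnA leq_add2l addnC -mulSn leq_mul2r e orbT //.
      by rewrite fr2 ?tg' //; lia.
    * have [[f1' f2' f3 f4 f5] [f6 f7 f8 f9 f10] f11 f12] := cg'.
      split; last by move=> p pn; rewrite updne ?fr2' ?lg' //; lia.
      split.
      - by split; rewrite updne ?fr2' //; lia.
      - by split; rewrite updne ?fr2' //; lia.
      - by rewrite updne ?fr2' //; lia.
      - by move=> lev levk; rewrite updne ?fr2' ?f12 //; lia.
  + move=> g' j' t' [[cg' lg'] tg' glev gK' ->] _.
    split; first by [].
    split=> //.
    by rewrite mulSn addnC.
- move=> g j t [cg lg tg ->] _; apply: h; split=> // lev tau levk taul.
  apply: tg => //; apply: (@leq_trans (lev.+1 * (G * L))); first by rewrite mulSn; lia.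
  by rewrite leq_mul2r levk orbT.
Qed.

End Preprocessing.

End Correctness.

Import Order.TTheory GRing.Theory Num.Theory.
Import numFieldNormedType.Exports.

Local Open Scope ring_scope.

(** * Finite probability *)

(** Uniform averages, iterated averages and finite product laws share this interface, so sums,
    constants and [markov] are treated once for all of them. *)
Record expectation (R : realFieldType) (T : Type) (E : (T -> R) -> R) : Prop :=
  Expectation {
    expD : forall f g, E (fun x => f x + g x) = E f + E g;
    expZ : forall c f, E (fun x => c * f x) = c * E f;
    exp_le : forall f g, (forall x, f x <= g x) -> E f <= E g;
    exp1 : E (fun=> 1) = 1
  }.

Section Expectation.
Variables (R : realFieldType) (T : Type) (E : (T -> R) -> R).
Hypothesis EE : expectation E.

Lemma exp_ext f g : f =1 g -> E f = E g.
Proof.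
by move=> fg; apply/eqP; rewrite eq_le !(exp_le EE) // => x; rewrite fg.
Qed.

Lemma exp_cst c : E (fun=> c) = c.
Proof.
rewrite -[RHS]mulr1 -(exp1 EE) -(expZ EE); apply: exp_ext => x; by rewrite mulr1.
Qed.

Lemma exp_ge0 f : (forall x, 0 <= f x) -> 0 <= E f.
Proof. by move=> f0; rewrite -(exp_cst 0); apply: exp_le. Qed.

Lemma exp_sum (I : Type) (r : seq I) (P : pred I) (F : I -> T -> R) :
  E (fun x => \sum_(i <- r | P i) F i x) = \sum_(i <- r | P i) E (F i).
Proof.
elim: r => [|i r IH].
  rewrite big_nil; transitivity (E (fun=> 0)); last exact: exp_cst.
  by apply: exp_ext => x; rewrite big_nil.
rewrite big_cons; case: ifP => Pi.
  by rewrite -IH -(expD EE); apply: exp_ext => x; rewrite big_cons Pi.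
by rewrite -IH; apply: exp_ext => x; rewrite big_cons Pi.
Qed.

Lemma expZr c f : E (fun x => f x * c) = E f * c.
Proof. by rewrite mulrC -(expZ EE); apply: exp_ext => x; rewrite mulrC. Qed.

Lemma expB f g : E (fun x => f x - g x) = E f - E g.
Proof.
rewrite -mulN1r -(expZ EE) -(expD EE); apply: exp_ext => x; by rewrite mulN1r.
Qed.

Lemma markov (f : T -> R) a : (forall x, 0 <= f x) -> 0 < a ->
  E (fun x => (a <= f x)%R%:R) <= E f / a.
Proof.
move=> f0 a0; rewrite -expZr; apply: exp_le => // x.
rewrite ler_pdivlMr //; case: (lerP a (f x)) => h; first by rewrite mul1r.
by rewrite mul0r.
Qed.

End Expectation.

Section Averages.
Variable R : realFieldType.

Definition avg (N : nat) (f : nat -> R) : R := (\sum_(z < N) f z) / N%:R.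

Fixpoint avgs (N m : nat) (f : seq nat -> R) : R :=
  if m is m'.+1 then avg N (fun z => avgs N m' (fun s => f (z :: s)))
  else f [::].

Lemma avg_expectation N : (0 < N)%N -> expectation (avg N).
Proof.
move=> N0; have N0' : 0 < N%:R :> R by rewrite ltr0n.
split=> [f g|c f|f g fg|]; rewrite /avg.
- by rewrite big_split mulrDl.
- by rewrite -mulr_sumr mulrA.
- by rewrite ler_pM2r ?invr_gt0 //; apply: ler_sum.
- by rewrite sumr_const card_ord divff // gt_eqF.
Qed.

Lemma avg_eq N f g : (forall z, (z < N)%N -> f z = g z) -> avg N f = avg N g.
Proof. by move=> fg; rewrite /avg; congr (_ / _); apply: eq_bigr => z _; apply: fg. Qed.

Lemma avgs_expectation N m : (0 < N)%N -> expectation (avgs N m).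
Proof.
move=> N0; have EE := avg_expectation N0.
elim: m => [|m IH]; first by split=> //= f g; apply.
split=> [f g|c f|f g fg|] /=.
- by rewrite -(expD EE); apply: (exp_ext EE) => z; rewrite (expD IH).
- by rewrite -(expZ EE); apply: (exp_ext EE) => z; rewrite (expZ IH).
- by apply: (exp_le EE) => z; apply: (exp_le IH).
- by rewrite -[RHS](exp1 EE); apply: (exp_ext EE) => z; rewrite (exp1 IH).
Qed.

Definition vals (N m : nat) (s : seq nat) := (size s == m) && all (fun z => (z < N)%N) s.

(* Only lists of [m] numbers below [N] matter. *)
Lemma avgs_le_in N m f g :
  (forall s, vals N m s -> f s <= g s) -> avgs N m f <= avgs N m g.
Proof.
elim: m f g => [|m IH] f g fg /=; first exact: fg.
rewrite /avg ler_wpM2r ?invr_ge0 ?ler0n //; apply: ler_sum => z _; apply: IH => s vs.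
apply: fg; move: vs; rewrite /vals /= => /andP[/eqP -> ->].
by rewrite eqxx ltn_ord.
Qed.

Lemma avgs_eq_in N m f g :
  (forall s, vals N m s -> f s = g s) -> avgs N m f = avgs N m g.
Proof. by move=> fg; apply: le_anti; rewrite !avgs_le_in // => s /fg ->. Qed.

Lemma avgs_prod N m (g : nat -> nat -> R) : (0 < N)%N ->
  avgs N m (fun s => \prod_(i < m) g i (nth 0%N s i)) = \prod_(i < m) avg N (g i).
Proof.
move=> N0; elim: m g => [|m IH] g /=; first by rewrite !big_ord0.
rewrite big_ord_recl -(IH (fun i => g i.+1)).
rewrite -(expZr (avg_expectation N0)); apply: avg_eq => z _.
rewrite -(expZ (avgs_expectation m N0)); apply: (exp_ext (avgs_expectation m N0)) => s.
by rewrite big_ord_recl.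
Qed.

Lemma avgs_cat N a b f : avgs N (a + b) f =
  avgs N a (fun s => avgs N b (fun t => f (s ++ t))).
Proof.
elim: a f => //= a IH f; apply: avg_eq => z _; by rewrite IH.
Qed.

End Averages.

Section FiniteProduct.
Variables (R : realFieldType) (I V : finType) (mu : I -> V -> R).
Hypothesis mu_ge0 : forall i v, 0 <= mu i v.
Hypothesis mu_sum : forall i, \sum_v mu i v = 1.

Definition Ex (f : {ffun I -> V} -> R) : R :=
  \sum_(v : {ffun I -> V}) (\prod_i mu i (v i)) * f v.

Lemma Ex_prod (F : I -> V -> R) :
  Ex (fun v => \prod_i F i (v i)) = \prod_i \sum_a mu i a * F i a.
Proof.
rewrite bigA_distr_bigA /=; apply: eq_bigr => v _; by rewrite -big_split.
Qed.

Lemma Ex_expectation : expectation Ex.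
Proof.
split=> [f g|c f|f g fg|]; rewrite /Ex.
- by rewrite -big_split; apply: eq_bigr => v _; rewrite mulrDr.
- by rewrite mulr_sumr; apply: eq_bigr => v _; rewrite mulrCA.
- by apply: ler_sum => v _; apply: ler_wpM2l => //; apply: prodr_ge0.
- transitivity (Ex (fun v => \prod_(i : I) (fun _ _ => 1 : R) i (v i))).
    by apply: eq_bigr => v _; congr (_ * _); rewrite big1.
  rewrite (Ex_prod (fun _ _ => 1)) big1 // => i _; rewrite -[RHS](mu_sum i).
  by apply: eq_bigr => a _; rewrite mulr1.
Qed.

Lemma Ex_coord i (F : V -> R) : Ex (fun v => F (v i)) = \sum_a mu i a * F a.
Proof.
transitivity (Ex (fun v => \prod_j (if j == i then F (v j) else 1))).
  by apply: eq_bigr => v _; rewrite -big_mkcond big_pred1_eq.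
rewrite (Ex_prod (fun j a => if j == i then F a else 1)).
rewrite (bigD1 i) //= eqxx [X in _ * X]big1 ?mulr1 // => j /negbTE ->.
by rewrite -[RHS](mu_sum j); apply: eq_bigr => a _; rewrite mulr1.
Qed.

Definition depends (f : {ffun I -> V} -> R) (A : pred I) :=
  forall v v' : {ffun I -> V}, (forall i, A i -> v i = v' i) -> f v = f v'.

(* Exchanging the coordinates in [A] of two independent samples preserves their joint
   law, and turns [f v * g v'] into [f v * g v] evaluated at one sample. *)
Lemma Ex_indep2 f g (A : pred I) : depends f A -> depends g (predC A) ->
  Ex (fun v => f v * g v) = Ex f * Ex g.
Proof.
move=> fA gA; pose W (v : {ffun I -> V}) := \prod_i mu i (v i).
pose mix (v v' : {ffun I -> V}) := [ffun i => if A i then v i else v' i].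
pose sw (x : {ffun I -> V} * {ffun I -> V}) := (mix x.1 x.2, mix x.2 x.1).
have swK : involutive sw.
  by case=> v v'; congr pair; apply/ffunP => i; rewrite !ffunE; case: (A i).
have E1 : Ex f * Ex g = \sum_(x : {ffun I -> V} * {ffun I -> V}) W x.1 * W x.2 * (f x.1 * g x.2).
  rewrite /Ex mulr_suml -(pair_bigA _ (fun v v' => W v * W v' * (f v * g v'))) /=.
  by apply: eq_bigr => v _; rewrite mulr_sumr; apply: eq_bigr => v' _; rewrite mulrACA.
have E2 : Ex (fun v => f v * g v) = \sum_(x : {ffun I -> V} * {ffun I -> V}) W x.1 * W x.2 * (f x.1 * g x.1).
  rewrite -(pair_bigA _ (fun v v' => W v * W v' * (f v * g v))) /=.
  apply: eq_bigr => v _; rewrite -mulr_suml -mulr_sumr.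
  have : \sum_v' W v' = 1.
    rewrite -[RHS](exp1 Ex_expectation); apply: eq_bigr => v' _; by rewrite mulr1.
  by move=> ->; rewrite mulr1.
rewrite E1 E2 (reindex_inj (inv_inj swK)); apply: eq_bigr => -[v v'] _ /=.
have -> : W (mix v v') * W (mix v' v) = W v * W v'.
  rewrite /W -!big_split; apply: eq_bigr => i _; rewrite !ffunE /=.
  by case: (A i) => //; rewrite mulrC.
congr (_ * (_ * _)); first by apply: fA => i Ai; rewrite ffunE Ai.
by apply: gA => i /= /negbTE Ai; rewrite ffunE Ai.
Qed.

(** [b] sorts the coordinates into blocks; in use, a block gathers the hash functions of one
    coordinate of a key, of one table or of one group. *)
Lemma Ex_indep (T : eqType) (b : I -> T) (F : T -> {ffun I -> V} -> R) (s : seq T) :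
  uniq s -> (forall t, t \in s -> depends (F t) [pred i | b i == t]) ->
  Ex (fun v => \prod_(t <- s) F t v) = \prod_(t <- s) Ex (F t).
Proof.
elim: s => [|t s IH] /=.
  move=> _ _; rewrite big_nil -[RHS](exp1 Ex_expectation).
  by apply: (exp_ext Ex_expectation) => v; rewrite big_nil.
case/andP=> ts us dep; rewrite big_cons -IH //; last first.
  by move=> u us'; apply: dep; rewrite inE us' orbT.
rewrite -(Ex_indep2 (A := [pred i | b i == t])).
- by apply: (exp_ext Ex_expectation) => v; rewrite big_cons.
- by apply: dep; rewrite mem_head.
- move=> v v' vv'; apply: eq_big_seq => u us'.
  apply: (dep u); first by rewrite inE us' orbT.
  move=> i /= /eqP bu; apply: vv' => /=; rewrite bu.
  by apply: contraNneq ts => <-.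
Qed.

End FiniteProduct.

Local Close Scope ring_scope.

(** * Completeness of the candidate list *)

Section Completeness.
Variables (n l G L T : nat) (lab : nat -> nat) (near : nat -> nat -> bool).
Variables (col : nat -> nat -> nat -> bool) (lev lo hi : nat).
Hypothesis n_gt0 : 0 < n.

Let X p := inrange n lab lo hi p.
Let e tau := ents n lab col lev tau lo hi.

(** A sufficient event that does not mention the scan: the first [M] tables of the group fit
    together into the budget, hence are all read, and one of them puts [x] next to the query. [M]
    may be chosen according to [x]. *)
Definition group_hit (g x : nat) : bool :=
  has (fun M => has (fun t => col lev (g * L + t) x) (iota 0 M) &&
                (\sum_(t <- iota 0 M) size (e (g * L + t)) <= T)) (iota 0 L.+1).

Definition wanted p := [&& p < n, near lev p & X p].

Hypothesis load : count wanted (iota 0 n) <= 2 ^ l.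

Definition okl (s : seq nat) := uniq s && all wanted s.

Lemma okl_size s : okl s -> size s <= count wanted (iota 0 n).
Proof.
case/andP=> us as_; rewrite -size_filter; apply: uniq_leq_size => // p ps.
have := allP as_ p ps; rewrite mem_filter => h; rewrite h mem_iota add0n.
by case/and3P: h.
Qed.

Lemma addp_okl s p : okl s -> p < n -> X p ->
  [/\ okl (addp l near lev s p), {subset s <= addp l near lev s p} &
      near lev p -> p \in addp l near lev s p].
Proof.
move=> oks pn Xp; rewrite /addp.
have [/and3P[np ps sl]|h] := ifP.
  split; last by rewrite mem_rcons mem_head.
    by case/andP: oks => us as_; rewrite /okl rcons_uniq ps us all_rcons as_ /wanted pn np Xp.
  by move=> x xs; rewrite mem_rcons inE xs orbT.
(* Were the list full, appending [p] would produce more distinct wanted points than [load]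
   allows. *)
split=> // np; move: h; rewrite np /=; case ps: (p \in s) => //= sl.
have : okl (rcons s p).
  by case/andP: oks => us as_; rewrite /okl rcons_uniq ps us all_rcons as_ /wanted pn np Xp.
move/okl_size; rewrite size_rcons; move: load sl; clear; lia.
Qed.

Lemma foldl_addp_okl s r : okl s -> all (fun p => (p < n) && X p) r ->
  [/\ okl (foldl (addp l near lev) s r), {subset s <= foldl (addp l near lev) s r} &
      {in r, forall p, near lev p -> p \in foldl (addp l near lev) s r}].
Proof.
elim: r s => [|p r IH] s oks /=; first by split.
case/andP=> /andP[pn Xp] ar.
have [ok1 sub1 in1] := addp_okl oks pn Xp.
have [ok2 sub2 in2] := IH _ ok1 ar.
split=> //; first by move=> x /sub1 /sub2.
move=> x; rewrite inE => /orP[/eqP -> np|]; last exact: in2.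
by apply: sub2; apply: in1.
Qed.

Lemma ents_in tau : all (fun p => (p < n) && X p) (e tau).
Proof. by apply/allP => p; rewrite mem_ents => /and3P[pn _ ip]; apply/andP. Qed.

Lemma scan_okl acc tau : okl acc.1 ->
  okl (scan n l lab near col lev lo hi acc tau).1 /\
  {subset acc.1 <= (scan n l lab near col lev lo hi acc tau).1}.
Proof.
move=> oka; rewrite /scan; case: ifP => /= _; last by split.
by have [? ? _] := foldl_addp_okl oka (ents_in tau).
Qed.

Lemma foldl_scan_okl acc r : okl acc.1 ->
  okl (foldl (scan n l lab near col lev lo hi) acc r).1 /\
  {subset acc.1 <= (foldl (scan n l lab near col lev lo hi) acc r).1}.
Proof.
elim: r acc => [acc oka|tau r IH acc oka] /=; first by split.
have [ok1 sub1] := scan_okl tau oka; have [ok2 sub2] := IH _ ok1.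
by split=> // x /sub1 /sub2.
Qed.

Lemma foldl_scan_budget s b r : okl s -> \sum_(tau <- r) size (e tau) <= b ->
  let acc := foldl (scan n l lab near col lev lo hi) (s, b) r in
  acc.2 = b - \sum_(tau <- r) size (e tau) /\
  {in r, forall tau x, col lev tau x -> wanted x -> x \in acc.1}.
Proof.
elim: r s b => [|tau r IH] s b oks /=; first by rewrite big_nil subn0.
rewrite big_cons => hb.
have eb : size (ents n lab col lev tau lo hi) <= b by apply: leq_trans hb; apply: leq_addr.
have [ok1 _ in1] := foldl_addp_okl oks (ents_in tau).
rewrite /scan /= eb -/(scan _ _ _ _ _ _ _ _).
have hb' : \sum_(tau0 <- r) size (e tau0) <= b - size (e tau) by lia.
have [b1 m1] := IH _ _ ok1 hb'.
split; first by rewrite b1 subnDA.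
move=> tau'; rewrite inE => /orP[/eqP ->|]; last exact: m1.
move=> x cx wx.
have [_ sub] := foldl_scan_okl (acc := (foldl (addp l near lev) s (e tau), b - size (e tau))) r ok1.
apply: sub; apply: in1; last by case/and3P: wx.
by rewrite mem_ents cx; case/and3P: wx => pn _ Xx; apply/andP.
Qed.

Lemma scan_group_okl s g : okl s ->
  [/\ okl (scan_group n l L T lab near col lev lo hi s g),
      {subset s <= scan_group n l L T lab near col lev lo hi s g} &
      forall x, wanted x -> group_hit g x ->
        x \in scan_group n l L T lab near col lev lo hi s g].
Proof.
move=> oks; rewrite /scan_group.
have [ok1 sub1] := foldl_scan_okl (acc := (s, T)) [seq g * L + t | t <- iota 0 L] oks.
split=> // x wx /hasP[M]; rewrite mem_iota add0n ltnS => /= ML /andP[/hasP[t tM ct] hT].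
have -> : [seq g * L + t | t <- iota 0 L] =
   [seq g * L + t | t <- iota 0 M] ++ [seq g * L + t | t <- iota M (L - M)].
  by rewrite -map_cat -{2}[M]add0n -iotaD subnKC.
rewrite foldl_cat.
have hT' : \sum_(tau <- [seq g * L + t | t <- iota 0 M]) size (e tau) <= T by rewrite big_map.
have [_ m1] := foldl_scan_budget oks hT'.
have [ok2 _] := foldl_scan_okl (acc := (s, T)) [seq g * L + t | t <- iota 0 M] oks.
have [_ sub2] := foldl_scan_okl [seq g * L + t | t <- iota M (L - M)] ok2.
apply: sub2; apply: (m1 (g * L + t)) => //.
by apply/mapP; exists t.
Qed.

Lemma found_complete :
  (forall x, wanted x -> has (fun g => group_hit g x) (iota 0 G)) ->
  uniq (found n l G L T lab near col lev lo hi) /\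
  found n l G L T lab near col lev lo hi =i wanted.
Proof.
move=> hit; rewrite /found.
have key r : okl (foldl (scan_group n l L T lab near col lev lo hi) [::] r) /\
   forall x, wanted x -> has (fun g => group_hit g x) r ->
     x \in foldl (scan_group n l L T lab near col lev lo hi) [::] r.
  elim/last_ind: r => [|r g [ok1 in1]] //; rewrite -cats1 foldl_cat /=.
  have [ok2 sub2 in2] := scan_group_okl g ok1; split=> // x wx.
  rewrite has_cat /= orbF => /orP[h|h]; last exact: in2.
  by apply: sub2; apply: in1.
have [/andP[us as_] in1] := key (iota 0 G); split=> // x.
by apply/idP/idP => [/(allP as_) //|wx]; apply: in1 => //; apply: hit.
Qed.

End Completeness.

Lemma inrange_segment n lab w s p : 0 < w -> p < n ->
  inrange n lab (s * (w * n)) (s * (w * n) + w * n) p = (lab p %/ w == s).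
Proof.
move=> w0 pn; rewrite /inrange /ext eqn_leq.
have -> : s * (w * n) + w * n = s.+1 * w * n by rewrite mulSn mulnDl addnC mulnA.
have h a : (a * n <= lab p * n + p) = (a <= lab p).
  have [le|gt] := leqP a (lab p); first by rewrite (leq_trans (leq_mul le (leqnn n))) ?leq_addr.
  have : (lab p).+1 * n <= a * n by rewrite leq_mul2r gt orbT.
  by rewrite mulSn; lia.
rewrite mulnA h ltnNge h -ltnNge -leq_divRL // andbC; congr (_ && _).
by rewrite -ltn_divLR // ltnS.
Qed.

(** * The exact law of one attempt *)

Section Law.
Variable R : realFieldType.
 Local Open Scope ring_scope.
Variables (n l G L T J : nat) (lab : nat -> nat) (near : nat -> nat -> bool).
Variables (col : nat -> nat -> nat -> bool).
Hypothesis lab_lt : forall p, (lab p < 2 ^ J)%N.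
Hypothesis n_gt0 : (0 < n)%N.

Definition nearcount lev : nat := count (near lev) (iota 0 n).

Lemma sum_mul_ord (F : nat -> R) a b :
  \sum_(z < a * b) F z = \sum_(i < a) \sum_(u < b) F (i * b + u)%N.
Proof.
elim: a => [|a IH]; first by rewrite !big_ord0.
rewrite mulSnr big_split_ord /= IH big_ord_recr /=; congr (_ + _).
Qed.

Definition segment w s p := (lab p %/ w == s)%N.

Definition complete lev w s : Prop :=
  let fd := found n l G L T lab near col lev (s * (w * n)) (s * (w * n) + w * n) in
  [/\ uniq fd, (size fd <= 2 ^ l)%N &
      fd =i [pred p | [&& (p < n)%N, near lev p & segment w s p]]].

(** Every near point has weight [2^-(j + l)], and the remaining mass sits on [n], the code of no
    answer. Neither labels nor hash functions occur in these weights. *)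
Definition att_law lev j (phi : nat -> R) : R :=
  (\sum_(x <- iota 0 n | near lev x) phi x) / (2 ^ (j + l))%:R +
  (1 - (nearcount lev)%:R / (2 ^ (j + l))%:R) * phi n.

Lemma pick_law lev jj (phi : nat -> R) : (jj <= J)%N ->
  (forall s, (s < 2 ^ (J - jj))%N -> complete lev (2 ^ jj) s) ->
  avg (2 ^ (J + l)) (fun z => phi (pick_found n l G L T lab near col (2 ^ jj) z lev n)) =
  att_law lev (J - jj) phi.
Proof.
move=> jJ comp; set w := (2 ^ jj)%N; set A := (2 ^ (J - jj))%N.
have w0 : (0 < w)%N by rewrite expn_gt0.
have wR : w%:R != 0 :> R by rewrite pnatr_eq0 -lt0n.
(* Write [z = (s * w + mid) * 2^l + u]: [s] is the segment, [u] the rank, and [mid] does not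
   influence the outcome. *)
have EN : (2 ^ (J + l) = A * w * 2 ^ l)%N by rewrite -!expnD subnK.
have EA : (2 ^ (J - jj + l) = A * 2 ^ l)%N by rewrite -expnD.
pose fd s := found n l G L T lab near col lev (s * (w * n)) (s * (w * n) + w * n).
have step s mid : (mid < w)%N -> \sum_(u < 2 ^ l)
     phi (pick_found n l G L T lab near col w ((s * w + mid) * 2 ^ l + u) lev n) =
   \sum_(u < 2 ^ l) (if (u < size (fd s))%N then phi (nth 0%N (fd s) u) else phi n).
  move=> mw; apply: eq_bigr => u _; rewrite /pick_found.
  rewrite modnMDl modn_small // divnMDl ?expn_gt0 // (divn_small (ltn_ord u)) addn0.
  by rewrite divnMDl // (divn_small mw) addn0 -/(fd s); case: ifP.
have inner s : (s < A)%N ->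
   \sum_(u < 2 ^ l) (if (u < size (fd s))%N then phi (nth 0%N (fd s) u) else phi n) =
   \sum_(x <- iota 0 n | near lev x) (segment w s x)%:R * (phi x - phi n)
     + (2 ^ l)%:R * phi n.
  move=> sA; have [us szl mem] := comp s sA.
  (* Splitting off [phi n] leaves a sum over the listed points alone, which no longer depends on
     their order. *)
  have -> : \sum_(u < 2 ^ l) (if (u < size (fd s))%N then phi (nth 0%N (fd s) u) else phi n) =
     \sum_(u < 2 ^ l) ((if (u < size (fd s))%N then phi (nth 0%N (fd s) u) - phi n else 0) + phi n).
    by apply: eq_bigr => u _; case: ifP => _; ring.
  rewrite big_split /= sumr_const card_ord mulr_natl; congr (_ + _).
  rewrite -big_mkcond /=.
  rewrite (big_ord_narrow szl) /=.
  rewrite -(big_mkord xpredT (fun u => phi (nth 0%N (fd s) u) - phi n)) /=.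
  rewrite -(big_nth 0%N xpredT (fun x => phi x - phi n)).
  have pe : perm_eq (fd s) [seq p <- iota 0 n | near lev p && segment w s p].
    apply: uniq_perm => //; first by rewrite filter_uniq ?iota_uniq.
    by move=> p; rewrite mem !inE mem_filter mem_iota add0n /= andbC.
  rewrite (perm_big _ pe) big_filter big_mkcondr; apply: eq_bigr => x _.
  by case: (segment w s x); rewrite ?mul1r ?mul0r.
rewrite /avg EN (sum_mul_ord (fun z => phi (pick_found n l G L T lab near col w z lev n))).
have -> : \sum_(i < A * w) \sum_(u < 2 ^ l)
    phi (pick_found n l G L T lab near col w (i * 2 ^ l + u) lev n) =
  \sum_(s < A) w%:R * (\sum_(x <- iota 0 n | near lev x) (segment w s x)%:R * (phi x - phi n)
     + (2 ^ l)%:R * phi n).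
  rewrite (sum_mul_ord (fun i => \sum_(u < 2 ^ l)
    phi (pick_found n l G L T lab near col w (i * 2 ^ l + u) lev n))).
  apply: eq_bigr => s _; rewrite -inner // mulr_natl -[w in RHS]card_ord -sumr_const.
  by apply: eq_bigr => mid _; apply: step.
rewrite -mulr_sumr big_split /= sumr_const card_ord exchange_big /=.
(* A point has one label and lies in exactly one segment; summing over [s] thus removes the labels
   from the law. *)
have -> : \sum_(x <- iota 0 n | near lev x) \sum_(s < A) (segment w s x)%:R * (phi x - phi n) =
   \sum_(x <- iota 0 n | near lev x) (phi x - phi n).
  apply: eq_bigr => x _; rewrite -mulr_suml.
  have lA : (lab x %/ w < A)%N by rewrite ltn_divLR // -expnD subnK.
  rewrite (bigD1 (Ordinal lA)) //= /segment eqxx big1 ?addr0 ?mul1r // => s.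
  by rewrite -val_eqE /= eq_sym => /negbTE ->.
rewrite sumrB /att_law EA.
have -> : \sum_(x <- iota 0 n | near lev x) phi n = (nearcount lev)%:R * phi n.
  by rewrite big_const_seq iter_addr_0 mulr_natl.
have A0 : A%:R != 0 :> R by rewrite pnatr_eq0 -lt0n expn_gt0.
have l0 : (2 ^ l)%:R != 0 :> R by rewrite pnatr_eq0 -lt0n expn_gt0.
rewrite -[_ *+ A]mulr_natl !natrM; field.
by rewrite A0 l0 wR.
Qed.

End Law.
(** * The law of the answers *)

Section Levels.
Variables (k J : nat).
Hypothesis k_gt0 : 0 < k.

(** The loop counter [jj] belongs to the rate [2^-(J - jj)]: segments widen while levels go down. *)
Definition level_of jj := level k J (J - jj).

Lemma level_of_lt jj : level_of jj < k.
Proof.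
by rewrite /level_of /level ltn_divLR ?addn1 // mulnC ltn_mul2l k_gt0 ltnS leq_subr.
Qed.

Lemma level_le a b : a <= b -> level k J a <= level k J b.
Proof. by move=> ab; rewrite /level leq_div2r // leq_mul2r ab orbT. Qed.

Lemma level_ofJ : level_of J = 0.
Proof. by rewrite /level_of subnn /level mul0n div0n. Qed.

(* The first rate whose level is larger than that of [j]. *)
Definition next j := ((level k J j).+1 * (J + 1) + k.-1) %/ k.

(** A level lasts about [(J + 1) / k] rates. In terms of ball sizes this is the factor of order
    [n^(1/k)] between consecutive levels. *)
Lemma next_le j : next j <= j + ((J + 1) %/ k).+1.
Proof.
have h : level k J j * (J + 1) <= j * k by apply: leq_divM.
rewrite /next; apply: (@leq_trans ((j * k + (J + 1 + k.-1)) %/ k)).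
  by apply: leq_div2r; rewrite mulSn; lia.
rewrite divnMDl // leq_add2l.
have : (J + 1 + k.-1) %/ k <= (J + 1 + k) %/ k by apply: leq_div2r; lia.
by rewrite [(J + 1 + k) %/ k]divnDr // divnn k_gt0 [_ + true]addn1.
Qed.

Lemma level_next j : level k J j < level k J (next j).
Proof.
rewrite {2}/level leq_divRL ?addn1 // -addn1.
have := ltn_ceil ((level k J j).+1 * (J + 1) + k.-1) k_gt0.
by rewrite -/(next j) mulSn; lia.
Qed.

Lemma next_gt j : j < next j.
Proof. by rewrite ltnNge; apply/negP => /level_le; rewrite leqNgt level_next. Qed.

End Levels.

(** * The ideal law of a query *)

Section Query.
Variable R : realFieldType.
 Local Open Scope ring_scope.
Variables (k n l J M : nat) (near : nat -> nat -> bool).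
Hypothesis k_gt0 : (0 < k)%N.
Hypothesis n_gt0 : (0 < n)%N.
Hypothesis l_gt0 : (0 < l)%N.
Hypothesis n_le : (n <= 2 ^ J)%N.
Hypothesis near_mono : forall lev lev' p, (lev <= lev')%N -> near lev p -> near lev' p.

Let lev := level_of k J.
Let N jj := nearcount n near (lev jj).

(** The expectation of [phi] at the final answer if every attempt of [js] followed [att_law] with
    fresh coins. Its weights depend on the dataset and the query only. *)
Fixpoint ideal (js : seq nat) (phi : nat -> R) : R :=
  if js is jj :: js' then
    (\sum_(x <- iota 0 n | near (lev jj) x) phi x) / (2 ^ (J - jj + l))%:R +
    (1 - (N jj)%:R / (2 ^ (J - jj + l))%:R) * ideal js' phi
  else phi n.

Definition stages (r : seq nat) : seq nat := flatten [seq nseq M jj | jj <- r].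

Definition hit jj : bool := (2 ^ (J - jj) <= N jj)%N.

(** Equal to [J.+1] when no rate is hit. The program never computes it: the attempts at this rate
    simply succeed with overwhelming probability. *)
Definition first_hit : nat := find hit (iota 0 J.+1).

Definition pre : seq nat := stages (iota 0 (minn first_hit.+1 J.+1)).

Lemma N_le_n jj : (N jj <= n)%N.
Proof. by rewrite -[X in (_ <= X)%N](size_iota 0 n) count_size. Qed.

Lemma nearcount_mono a b : (a <= b)%N -> (nearcount n near a <= nearcount n near b)%N.
Proof. by move=> ab; apply: sub_count => p; apply: near_mono. Qed.

Lemma before_hit jj : (jj < first_hit)%N -> (jj <= J)%N -> (N jj < 2 ^ (J - jj))%N.
Proof.
move=> jf jJ; have := before_find 0%N jf.
by rewrite nth_iota //= add0n /hit => /negbT; rewrite -ltnNge.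
Qed.

(** The preceding rate was not hit, although its ball was at least as large. At [jj = 0] the size of
    the dataset takes over. *)
Lemma valid_near jj : (jj <= first_hit)%N -> (jj <= J)%N ->
  (N jj <= 2 ^ (J - jj).+1)%N.
Proof.
case: jj => [|jj] jf jJ.
  by apply: leq_trans (N_le_n _) _; apply: leq_trans n_le _; rewrite leq_exp2l; lia.
have := before_hit jf (ltnW jJ); rewrite (subnSK jJ) => h; apply: leq_trans (ltnW h).
by apply: nearcount_mono; apply: level_le => //; lia.
Qed.

(** The same argument at the rate [next], the last one passed whose level exceeds the current one.
    If [next] is larger than [J], the whole dataset has at most [2^J] points anyway. *)
Lemma valid_ann jj : (jj <= first_hit)%N -> (jj <= J)%N ->
  (nearcount n near (lev jj).+1 <= 2 ^ (J - jj) * 2 ^ ((J + 1) %/ k).+1)%N.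
Proof.
move=> jf jJ; rewrite -expnD; set j := (J - jj)%N.
have nle : (next k J j <= j + ((J + 1) %/ k).+1)%N by apply: next_le.
have ngt : (j < next k J j)%N by apply: next_gt.
apply: (@leq_trans (2 ^ next k J j)); last by rewrite leq_exp2l.
have [nJ|nJ] := leqP (next k J j) J; last first.
  rewrite -[X in (X <= _)%N]/(nearcount n near (lev jj).+1).
  have : (nearcount n near (lev jj).+1 <= n)%N.
    by rewrite -[X in (_ <= X)%N](size_iota 0 n) count_size.
  by move/leq_trans; apply; apply: leq_trans n_le _; rewrite leq_exp2l; lia.
have hj : (J - next k J j < first_hit)%N.
  by apply: leq_trans jf; have jE : j = (J - jj)%N by []; lia.
have := before_hit hj (leq_subr _ _); rewrite subKn // => h; apply: leq_trans (ltnW h).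
apply: nearcount_mono; rewrite /lev /level_of subKn //.
exact: level_next.
Qed.

Lemma mem_stages r jj : jj \in stages r -> jj \in r.
Proof. by case/flattenP => _ /mapP[j jr ->]; rewrite mem_nseq => /andP[_ /eqP ->]. Qed.

Lemma pre_valid jj : jj \in pre -> (jj <= first_hit)%N /\ (jj <= J)%N.
Proof. by move/mem_stages; rewrite mem_iota add0n /= leq_min !ltnS => /andP. Qed.

(** Makes the weight of no answer non-negative, which the monotonicity of [ideal] rests on. *)
Definition small jj := (N jj <= 2 ^ (J - jj + l))%N.

Lemma pre_small : all small pre.
Proof.
apply/allP => jj /pre_valid[jf jJ]; rewrite /small.
by apply: leq_trans (valid_near jf jJ) _; rewrite leq_exp2l //; lia.
Qed.

Lemma pow_gt0 e : 0 < (2 ^ e)%:R :> R.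
Proof. by rewrite ltr0n expn_gt0. Qed.

Lemma small_ge0 jj : small jj -> 0 <= 1 - (N jj)%:R / (2 ^ (J - jj + l))%:R :> R.
Proof. by move=> s; rewrite subr_ge0 ler_pdivrMr ?pow_gt0 // mul1r ler_nat. Qed.

Lemma ideal_le js phi psi : all small js ->
  (forall jj x, jj \in js -> (x < n)%N -> near (lev jj) x -> phi x <= psi x) ->
  phi n <= psi n -> ideal js phi <= ideal js psi.
Proof.
elim: js => //= jj js IH /andP[sj sjs] h hn; apply: lerD.
  rewrite ler_wpM2r ?invr_ge0 ?ler0n // big_seq_cond [leRHS]big_seq_cond.
  apply: ler_sum => x /andP[]; rewrite mem_iota add0n /= => xn nx.
  by apply: h nx => //; rewrite mem_head.
apply: ler_wpM2l; first exact: small_ge0.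
by apply: IH => // j x jjs; apply: h; rewrite inE jjs orbT.
Qed.

Lemma idealD js phi psi : ideal js (fun a => phi a + psi a) = ideal js phi + ideal js psi.
Proof. by elim: js => //= jj js ->; rewrite big_split /=; ring. Qed.

(** Used with [E] an average over labels or over hash functions: the weights of [ideal] are
    constants for it, so what an answer teaches the adversary can be averaged after the answer is
    fixed. *)
Lemma ideal_exp (H : Type) (E : (H -> R) -> R) js (phi : H -> nat -> R) :
  expectation E -> E (fun h => ideal js (phi h)) = ideal js (fun a => E (fun h => phi h a)).
Proof.
move=> EE; elim: js => //= jj js IH.
by rewrite (expD EE) (expZr EE) (expZ EE) IH (exp_sum EE).
Qed.

Lemma ideal_cst js c : ideal js (fun=> c) = c.
Proof.
elim: js => //= jj js ->.
rewrite big_const_seq iter_addr_0 -mulr_natl -[count _ _]/(N jj).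
have : (2 ^ (J - jj + l))%:R != 0 :> R by rewrite gt_eqF ?pow_gt0.
by move: (2 ^ _)%:R => p p0; field.
Qed.

Definition miss js : R := ideal js (fun a => (a == n)%:R).

Lemma missE js : miss js = \prod_(jj <- js) (1 - (N jj)%:R / (2 ^ (J - jj + l))%:R).
Proof.
rewrite /miss; elim: js => [|jj js IH] /=; first by rewrite big_nil eqxx.
rewrite big_cons IH big1_seq ?mul0r ?add0r // => x /andP[_].
by rewrite mem_iota add0n /= => /ltn_eqF ->.
Qed.

(** At the first hit the ball holds at least [2^j] points of weight [2^-(j + l)] each, so each of
    the [M] attempts succeeds with probability at least [2^-l]. The factors of earlier rates are at
    most 1. *)
Lemma miss_pre : (first_hit <= J)%N -> miss pre <= (1 - (2 ^ l)%:R^-1) ^+ M.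
Proof.
move=> fJ; have ps := pre_small; move: ps.
rewrite missE /pre (minn_idPl _) // -addn1 iotaD /stages map_cat flatten_cat /= cats0 add0n.
rewrite all_cat => /andP[s1 _].
rewrite big_cat /= [X in _ * X]big_nseq iter_mulr_1 -[X in _ <= X]mul1r.
have hf : hit first_hit.
  have := @nth_find _ 0%N hit (iota 0 J.+1); rewrite has_find size_iota ltnS => /(_ fJ).
  by rewrite nth_iota ?ltnS // add0n.
have sf : small first_hit.
  by rewrite /small; apply: leq_trans (valid_near (leqnn _) fJ) _; rewrite leq_exp2l //; lia.
apply: ler_pM.
- elim: (flatten _) s1 => [|j js IH] /=; first by rewrite big_nil.
  by rewrite big_cons => /andP[sj /IH h]; apply: mulr_ge0 => //; apply: small_ge0.
- by apply: exprn_ge0; apply: small_ge0.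
- elim: (flatten _) s1 => [|j js IH] /=; first by rewrite big_nil.
  rewrite big_cons => /andP[sj /IH h].
  have s0 := small_ge0 sj.
  have s1 : 1 - (N j)%:R / (2 ^ (J - j + l))%:R <= 1 :> R.
    by rewrite lerBlDr lerDl divr_ge0 ?ler0n.
  apply: le_trans (ler_wpM2l s0 h) _; by rewrite mulr1.
- apply: lerXn2r; rewrite ?nnegrE ?small_ge0 //.
    by rewrite subr_ge0 invf_le1 ?pow_gt0 // ler1n expn_gt0.
  rewrite lerD2l lerN2 expnD natrM invfM mulrA ler_pMl ?invr_gt0 ?pow_gt0 //.
  by rewrite ler_pdivlMr ?pow_gt0 // mul1r ler_nat.
Qed.

Variables (G L T : nat) (lab : nat -> nat) (col : nat -> nat -> nat -> bool).
Hypothesis lab_lt : forall p, (lab p < 2 ^ J)%N.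

Definition qstep (ans : nat) (jz : nat * nat) : nat :=
  if (ans < n)%N then ans
  else pick_found n l G L T lab near col (2 ^ jz.1) jz.2 (lev jz.1) ans.

Definition qrun js zs : nat := foldl qstep n (zip js zs).

Definition lawful jj : Prop := forall s, (s < 2 ^ (J - jj))%N ->
  complete n l G L T lab near col (lev jj) (2 ^ jj) s.

Lemma foldl_qstep_lt a s : (a < n)%N -> foldl qstep a s = a.
Proof. by move=> an; elim: s => //= x s; rewrite /qstep an. Qed.

Lemma pick_le jj z : (pick_found n l G L T lab near col (2 ^ jj) z (lev jj) n <= n)%N.
Proof. exact: pick_found_le. Qed.

Lemma foldl_qstep_le s : (foldl qstep n s <= n)%N.
Proof.
elim: s => //= x s; rewrite /qstep ltnn.
have := pick_le x.1 x.2; rewrite leq_eqVlt => /orP[/eqP -> //|lt _].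
by rewrite foldl_qstep_lt // ltnW.
Qed.

Lemma qrun_ideal js phi : (forall jj, jj \in js -> (jj <= J)%N /\ lawful jj) ->
  avgs (2 ^ (J + l)) (size js) (fun zs => phi (qrun js zs)) = ideal js phi.
Proof.
rewrite /qrun; elim: js => [|jj js IH] law //=.
have EE := avgs_expectation R (size js) (expn_gt0 2 (J + l)).
have [jJ lawj] := law jj (mem_head _ _).
(* The value of the continuation: an answer once found is frozen, otherwise the remaining attempts
   are still ideal. *)
pose psi a := if (a < n)%N then phi a else ideal js phi.
transitivity (avg (2 ^ (J + l))
    (fun z => psi (pick_found n l G L T lab near col (2 ^ jj) z (lev jj) n))).
  apply: avg_eq => z _; rewrite /psi /qstep /= ltnn.
  set a := pick_found _ _ _ _ _ _ _ _ _ _ _ _.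
  have an : (a <= n)%N by apply: pick_le.
  case: ltngtP an => // [lt|eqa] _; last first.
    by rewrite eqa; apply: IH => j jjs; apply: law; rewrite inE jjs orbT.
  rewrite -[RHS](exp_cst EE); apply: (exp_ext EE) => s.
  by rewrite foldl_qstep_lt.
rewrite (pick_law lab_lt psi jJ lawj) /att_law; congr (_ / _ + _ * _).
  rewrite big_seq_cond [RHS]big_seq_cond; apply: eq_bigr => x.
  by rewrite mem_iota add0n /= /psi => /andP[-> _].
by rewrite /psi ltnn.
Qed.

Lemma size_stages r : size (stages r) = (size r * M)%N.
Proof.
by elim: r => //= j r IH; rewrite /stages /= size_cat size_nseq IH mulSn.
Qed.

(** A wrong answer is charged 1. If some rate is hit, an answer is present after [pre] except with
    ideal probability [eps], and stays; being near at some level, it is correct. If none is hit,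
    [pre] is the whole run. Only the stages up to the first hit have to be lawful. *)
Lemma query_le (ok : pred nat) (phi : nat -> R) eps :
  (forall a, 0 <= phi a <= 1) ->
  (forall lv x, (lv < k)%N -> (x < n)%N -> near lv x -> ok x) ->
  ((forall x, (x < n)%N -> ~~ near 0%N x) -> ok n) ->
  (forall jj, (jj <= first_hit)%N -> (jj <= J)%N -> lawful jj) ->
  (1 - (2 ^ l)%:R^-1) ^+ M <= eps -> 0 <= eps ->
  avgs (2 ^ (J + l)) (J.+1 * M)
    (fun zs => let a := qrun (stages (iota 0 J.+1)) zs in if ok a then phi a else 1)
  <= ideal pre phi + eps.
Proof.
move=> phi01 okx okn law heps eps0; cbv zeta.
have law' jj : jj \in pre -> (jj <= J)%N /\ lawful jj.
  by case/pre_valid => a b; split=> //; apply: law.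
have [fJ|Jf] := leqP first_hit J.
  pose psi a := if (a < n)%N && ok a then phi a else 1.
  have E : stages (iota 0 J.+1) = pre ++ stages (iota first_hit.+1 (J - first_hit)).
    rewrite /pre (minn_idPl _) // /stages -flatten_cat -map_cat; congr (flatten (map _ _)).
    by rewrite -{2}[first_hit.+1]add0n -iotaD; congr iota; lia.
  have szE : (J.+1 * M = size pre + size (stages (iota first_hit.+1 (J - first_hit))))%N.
    by rewrite -size_cat -E size_stages size_iota.
  rewrite szE avgs_cat.
  have EE := avgs_expectation R (size (stages (iota first_hit.+1 (J - first_hit)))) (expn_gt0 2 (J + l)).
  apply: (@le_trans _ _ (avgs (2 ^ (J + l)) (size pre) (fun zs => psi (qrun pre zs)))).
    apply: avgs_le_in => zs1 /andP[/eqP sz1 _].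
    rewrite -[leRHS](exp_cst EE); apply: (exp_le EE) => zs2.
    rewrite E /qrun zip_cat ?sz1 // foldl_cat -/(qrun pre zs1) /psi.
    case: (ltnP (qrun pre zs1) n) => an /=; first by rewrite foldl_qstep_lt.
    by case: ifP => // _; case/andP: (phi01 (foldl qstep (qrun pre zs1)
         (zip (stages (iota first_hit.+1 (J - first_hit))) zs2))).
  rewrite (qrun_ideal psi law').
  apply: (@le_trans _ _ (ideal pre (fun a => phi a + (a == n)%:R))); last first.
    by rewrite idealD lerD2l; apply: le_trans (miss_pre fJ) heps.
  apply: ideal_le pre_small _ _.
    move=> jj x _ xn nx; rewrite /psi xn (okx _ _ (level_of_lt _ k_gt0 _) xn nx) /=.
    by rewrite lerDl ler0n.
  by rewrite /psi ltnn eqxx /= lerDr; case/andP: (phi01 n).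
have -> : stages (iota 0 J.+1) = pre by rewrite /pre (minn_idPr _) //; lia.
have -> : (J.+1 * M)%N = size pre by rewrite size_stages size_iota (minn_idPr _) //; lia.
pose psi a := if ok a then phi a else 1.
rewrite (qrun_ideal psi law') -[leLHS]addr0; apply: lerD => //.
apply: ideal_le pre_small _ _.
  by move=> jj x _ xn nx; rewrite /psi (okx _ _ (level_of_lt _ k_gt0 _) xn nx).
rewrite /psi okn // => x xn.
(* At [jj = J] the rate is 1 and the level 0: no hit means that the smallest ball is empty, so no
   answer is the right one. *)
have := before_hit Jf (leqnn J); rewrite subnn expn0 ltnS leqn0 => /eqP N0.
apply/negP => nx; have : (0 < N J)%N.
  by rewrite -has_count; apply/hasP; exists x; rewrite ?mem_iota //= /lev level_ofJ.
by rewrite N0.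
Qed.

End Query.

(** * Elementary estimates *)

Local Open Scope ring_scope.

(** A rational substitute for [(1 - w)^M <= exp (- M w)], enough to get 1/4 from [M w >= 3]. *)
Lemma pow_compl_le (R : realFieldType) (w : R) M : 0 <= w <= 1 ->
  (1 - w) ^+ M * (1 + M%:R * w) <= 1.
Proof.
case/andP=> w0 w1; elim: M => [|M IH]; first by rewrite expr0 mul0r addr0 mul1r.
apply: le_trans IH; rewrite exprSr -mulrA ler_wpM2l //.
  by apply: exprn_ge0; rewrite subr_ge0.
rewrite -natr1; have : 0 <= (M%:R + 1) * w ^+ 2 :> R by rewrite mulr_ge0 ?addr_ge0 ?exprn_ge0.
by nra.
Qed.

Lemma table_number (R : realFieldType) (w : R) L : 0 <= w <= 1 -> 3 <= L%:R * w ->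
  exists M, [/\ (M <= L)%N, 3 <= M%:R * w & M%:R * w <= 4].
Proof.
case/andP=> w0 w1 hL.
have ex : exists M, 3 <= M%:R * w by exists L.
(* The least such [M] overshoots 3 by at most [w <= 1]. *)
case: (ex_minnP ex) => M hM minM; exists M; split=> //; first exact: minM.
case: M hM minM => [|M] hM minM; first by rewrite mul0r.
rewrite leNgt; apply/negP => h; have : (M.+1 <= M)%N; last by rewrite ltnn.
by apply: minM; move: h; rewrite -[M.+1%:R]natr1 mulrDl; lra.
Qed.

(* [(1 + 2^-j)^(2^j) <= 4], by squaring a bound for half of the exponent. *)
Lemma pow_dyadic_le4 (R : realFieldType) j :
  (1 + (2 ^ j)%:R^-1) ^+ (2 ^ j) <= 4 :> R.
Proof.
case: j => [|j]; first by rewrite expn0 invr1 expr1; lra.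
set h := (2 ^ j)%N; set x : R := (2 ^ j.+1)%:R^-1.
have h0 : 0 < h%:R :> R by rewrite ltr0n expn_gt0.
have x0 : 0 < x by rewrite invr_gt0 ltr0n expn_gt0.
have hx : h%:R * x = 2^-1.
  by rewrite /x expnS natrM invfM mulrCA divff ?mulr1 // gt_eqF.
rewrite expnS mulnC exprM.
have s1 : (1 + x) ^+ h <= 2.
  (* The inverse of [1 + x] is [1 - y]; Bernoulli's inequality and [y <= x] bound [(1 - y)^h] from
     below by [1 - h x = 1/2]. *)
  pose y := x / (1 + x).
  have x1 : 0 < 1 + x by rewrite addr_gt0.
  have y01 : 0 <= y <= 1.
    rewrite /y divr_ge0 ?(ltW x0) ?(ltW x1) // ler_pdivrMr // mul1r lerDr; exact: ler01.
  have E : (1 + x) * (1 - y) = 1 by rewrite /y; field; rewrite gt_eqF ?addr_gt0.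
  have B : 2^-1 <= (1 - y) ^+ h.
    have : 1 - h%:R * y <= (1 - y) ^+ h.
      case/andP: y01 => y0 y1; elim: (h) => [|i IH]; first by rewrite expr0 mul0r subr0.
      rewrite exprSr -natr1; have : 0 <= 1 - y by rewrite subr_ge0.
      have : 0 <= i%:R :> R by rewrite ler0n.
      by nra.
    apply: le_trans; have : y <= x.
      by rewrite ler_pdivrMr ?addr_gt0 // mulrDr mulr1 lerDl mulr_ge0 // ltW.
    by nra.
  have E' : (1 + x) ^+ h * (1 - y) ^+ h = 1 by rewrite -exprMn E expr1n.
  have p0 : 0 <= (1 + x) ^+ h by apply: exprn_ge0; rewrite addr_ge0 // ltW.
  by nra.
rewrite expr2; have p0 : 0 <= (1 + x) ^+ h by apply: exprn_ge0; rewrite addr_ge0 // ltW.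
by nra.
Qed.

Lemma sum_count (R : pzSemiRingType) (P : pred nat) n :
  \sum_(p < n) (P p)%:R = (count P (iota 0 n))%:R :> R.
Proof.
rewrite -(big_mkord xpredT (fun p => (P p)%:R)) /index_iota subn0.
elim: (iota 0 n) => [|p s IH]; first by rewrite big_nil.
by rewrite big_cons IH -natrD.
Qed.

(** * Concentration of the random labels *)

Section Load.
Variable R : realFieldType.
Variables (n J j r a s : nat) (Bp : pred nat).
Hypothesis jJ : (j <= J)%N.
Hypothesis s_lt : (s < 2 ^ j)%N.
Hypothesis count_le : (count Bp (iota 0 n) <= 2 ^ j * r)%N.

Lemma avg_segment : avg (2 ^ J) (fun z => (z %/ 2 ^ (J - j) == s)%N%:R : R) = (2 ^ j)%:R^-1.
Proof.
have EJ : (2 ^ J = 2 ^ j * 2 ^ (J - j))%N by rewrite -expnD subnKC.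
rewrite /avg EJ (sum_mul_ord (fun z => (z %/ 2 ^ (J - j) == s)%N%:R : R)).
have -> : \sum_(i < 2 ^ j) \sum_(u < 2 ^ (J - j))
    (((i * 2 ^ (J - j) + u) %/ 2 ^ (J - j))%N == s)%:R =
  \sum_(i < 2 ^ j) (2 ^ (J - j))%:R * (nat_of_ord i == s)%:R :> R.
  apply: eq_bigr => i _; rewrite mulr_natl -[X in _ *+ X]card_ord -sumr_const.
  by apply: eq_bigr => u _; rewrite divnMDl ?expn_gt0 // divn_small ?addn0.
rewrite -mulr_sumr (bigD1 (Ordinal s_lt)) //= eqxx big1 ?addr0 ?mulr1 => [|i].
  by rewrite natrM invfM mulrCA divff ?mulr1 // pnatr_eq0 -lt0n expn_gt0.
by rewrite -val_eqE /= => /negbTE ->.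
Qed.

(** Exponential moment: the labels are independent, so the average of 2 to the load is [(1 + 2^-j)]
    to the size of the ball, at most [4^r]. Markov's inequality at [2^a] concludes. *)
Lemma load_le :
  avgs (2 ^ J) n (fun labs =>
    (a <= count (fun p => Bp p && segment (nth 0%N labs) (2 ^ (J - j)) s p) (iota 0 n))%N%:R)
  <= 4 ^+ r / 2 ^+ a :> R.
Proof.
have EE := avgs_expectation R n (expn_gt0 2 J).
pose g i z : R := 1 + (Bp i && (z %/ 2 ^ (J - j) == s)%N)%:R.
apply: (@le_trans _ _ (avgs (2 ^ J) n
   (fun labs => (\prod_(i < n) g i (nth 0%N labs i)) * (2 ^+ a)^-1))).
  apply: (exp_le EE) => labs; rewrite ler_pdivlMr ?exprn_gt0 //.
  have -> : \prod_(i < n) g i (nth 0%N labs i) =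
     2 ^+ count (fun p => Bp p && segment (nth 0%N labs) (2 ^ (J - j)) s p) (iota 0 n).
    rewrite -(big_mkord xpredT (fun i => g i (nth 0%N labs i))) /index_iota subn0.
    elim: (iota 0 n) => [|p t IH]; first by rewrite big_nil.
    rewrite big_cons IH /= exprD /g -/(segment _ _ _ _); congr (_ * _).
    by case: (_ && _); rewrite /= ?expr1 ?expr0 ?addr0.
  case: leqP => h; last by rewrite mul0r exprn_ge0.
  by rewrite mul1r ler_eXn2l // ltr1n.
rewrite (expZr EE) ler_wpM2r ?invr_ge0 ?exprn_ge0 //.
rewrite (avgs_prod _ _ (expn_gt0 2 J)).
have E1 := avg_expectation R (expn_gt0 2 J).
have -> : \prod_(i < n) avg (2 ^ J) (g i) = (1 + (2 ^ j)%:R^-1) ^+ count Bp (iota 0 n).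
  rewrite -(big_mkord xpredT (fun i => avg (2 ^ J) (g i))) /index_iota subn0.
  elim: (iota 0 n) => [|p t IH]; first by rewrite big_nil.
  rewrite big_cons IH /= exprD; congr (_ * _).
  rewrite (expD E1) (exp1 E1); case: (Bp p) => /=; last by rewrite (exp_cst E1) addr0.
  by rewrite avg_segment expr1.
apply: (@le_trans _ _ ((1 + (2 ^ j)%:R^-1) ^+ (2 ^ j * r))).
  by apply: ler_weXn2l => //; rewrite lerDl invr_ge0 ler0n.
have b0 : 0 <= 1 + (2 ^ j)%:R^-1 :> R by rewrite addr_ge0 // invr_ge0 ler0n.
by rewrite exprM; apply: lerXn2r; rewrite ?nnegrE ?exprn_ge0 ?pow_dyadic_le4.
Qed.

End Load.

Lemma natr_all (R : nzRingType) (P : pred nat) s :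
  (all P s)%:R = \prod_(a <- s) (P a)%:R :> R.
Proof.
elim: s => [|a s IH]; first by rewrite big_nil.
by rewrite big_cons -IH /=; case: (P a); rewrite ?mul1r ?mul0r.
Qed.

(** * Probability that the tables miss a near point *)

Section Hash.
Variables (R : realFieldType) (I V : finType) (mu : I -> V -> R).
Hypothesis mu_ge0 : forall i v, 0 <= mu i v.
Hypothesis mu_sum : forall i, \sum_v mu i v = 1.
Variables (hash_hit : V -> nat -> bool) (idx : nat -> nat -> I) (jdx : I -> nat).
Variables (k n l J G L T H nu r : nat) (K : nat -> nat).
Variables (near : nat -> nat -> bool) (colp : nat -> nat -> R).
Hypothesis jdxK : forall lev j, (lev < k)%N -> (j < H)%N -> jdx (idx lev j) = j.
Hypothesis H_ge : forall lev, (lev < k)%N -> (G * L * K lev <= H)%N.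
Hypothesis colpE : forall lev j p, (lev < k)%N -> (j < H)%N -> (p < n)%N ->
  \sum_v mu (idx lev j) v * (hash_hit v p)%:R = colp lev p.
Hypothesis colp01 : forall lev p, (lev < k)%N -> (p < n)%N -> 0 <= colp lev p <= 1.
Hypothesis colp_near : forall lev p, (lev < k)%N -> (p < n)%N -> near lev p ->
  3 <= L%:R * colp lev p ^+ K lev.
Hypothesis colp_mono : forall lev x y, (lev < k)%N -> (x < n)%N -> (y < n)%N ->
  near lev x -> ~~ near lev y -> colp lev y <= colp lev x.
Hypothesis colp_far : forall lev p, (lev < k)%N -> (p < n)%N -> ~~ near lev.+1 p ->
  n%:R * colp lev p ^+ K lev <= 1.
Hypothesis T_ge : (L * 2 ^ l + 4 * (4 * nu + L) <= T)%N.
Hypothesis n_gt0 : (0 < n)%N.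

Let E := Ex mu.
Let EE : expectation E := Ex_expectation mu_ge0 mu_sum.

Definition colv (v : {ffun I -> V}) lev tau p : bool :=
  all (fun a => hash_hit (v (idx lev (tau * K lev + a)%N)) p) (iota 0 (K lev)).

Lemma hash_index_lt lev tau a : (lev < k)%N -> (tau < G * L)%N -> (a < K lev)%N ->
  (tau * K lev + a < H)%N.
Proof.
move=> levk taul aK; apply: leq_trans (H_ge levk).
apply: (@leq_trans (tau.+1 * K lev)); first by rewrite mulSn; lia.
by rewrite leq_mul2r taul orbT.
Qed.

Lemma colvP lev tau p : (lev < k)%N -> (tau < G * L)%N -> (p < n)%N ->
  E (fun v => (colv v lev tau p)%:R) = colp lev p ^+ K lev.
Proof.
move=> levk taul pn.
have -> : colp lev p ^+ K lev = \prod_(a <- iota 0 (K lev)) E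
    (fun v => (hash_hit (v (idx lev (tau * K lev + a)%N)) p)%:R).
  transitivity (\prod_(a <- iota 0 (K lev)) colp lev p).
    by rewrite big_const_seq count_predT size_iota iter_mulr_1.
  apply: eq_big_seq => a; rewrite mem_iota add0n /= => aK.
  rewrite /E (Ex_coord mu_sum _ (fun v => (hash_hit v p)%:R)) colpE //.
  exact: hash_index_lt.
(* The truncated subtraction sends all earlier hash functions to block 0; this is harmless, as a
   block may be larger than what is read from it. *)
rewrite /E -(Ex_indep mu_ge0 mu_sum (b := (fun i => jdx i - tau * K lev)%N) (iota_uniq _ _)).
  by apply: (exp_ext EE) => v; rewrite natr_all.
move=> a; rewrite mem_iota add0n /= => aK v v' vv'; rewrite vv' //=.
by rewrite jdxK ?hash_index_lt // addKn.
Qed.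

Section Group.
Variables (labs : seq nat) (lev j s : nat).
Hypothesis levk : (lev < k)%N.
Hypothesis jJ : (j <= J)%N.
Let lab := nth 0%N labs.
Let w := (2 ^ (J - j))%N.
Let lo := (s * (w * n))%N.
Let hi := (s * (w * n) + w * n)%N.
Let w_gt0 : (0 < w)%N. Proof. by rewrite expn_gt0. Qed.

Definition load_near : nat := count (fun p => near lev p && segment lab w s p) (iota 0 n).
Definition load_ann : nat := count (fun p => near lev.+1 p && segment lab w s p) (iota 0 n).

Hypothesis near_ok : (load_near <= 2 ^ l)%N.
Hypothesis ann_ok : (load_ann <= nu)%N.

Definition hitv v g x := group_hit n L T lab (colv v) lev lo hi g x.

Lemma size_ents_le v tau : (size (ents n lab (colv v) lev tau lo hi))%:R <=
  (2 ^ l)%:R + \sum_(y < n | ~~ near lev y && segment lab w s y) (colv v lev tau y)%:R :> R.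
Proof.
rewrite big_mkcond /=.
have -> : (size (ents n lab (colv v) lev tau lo hi))%:R =
   \sum_(y < n) (colv v lev tau y && segment lab w s y)%:R :> R.
  rewrite (sum_count R (fun y => colv v lev tau y && segment lab w s y)).
  congr (_%:R); rewrite size_filter.
  transitivity (count (fun p => colv v lev tau p && inrange n lab lo hi p) (iota 0 n)).
    by apply/permP; rewrite perm_sort.
  by apply: eq_in_count => p; rewrite mem_iota add0n /= => pn; rewrite inrange_segment.
apply: (@le_trans _ _ (load_near%:R +
    \sum_(y < n) (if ~~ near lev y && segment lab w s y then (colv v lev tau y)%:R else 0))).
  rewrite /load_near -sum_count -big_split; apply: ler_sum => y _.
  case: (near lev y); case: (segment lab w s y); rewrite /= ?andbF ?andbT ?addr0 ?add0r ?lerDl ?lerDr //.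
  by case: (colv _ _ _ _); rewrite ?ler01.
by rewrite lerD2r ler_nat.
Qed.

Lemma far_sum M (q : R) : (M <= L)%N -> (forall y, (y < n)%N -> ~~ near lev y ->
    colp lev y ^+ K lev <= q) -> 0 <= q -> M%:R * q <= 4 ->
  M%:R * \sum_(y < n | ~~ near lev y && segment lab w s y) colp lev y ^+ K lev <=
  (4 * nu + L)%:R.
Proof.
move=> ML hq q0 Mq; rewrite mulr_sumr.
have nR : 0 < n%:R :> R by rewrite ltr0n.
apply: (@le_trans _ _ (\sum_(y < n) (4 * (near lev.+1 y && segment lab w s y)%:R + L%:R / n%:R))).
  rewrite big_mkcond /=; apply: ler_sum => y _.
  have Ln : 0 <= L%:R / n%:R :> R by rewrite divr_ge0.
  case: ifP => [/andP[ny sy]|_]; last by rewrite addr_ge0 // mulr_ge0.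
  rewrite sy andbT; case n1: (near lev.+1 y) => /=.
    rewrite mulr1; apply: le_trans (ler_wpM2l _ (hq y (ltn_ord y) ny)) _ => //.
    by apply: le_trans Mq _; rewrite lerDl.
  rewrite mulr0 add0r ler_pdivlMr // -mulrA [_ * n%:R]mulrC.
  have := colp_far levk (ltn_ord y) (negbT n1).
  set c := n%:R * _ => hc; apply: (@le_trans _ _ M%:R); last by rewrite ler_nat.
  by apply: ler_piMr.
rewrite big_split /= sumr_const card_ord -mulr_sumr (sum_count R (fun y => near lev.+1 y && segment lab w s y)).
rewrite natrD natrM lerD //.
  by rewrite ler_wpM2l // ler_nat.
by rewrite -[X in X <= _]mulr_natr divfK // gt_eqF.
Qed.

Lemma hitv_depends g x : (g < G)%N ->
  depends (fun v => (~~ hitv v g x)%:R : R) [pred i | (jdx i %/ (L * K lev))%N == g].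
Proof.
move=> gG v v' vv'; congr (_%:R); congr (nat_of_bool (~~ _)).
have colE t y : (t < L)%N -> colv v lev (g * L + t) y = colv v' lev (g * L + t) y.
  move=> tL; apply: eq_in_all => a; rewrite mem_iota add0n /= => aK.
  have taul : (g * L + t < G * L)%N.
    apply: (@leq_trans (g.+1 * L)); first by rewrite mulSn; lia.
    by rewrite leq_mul2r gG orbT.
  rewrite vv' //= jdxK ?hash_index_lt //.
  have tK : (t * K lev + a < L * K lev)%N.
    apply: (@leq_trans (t.+1 * K lev)); first by rewrite mulSn; lia.
    by rewrite leq_mul2r tL orbT.
  by rewrite mulnDl -mulnA -addnA divnMDl ?(divn_small tK) ?addn0 //; lia.
apply: eq_in_has => M; rewrite mem_iota add0n ltnS /= => ML; congr (_ && _).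
  by apply: eq_in_has => t; rewrite mem_iota add0n /= => tM; apply: colE; lia.
congr (_ <= _)%N; apply: eq_big_seq => t; rewrite mem_iota add0n /= => tM.
by congr size; apply: eq_filter => p; rewrite colE //; lia.
Qed.

(* One group of tables misses a near point with probability at most 1/2: reading the
   first [M] tables, with [M] about [3 / w] for a point colliding with probability [w],
   suffices, and points that are not near collide at most as often as this one. *)
Lemma group_miss g x : (g < G)%N -> (x < n)%N -> near lev x ->
  E (fun v => (~~ hitv v g x)%:R) <= 2^-1.
Proof.
move=> gG xn nx; set q := colp lev x ^+ K lev.
have q01 : 0 <= q <= 1.
  by case/andP: (colp01 levk xn) => c0 c1; rewrite exprn_ge0 // exprn_ile1.
have [M [ML M3 M4]] := table_number q01 (colp_near levk xn nx).
have gl t : t \in iota 0 M -> (g * L + t < G * L)%N.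
  rewrite mem_iota add0n /= => tM; apply: (@leq_trans (g.+1 * L)); first by rewrite mulSn; lia.
  by rewrite leq_mul2r gG orbT.
pose no v : R := \prod_(t <- iota 0 M) (1 - (colv v lev (g * L + t) x)%:R).
pose Z v : R := \sum_(t <- iota 0 M) \sum_(y < n | ~~ near lev y && segment lab w s y)
  (colv v lev (g * L + t) y)%:R.
(* Four times the expectation bounded by [far_sum], so that Markov's inequality leaves 1/4; [T_ge]
   is tailored to this threshold. *)
pose a : R := 4 * (4 * nu + L)%:R.
have L0 : (0 < L)%N.
  by rewrite lt0n; apply: contraTneq (colp_near levk xn nx) => ->; rewrite mul0r -ltNge ltr0n.
have a0 : 0 < a by rewrite mulr_gt0 // ltr0n; lia.
have Z0 v : 0 <= Z v by apply: sumr_ge0 => t _; apply: sumr_ge0 => y _; rewrite ler0n.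
(* A miss means that none of the first [M] tables catches [x], or that together they exceed the
   budget although near points fill at most [2^l] entries in each. *)
have step : E (fun v => (~~ hitv v g x)%:R) <= E (fun v => no v + (a <= Z v)%R%:R).
  apply: (exp_le EE) => v.
  have no0 : 0 <= no v by apply: prodr_ge0 => t _; case: colv; rewrite /= ?subrr ?subr0.
  have [hv|hv] := boolP (hitv v g x); first by rewrite /= addr_ge0 // ler0n.
  rewrite /=; case: (lerP a (Z v)) => Za; first by rewrite lerDr.
  rewrite addr0; move: hv; rewrite -all_predC => /allP /(_ M).
  rewrite mem_iota add0n ltnS ML /= => /(_ isT); rewrite negb_and => /orP[|].
    rewrite -all_predC => /allP h; rewrite /no big1_seq // => t /andP[_ tM].
    by have /= := h t tM; case: colv; rewrite //= subr0.
  rewrite -ltnNge => Tlt; exfalso; move: Za; rewrite ltNge => /negP; apply.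
  have h1 : T%:R <= (M * 2 ^ l)%:R + Z v.
    apply: (@le_trans _ _ (\sum_(t <- iota 0 M)
        size (ents n lab (colv v) lev (g * L + t) lo hi))%N%:R); first by rewrite ler_nat ltnW.
    rewrite natr_sum natrM -[X in X%:R * _](size_iota 0 M) -sum1_size natr_sum mulr_suml -big_split.
    by apply: ler_sum => t _; rewrite mul1r; apply: size_ents_le.
  have h2 : (L * 2 ^ l)%:R + a <= T%:R.
    by rewrite /a -natrM -natrD ler_nat.
  have h3 : (M * 2 ^ l)%:R <= (L * 2 ^ l)%:R :> R by rewrite ler_nat leq_mul2r ML orbT.
  by rewrite -(lerD2l (L * 2 ^ l)%:R); apply: le_trans h2 _; apply: le_trans h1 _; rewrite lerD2r.
apply: le_trans step _; rewrite (expD EE).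
have -> : 2^-1 = 4^-1 + 4^-1 :> R by lra.
apply: lerD.
  have -> : E no = (1 - q) ^+ M.
    rewrite /E (Ex_indep mu_ge0 mu_sum (b := (fun i => (jdx i %/ K lev - g * L))%N) (iota_uniq _ _)).
      transitivity (\prod_(t <- iota 0 M) (1 - q)); last first.
        by rewrite big_const_seq count_predT size_iota iter_mulr_1.
      apply: eq_big_seq => t tM; rewrite -/E (expB EE) (exp1 EE); congr (1 - _).
      exact: colvP (gl _ tM) xn.
    move=> t tM v v' vv'; congr (1 - (nat_of_bool _)%:R).
    apply: eq_in_all => b; rewrite mem_iota add0n /= => bK; rewrite vv' //=.
    rewrite jdxK ?hash_index_lt ?gl // divnMDl ?(divn_small bK) ?addn0 ?addKn //.
    exact: leq_ltn_trans bK.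
  (* With [3 <= M q] this bounds [(1 - q)^M] by 1/4, the other half of the allowance. *)
  have := pow_compl_le M q01; have : 0 <= (1 - q) ^+ M.
    by case/andP: q01 => _ q1; apply: exprn_ge0; rewrite subr_ge0.
  by nra.
apply: le_trans (markov EE Z0 a0) _.
rewrite ler_pdivrMr // /a mulrA mulVf ?pnatr_eq0 // mul1r.
rewrite (exp_sum EE); apply: le_trans (far_sum ML (q := q) _ _ M4).
- rewrite -[X in X%:R * _](size_iota 0 M) -sum1_size natr_sum mulr_suml.
  rewrite big_seq [leRHS]big_seq; apply: ler_sum => t tM; rewrite mul1r (exp_sum EE).
  by apply: ler_sum => y _; rewrite colvP ?gl.
- move=> y yn ny; have := colp_mono levk xn yn nx ny.
  by case/andP: (colp01 levk yn) => c0 _; apply: lerXn2r; rewrite nnegrE //; case/andP: (colp01 levk xn).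
- by case/andP: q01.
Qed.

(** Groups read disjoint blocks of [L * K lev] hash functions and are therefore independent. *)
Lemma all_miss x : (x < n)%N -> near lev x ->
  E (fun v => (~~ has (fun g => hitv v g x) (iota 0 G))%:R) <= 2^-1 ^+ G.
Proof.
move=> xn nx.
have -> : E (fun v => (~~ has (fun g => hitv v g x) (iota 0 G))%:R) =
   \prod_(g <- iota 0 G) E (fun v => (~~ hitv v g x)%:R).
  rewrite /E -(Ex_indep mu_ge0 mu_sum (b := fun i => (jdx i %/ (L * K lev))%N) (iota_uniq _ _)).
    by apply: (exp_ext EE) => v; rewrite -all_predC natr_all.
  by move=> g; rewrite mem_iota add0n /= => gG; apply: hitv_depends.
have -> : 2^-1 ^+ G = \prod_(g <- iota 0 G) 2^-1 :> R.
  by rewrite big_const_seq count_predT size_iota iter_mulr_1.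
rewrite big_seq [leRHS]big_seq; apply: ler_prod => g; rewrite mem_iota add0n /= => gG.
by rewrite group_miss // andbT; apply: (exp_ge0 EE) => v; rewrite ler0n.
Qed.

End Group.

Definition segment_ok (labs : seq nat) (v : {ffun I -> V}) lev j s : bool :=
  (load_near labs lev j s <= 2 ^ l)%N &&
  all (fun x => (near lev x && segment (nth 0%N labs) (2 ^ (J - j)) s x) ==>
                has (fun g => hitv labs lev j s v g x) (iota 0 G)) (iota 0 n).

Definition stage_ok labs v lev j : bool :=
  all (segment_ok labs v lev j) (iota 0 (2 ^ j)).

Lemma segment_okP labs v lev j s : segment_ok labs v lev j s ->
  complete n l G L T (nth 0%N labs) near (colv v) lev (2 ^ (J - j)) s.
Proof.
case/andP=> ld /allP hit.
have w0 : (0 < 2 ^ (J - j))%N by rewrite expn_gt0.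
have wE p : wanted n (nth 0%N labs) near lev (s * (2 ^ (J - j) * n))
    (s * (2 ^ (J - j) * n) + 2 ^ (J - j) * n) p =
    [&& (p < n)%N, near lev p & segment (nth 0%N labs) (2 ^ (J - j)) s p].
  rewrite /wanted; case pn: (p < n)%N => //=; by rewrite inrange_segment.
have ld' : (count (wanted n (nth 0%N labs) near lev (s * (2 ^ (J - j) * n))
    (s * (2 ^ (J - j) * n) + 2 ^ (J - j) * n)) (iota 0 n) <= 2 ^ l)%N.
  apply: leq_trans ld; rewrite leq_eqVlt; apply/orP; left; apply/eqP.
  by apply: eq_in_count => p; rewrite mem_iota add0n /= wE => ->.
have [|us mem] := found_complete (G := G) (L := L) (T := T) (col := colv v) n_gt0 ld'.
  move=> x; rewrite wE => /and3P[xn nx sx].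
  by have := hit x; rewrite mem_iota add0n xn nx sx => /(_ isT).
split=> //; last by move=> p; rewrite mem inE; apply: wE.
apply: leq_trans ld'; rewrite -size_filter; apply: uniq_leq_size => // p.
rewrite mem mem_filter mem_iota add0n -topredE /= => h; rewrite h.
by move: h; rewrite wE => /andP[].
Qed.

(** Union bound over the [2^j] segments. The three terms are an overfull near list, more than [nu]
    points of the larger ball, and one of at most [n] near points missed by all groups. The first
    two concern the labels alone; the third is bounded for fixed labels. *)
Lemma stage_fail lev j : (lev < k)%N -> (j <= J)%N ->
  (nearcount n near lev <= 2 ^ j * 2)%N -> (nearcount n near lev.+1 <= 2 ^ j * r)%N ->
  avgs (2 ^ J) n (fun labs => E (fun v => (~~ stage_ok labs v lev j)%:R)) <=
  (2 ^ j)%:R * (4 ^+ 2 / 2 ^+ (2 ^ l).+1 + 4 ^+ r / 2 ^+ nu.+1 + n%:R * 2^-1 ^+ G).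
Proof.
move=> levk jJ nc ac.
have AA := avgs_expectation R n (expn_gt0 2 J).
set c := (X in _ * X).
have E01 (b : {ffun I -> V} -> bool) : E (fun v => (b v)%:R) <= 1.
  by rewrite -[leRHS](exp1 EE); apply: (exp_le EE) => v; case: (b v).
have h2 : 0 <= n%:R * 2^-1 ^+ G :> R by rewrite mulr_ge0 ?exprn_ge0 ?invr_ge0.
have seg s : (s < 2 ^ j)%N -> avgs (2 ^ J) n (fun labs =>
    E (fun v => (~~ segment_ok labs v lev j s)%:R)) <= c.
  move=> sj.
  apply: (@le_trans _ _ (avgs (2 ^ J) n (fun labs =>
     ((2 ^ l).+1 <= load_near labs lev j s)%N%:R + (nu.+1 <= load_ann labs lev j s)%N%:R
     + n%:R * 2^-1 ^+ G))); last first.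
    rewrite (expD AA) (expD AA) (exp_cst AA) /c lerD2r; apply: lerD.
      exact: (load_le R _ jJ sj nc).
    exact: (load_le R _ jJ sj ac).
  apply: (exp_le AA) => labs.
  case: leqP => ld; last first.
    by rewrite mulr1n -addrA; apply: le_trans (E01 _) _; rewrite lerDl addr_ge0.
  case: leqP => la; last by rewrite mulr1n add0r; apply: le_trans (E01 _) _; rewrite lerDl.
  rewrite !add0r; rewrite ?ltnS in ld la.
  apply: (@le_trans _ _ (E (fun v => \sum_(x < n)
      (near lev x && ~~ has (fun g => hitv labs lev j s v g x) (iota 0 G))%:R))).
    apply: (exp_le EE) => v; rewrite (sum_count R (fun x => near lev x &&
      ~~ has (fun g => hitv labs lev j s v g x) (iota 0 G))).
    rewrite ler_nat /segment_ok -/(load_near labs lev j s) ld /=.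
    rewrite -has_predC; case: hasP => // -[x xn /=].
    rewrite negb_imply => /andP[/andP[nx _] hx].
    by rewrite -has_count; apply/hasP; exists x => //; rewrite nx hx.
  rewrite (exp_sum EE); have -> : n%:R * 2^-1 ^+ G = \sum_(x < n) 2^-1 ^+ G :> R.
    by rewrite sumr_const card_ord mulr_natl.
  apply: ler_sum => x _; case nx: (near lev x); last first.
    by rewrite /= (exp_cst EE) exprn_ge0 // invr_ge0.
  exact: (all_miss levk jJ ld la (ltn_ord x) nx).
apply: (@le_trans _ _ (avgs (2 ^ J) n (fun labs =>
   \sum_(s < 2 ^ j) E (fun v => (~~ segment_ok labs v lev j s)%:R)))).
  apply: (exp_le AA) => labs; rewrite -(exp_sum EE); apply: (exp_le EE) => v.
  rewrite (sum_count R (fun s => ~~ segment_ok labs v lev j s)) ler_nat.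
  rewrite /stage_ok -has_predC; case: hasP => // -[s hs /= hx].
  by rewrite -has_count; apply/hasP; exists s.
rewrite (exp_sum AA) -[(2 ^ j)%N in leRHS]card_ord mulr_natl -sumr_const.
by apply: ler_sum => s _; apply: seg.
Qed.

End Hash.

(** * The adaptive game *)

Section Game.
Variables (R : realFieldType) (I V : finType) (mu : I -> V -> R).
Hypothesis mu_ge0 : forall i v, 0 <= mu i v.
Hypothesis mu_sum : forall i, \sum_v mu i v = 1.
Variables (idx : nat -> nat -> I) (jdx : I -> nat).
Variables (k n l J G L T M H nu Q : nat) (K : nat -> nat).
Hypothesis jdxK : forall lev j, (lev < k)%N -> (j < H)%N -> jdx (idx lev j) = j.
Hypothesis H_ge : forall lev, (lev < k)%N -> (G * L * K lev <= H)%N.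
Hypothesis T_ge : (L * 2 ^ l + 4 * (4 * nu + L) <= T)%N.
Hypothesis n_gt0 : (0 < n)%N.
Hypothesis k_gt0 : (0 < k)%N.
Hypothesis l_gt0 : (0 < l)%N.
Hypothesis n_le : (n <= 2 ^ J)%N.

(* The adversary is seen through the function mapping the previous answers to the
   next query. *)
Variables (QT : Type) (query : seq nat -> QT).
Variables (hash_hit : QT -> V -> nat -> bool) (near : QT -> nat -> nat -> bool).
Variables (ok : QT -> pred nat) (colp : QT -> nat -> nat -> R).

Definition reachable (h : seq nat) := (size h < Q)%N && all (fun a => (a <= n)%N) h.

(** The interface between geometry and game: metric, radii and hash families stay hidden behind
    these properties. *)
Record fair_query (q : QT) : Prop := FairQuery {
  fq_colp : forall lev j p, (lev < k)%N -> (j < H)%N -> (p < n)%N ->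
    \sum_v mu (idx lev j) v * (hash_hit q v p)%:R = colp q lev p;
  fq_colp01 : forall lev p, (lev < k)%N -> (p < n)%N -> 0 <= colp q lev p <= 1;
  fq_near : forall lev p, (lev < k)%N -> (p < n)%N -> near q lev p ->
    3 <= L%:R * colp q lev p ^+ K lev;
  fq_mono : forall lev x y, (lev < k)%N -> (x < n)%N -> (y < n)%N ->
    near q lev x -> ~~ near q lev y -> colp q lev y <= colp q lev x;
  fq_far : forall lev p, (lev < k)%N -> (p < n)%N -> ~~ near q lev.+1 p ->
    n%:R * colp q lev p ^+ K lev <= 1;
  fq_nested : forall lev lev' p, (lev <= lev')%N -> near q lev p -> near q lev' p;
  fq_ok : forall lev x, (lev < k)%N -> (x < n)%N -> near q lev x -> ok q x;
  fq_none : (forall x, (x < n)%N -> ~~ near q 0%N x) -> ok q n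
}.

Hypothesis fair : forall h, reachable h -> fair_query (query h).

Let D := (2 ^ (J + l))%N.
Let natt := (J.+1 * M)%N.
Let E := Ex mu.
Let EE : expectation E := Ex_expectation mu_ge0 mu_sum.

Definition answer q labs (v : {ffun I -> V}) zs : nat :=
  qrun k n l J (near q) G L T (nth 0%N labs) (colv (hash_hit q) idx K v)
    (stages M (iota 0 J.+1)) zs.

Fixpoint bad (m : nat) (h : seq nat) labs v (zs : seq nat) : bool :=
  if m is m'.+1 then
    let q := query h in
    let a := answer q labs v (take natt zs) in
    if ok q a then bad m' (rcons h a) labs v (drop natt zs) else true
  else false.

(** Failure probability of the next [m] rounds after history [h], with labels and hash patterns held
    fixed: only the fresh coins of the queries are averaged. *)
Fixpoint W (m : nat) (h : seq nat) labs v : R :=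
  if m is m'.+1 then
    let q := query h in
    avgs D natt (fun zs => let a := answer q labs v zs in
      if ok q a then W m' (rcons h a) labs v else 1)
  else 0.

Let D_gt0 : (0 < D)%N. Proof. by rewrite expn_gt0. Qed.

Lemma avg_bad m h labs v :
  avgs D (m * natt) (fun zs => (bad m h labs v zs)%:R) = W m h labs v.
Proof.
elim: m h => [|m IH] h //=.
rewrite mulSn avgs_cat; apply: avgs_eq_in => zs /andP[/eqP sz _].
have AA := avgs_expectation R (m * natt) D_gt0.
transitivity (avgs D (m * natt) (fun t : seq nat =>
  (if ok (query h) (answer (query h) labs v zs)
   then bad m (rcons h (answer (query h) labs v zs)) labs v t else true)%:R : R)).
  by apply: (exp_ext AA) => t; rewrite take_size_cat // drop_size_cat.
by case: ifP => _; [apply: IH | rewrite (exp_cst AA)].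
Qed.

Lemma W01 m h labs v : 0 <= W m h labs v <= 1.
Proof.
rewrite -avg_bad; have AA := avgs_expectation R (m * natt) D_gt0.
apply/andP; split; first by apply: (exp_ge0 AA) => zs; rewrite ler0n.
by rewrite -[leRHS](exp1 AA); apply: (exp_le AA) => zs; case: bad.
Qed.

Let r := ((J + 1) %/ k).+1.
Definition stage_loss : R := (2 ^ J)%:R *
  (4 ^+ 2 / 2 ^+ (2 ^ l).+1 + 4 ^+ (2 ^ r) / 2 ^+ nu.+1 + n%:R * 2^-1 ^+ G).

Lemma stage_loss_ge0 : 0 <= stage_loss.
Proof.
by rewrite mulr_ge0 // !addr_ge0 ?divr_ge0 ?mulr_ge0 ?exprn_ge0 ?invr_ge0.
Qed.

Variable eps : R.
Hypothesis eps_ge0 : 0 <= eps.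
Hypothesis miss_le : (1 - (2 ^ l)%:R^-1) ^+ M <= eps.

Let AA := avgs_expectation R n (expn_gt0 2 J).
Definition avg_all (f : seq nat -> {ffun I -> V} -> R) : R :=
  avgs (2 ^ J) n (fun labs => E (f labs)).

(** Restricted to rates up to the first hit, where [valid_near] and [valid_ann] control the two
    balls. When these stages are good, later rates matter with probability at most [eps]. *)
Definition stage_bad q labs v jj : bool :=
  (jj <= first_hit k n J (near q))%N &&
  ~~ stage_ok (hash_hit q) idx n l J G L T K (near q) labs v (level_of k J jj) (J - jj).

Lemma stage_bad_le q jj : fair_query q -> (jj <= J)%N ->
  avg_all (fun labs v => (stage_bad q labs v jj)%:R) <= stage_loss.
Proof.
move=> fq jJ; rewrite /stage_bad; case: leqP => [jf|_] /=; last first.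
  by rewrite /avg_all (exp_ext AA (fun labs => exp_cst EE 0)) (exp_cst AA) stage_loss_ge0.
have vn := valid_near k_gt0 n_gt0 l_gt0 n_le (fq_nested fq) jf jJ.
have va := valid_ann k_gt0 n_gt0 l_gt0 n_le (fq_nested fq) jf jJ.
rewrite expnS mulnC in vn.
have lk := level_of_lt J k_gt0 jj.
apply: le_trans (stage_fail mu_ge0 mu_sum jdxK H_ge (fq_colp fq) (fq_colp01 fq)
  (fq_near fq) (fq_mono fq) (fq_far fq) T_ge n_gt0 lk (leq_subr _ _) vn va) _.
apply: ler_wpM2r; last by rewrite ler_nat leq_exp2l // leq_subr.
by rewrite !addr_ge0 ?divr_ge0 ?mulr_ge0 ?exprn_ge0 ?invr_ge0.
Qed.

(** If a stage is bad the sum is at least 1 and bounds any probability; otherwise the tables are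
    complete wherever needed and [query_le] applies. Adding the two alternatives avoids conditioning
    on good tables. *)
Lemma W_step m h labs v : reachable h -> all (fun z => (z < 2 ^ J)%N) labs ->
  W m.+1 h labs v <= \sum_(jj < J.+1) (stage_bad (query h) labs v jj)%:R +
    (ideal k n l J (near (query h)) (pre k n J M (near (query h)))
       (fun a => W m (rcons h a) labs v) + eps).
Proof.
move=> rh labsJ; set q := query h; have fq := fair rh.
have S0 : 0 <= \sum_(jj < J.+1) (stage_bad q labs v jj)%:R :> R.
  by apply: sumr_ge0 => jj _; rewrite ler0n.
have ps := pre_small M k_gt0 n_gt0 l_gt0 n_le (fq_nested fq).
have id0 : 0 <= ideal k n l J (near q) (pre k n J M (near q))
       (fun a => W m (rcons h a) labs v).
  rewrite -[leLHS](ideal_cst k n l J (near q) (pre k n J M (near q))).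
  apply: (ideal_le ps) => [jj x _ _ _|]; first by case/andP: (W01 m (rcons h x) labs v).
  by case/andP: (W01 m (rcons h n) labs v).
have [/existsP[jj bj]|] := boolP [exists jj : 'I_J.+1, stage_bad q labs v jj].
  apply: (@le_trans _ _ 1); first by case/andP: (W01 m.+1 h labs v).
  apply: (@le_trans _ _ (\sum_(jj < J.+1) (stage_bad q labs v jj)%:R)).
    rewrite (bigD1 jj) //= bj lerDl; apply: sumr_ge0 => i _; exact: ler0n.
  by rewrite lerDl addr_ge0.
rewrite negb_exists => /forallP nb.
apply: (@le_trans _ _ (ideal k n l J (near q) (pre k n J M (near q))
       (fun a => W m (rcons h a) labs v) + eps)); last by rewrite lerDr.
have labJ p : (nth 0%N labs p < 2 ^ J)%N.
  have [pl|pl] := ltnP p (size labs); first by apply: (allP labsJ); apply: mem_nth.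
  by rewrite nth_default // expn_gt0.
apply: (query_le (M := M) k_gt0 n_gt0 l_gt0 n_le (fq_nested fq) (G := G) (L := L) (T := T)
   (col := colv (hash_hit q) idx K v) labJ (ok := ok q)
   (phi := fun a => W m (rcons h a) labs v)) => //.
- by move=> a; apply: W01.
- exact: fq_ok fq.
- exact: fq_none fq.
move=> jj jf jJ s sj.
have := nb (Ordinal (n := J.+1) (m := jj) jJ); rewrite /stage_bad /= jf /= negbK => /allP so.
have := so s; rewrite mem_iota add0n sj => /(_ isT) /(segment_okP n_gt0).
by rewrite subKn.
Qed.

Definition loss : R := J.+1%:R * stage_loss + eps.

(** The history is fixed and the tables are averaged in full at every step. After [W_step], the
    average passes through [ideal] by [ideal_exp], and the induction hypothesis applies to each
    extended history separately; each round costs one [loss]. *)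
Lemma game_bound m h : (size h + m <= Q)%N -> all (fun a => (a <= n)%N) h ->
  avg_all (W m h) <= m%:R * loss.
Proof.
elim: m h => [|m IH] h hm ha.
  by rewrite /avg_all (exp_ext AA (fun labs => exp_cst EE 0)) (exp_cst AA) mul0r.
have rh : reachable h by rewrite /reachable ha andbT; lia.
have fq := fair rh; set q := query h in fq.
have ps := pre_small M k_gt0 n_gt0 l_gt0 n_le (fq_nested fq).
apply: (@le_trans _ _ (avg_all (fun labs v =>
   \sum_(jj < J.+1) (stage_bad q labs v jj)%:R +
    (ideal k n l J (near q) (pre k n J M (near q))
       (fun a => W m (rcons h a) labs v) + eps)))).
  apply: avgs_le_in => labs /andP[_ labsJ]; apply: (exp_le EE) => v; exact: W_step.
have -> : avg_all (fun labs v =>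
   \sum_(jj < J.+1) (stage_bad q labs v jj)%:R +
    (ideal k n l J (near q) (pre k n J M (near q))
       (fun a => W m (rcons h a) labs v) + eps)) =
  \sum_(jj < J.+1) avg_all (fun labs v => (stage_bad q labs v jj)%:R) +
   (ideal k n l J (near q) (pre k n J M (near q)) (fun a => avg_all (W m (rcons h a))) + eps).
  rewrite /avg_all -(exp_sum AA) -(ideal_exp _ _ _ _ _ _ _ AA) -[eps in RHS](exp_cst AA) -!(expD AA).
  apply: (exp_ext AA) => labs.
  rewrite (expD EE) (expD EE) (exp_cst EE) (exp_sum EE).
  by rewrite (ideal_exp _ _ _ _ _ _ (fun v a => W m (rcons h a) labs v) EE).
rewrite -natr1 mulrDl mul1r [leRHS]addrC /loss -addrA; apply: lerD.
  rewrite -[X in X%:R * _](card_ord J.+1) mulr_natl -sumr_const; apply: ler_sum => jj _.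
  by apply: stage_bad_le => //; rewrite -ltnS.
rewrite [leRHS]addrC lerD2r -/loss.
rewrite -[leRHS](ideal_cst k n l J (near q) (pre k n J M (near q))).
apply: (ideal_le ps) => [jj x _ xn _|]; apply: IH; rewrite ?size_rcons ?all_rcons ?ha ?leqnn ?(ltnW xn) //; lia.
Qed.

End Game.

Local Open Scope classical_set_scope.
Local Open Scope ring_scope.

(** * The law of the tapes *)

Section FiniteValued.
Variables (disp : measure_display) (Omega : measurableType disp) (R : realType).
Variables (P : probability Omega R) (T : finType) (Y : Omega -> T).
Hypothesis Y_meas : forall t, measurable [set w | Y w = t].

Lemma finite_valued_seq (r : seq T) : uniq r ->
  measurable [set w | Y w \in r] /\
  P [set w | Y w \in r] = (\sum_(t <- r) fine (P [set w | Y w = t]))%:E.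
Proof.
elim: r => [_|t r IH /= /andP[tr ur]].
  have -> : [set w | Y w \in [::]] = set0 by apply/seteqP; split.
  by rewrite big_nil measure0; split=> //; exact: measurable0.
have -> : [set w | Y w \in t :: r] = ([set w | Y w = t] `|` [set w | Y w \in r])%classic.
  apply/seteqP; split=> w /=; rewrite inE.
    by case/orP => [/eqP ->|h]; [left | right].
  by case=> [->|->]; rewrite ?eqxx ?orbT.
have [mr Pr] := IH ur; split; first exact: measurableU.
rewrite measureU //; last first.
  by apply/seteqP; split=> w //= -[-> tr']; move: tr; rewrite tr'.
rewrite big_cons EFinD; congr (_ + _)%E; last exact: Pr.
by rewrite fineK // fin_num_measure.
Qed.

Lemma finite_valued (Phi : pred T) :
  measurable [set w | Phi (Y w)] /\
  P [set w | Phi (Y w)] = (\sum_t fine (P [set w | Y w = t]) * (Phi t)%:R)%:E.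
Proof.
have [m p] := finite_valued_seq (filter_uniq Phi (enum_uniq T)).
have E : [set w | Y w \in [seq t <- enum T | Phi t]] = [set w | Phi (Y w)].
  by apply/seteqP; split=> w /=; rewrite mem_filter mem_enum inE andbT.
rewrite -E; split=> //; rewrite p big_filter big_enum_cond /= big_mkcond /=.
by congr EFin; apply: eq_bigr => t _; case: (Phi t); rewrite ?mulr1 ?mulr0.
Qed.

End FiniteValued.

Lemma tuple_avgs (R : realType) N (phi : seq bool -> R) :
  \sum_(b : N.-tuple bool) 2^-1 ^+ N * phi b = avgs 2 N (fun s => phi (map odd s)).
Proof.
elim: N phi => [|N IH] phi.
  rewrite (bigD1 [tuple]) //= big1 ?addr0 ?mul1r // => b /eqP[]; exact: tuple0.
rewrite /= /avg big_ord_recl big_ord1 /=.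
rewrite -(IH (fun s => phi (false :: s))) -(IH (fun s => phi (true :: s))).
pose f (x : bool * N.-tuple bool) : N.+1.-tuple bool := [tuple of x.1 :: x.2].
pose g (b : N.+1.-tuple bool) := (thead b, [tuple of behead b]).
rewrite (reindex f) /=; last first.
  exists g => [[x b]|b] _; last by rewrite /f /g /= [RHS]tuple_eta.
  by rewrite /f /g /=; congr pair; apply: val_inj.
rewrite -(pair_bigA _ (fun x (b : N.-tuple bool) => 2^-1 ^+ N.+1 * phi (x :: b))) /=.
rewrite big_bool /= addrC mulrDl !mulr_suml; congr (_ + _); apply: eq_bigr => b _;
  by rewrite exprS -mulrA mulrC.
Qed.

Section Bits.
Variable R : realType.

Lemma avgs_bin D (phi : nat -> R) :
  avgs 2 D (fun s => phi (bin (map odd s))) = avg (2 ^ D) phi.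
Proof.
have key v0 : avgs 2 D (fun s => phi (foldl (fun v (b : bool) => v + v + b)%N v0 (map odd s))) =
    avg (2 ^ D) (fun z => phi (v0 * 2 ^ D + z)%N).
  elim: D v0 => [|D IH] v0.
    by rewrite /= /avg big_ord1 muln1 addn0 divr1.
  rewrite /= /avg big_ord_recl big_ord1 /= !IH /avg.
  rewrite expnS (sum_mul_ord (fun z => phi (v0 * (2 * 2 ^ D) + z)%N)).
  rewrite big_ord_recl big_ord1 /= -mulrDl -mulrA natrM invfM [2^-1 * _]mulrC.
  congr ((_ + _) * _); apply: eq_bigr => z _; congr phi; rewrite /= /bump /=; lia.
by rewrite /bin key; apply: avg_eq => z _; rewrite mul0n add0n.
Qed.

Definition chunks D m (s : seq bool) : seq nat :=
  mkseq (fun e => bin (take D (drop (e * D) s))) m.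

Lemma chunksS D m s t : size s = D -> chunks D m.+1 (s ++ t) = bin s :: chunks D m t.
Proof.
move=> sD; rewrite /chunks /mkseq /= mul0n drop0 take_size_cat //; congr (_ :: _).
rewrite (iotaDl 1 0 m) -map_comp; apply: eq_map => e /=.
by rewrite add1n mulSn drop_cat sD ltnNge leq_addr /= addKn.
Qed.

Lemma avgs_chunks D m (phi : seq nat -> R) :
  avgs 2 (m * D) (fun s => phi (chunks D m (map odd s))) = avgs (2 ^ D) m phi.
Proof.
elim: m phi => [|m IH] phi //=.
rewrite mulSn avgs_cat -(avgs_bin _ (fun z => avgs (2 ^ D) m (fun s => phi (z :: s)))).
apply: avgs_eq_in => s /andP[/eqP sD _].
rewrite -IH; apply: (exp_ext (avgs_expectation R (m * D) (isT : 0 < 2)%N)) => t.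
by rewrite map_cat chunksS // size_map.
Qed.

Lemma vals_size N m s : vals N m s -> size s = m.
Proof. by case/andP => /eqP. Qed.

Lemma avgs_two_chunks D1 m1 D2 m2 (phi : seq nat -> seq nat -> R) :
  avgs 2 (m1 * D1 + m2 * D2)
    (fun s => phi (chunks D1 m1 (map odd s)) (chunks D2 m2 (drop (m1 * D1) (map odd s)))) =
  avgs (2 ^ D1) m1 (fun s => avgs (2 ^ D2) m2 (fun t => phi s t)).
Proof.
rewrite avgs_cat -(avgs_chunks D1 m1 (fun s => avgs (2 ^ D2) m2 (phi s))).
apply: avgs_eq_in => s /vals_size sD.
rewrite -(avgs_chunks D2 m2).
apply: (exp_ext (avgs_expectation R (m2 * D2) (isT : 0 < 2)%N)) => t.
rewrite map_cat drop_size_cat ?size_map //; congr phi.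
apply/eq_in_map => e; rewrite mem_iota add0n /= => em.
rewrite drop_cat size_map sD.
have eD : (e * D1 + D1 <= m1 * D1)%N by rewrite addnC -mulSn leq_mul2r em orbT.
(* A chunk can start at the end of the first block only when [D1 = 0], and it is then empty. *)
case: ltnP => h; first by rewrite takel_cat // size_drop size_map sD; lia.
have D0 : D1 = 0%N by lia.
by rewrite D0 !take0.
Qed.

End Bits.

Section TapeLaw.
Variables (R : realType) (M : metricType R) (n k H N : nat) (S : 'I_n -> M) (qs : seq M).
Variables (disp : measure_display) (Omega : measurableType disp).
Variables (P : probability Omega R) (F : nat -> hash_family R M).
Variables (hs : forall f : nat, nat -> Omega -> hf_type (F f)).
Variables (coins : nat -> Omega -> bool).
Hypothesis tapes : random_tapes P hs coins.

(** Hash values are natural numbers, so a collision is a countable union over the common value. *)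
Lemma measurable_collide (F' : hash_family R M) (x y : M) :
  measurable [set h : hf_type F' | hf_eval h x = hf_eval h y].
Proof.
have -> : [set h : hf_type F' | hf_eval h x = hf_eval h y] =
   \bigcup_(a in [set: nat]) (((fun h : hf_type F' => hf_eval h x) @^-1` [set a]) `&` ((fun h : hf_type F' => hf_eval h y) @^-1` [set a])).
  apply/seteqP; split=> [h /= e|h [a _ [/= -> ->]]] //.
  by exists (hf_eval h y).
apply: bigcup_measurable => a _; apply: measurableI.
  by rewrite -[X in measurable X]setTI; apply: (hf_measurable x).
by rewrite -[X in measurable X]setTI; apply: (hf_measurable y).
Qed.

(** All that a hash function contributes to the game: which data points it identifies with which of
    finitely many queries. This makes its law a finite one. *)
Definition pattern_type : finType := {ffun 'I_(size qs) * 'I_n -> bool}.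

Definition query_point (t : 'I_(size qs)) : M := tnth (in_tuple qs) t.

Definition pattern (F' : hash_family R M) (h : hf_type F') : pattern_type :=
  [ffun x => hf_eval h (S x.2) == hf_eval h (query_point x.1)].

Lemma measurable_pattern (F' : hash_family R M) (v : pattern_type) :
  measurable [set h : hf_type F' | pattern h = v].
Proof.
have -> : [set h : hf_type F' | pattern h = v] =
  \bigcap_(x in [set: 'I_(size qs) * 'I_n])
    (if v x then [set h | hf_eval h (S x.2) = hf_eval h (query_point x.1)]
     else ~` [set h | hf_eval h (S x.2) = hf_eval h (query_point x.1)]).
  apply/seteqP; split=> [h /= <- x _|h hx /=].
    by rewrite ffunE; case: eqP.
  apply/ffunP => x; rewrite ffunE; have := hx x I.
  by case: (v x) => /= [->|/eqP/negbTE ->]; rewrite ?eqxx.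
apply: fin_bigcap_measurable => [|x _]; first exact: finite_finset.
by case: (v x); [|apply: measurableC]; apply: measurable_collide.
Qed.

Definition index_type : finType := ('I_k * 'I_H)%type.

Definition mu (i : index_type) (v : pattern_type) : R :=
  fine (hf_prob (F i.1) [set h | pattern h = v]).

Lemma mu_ge0 i v : 0 <= mu i v.
Proof. by apply: fine_ge0; apply: measure_ge0. Qed.

Lemma mu_sum i : \sum_v mu i v = 1.
Proof.
have [_] := finite_valued (hf_prob (F i.1)) (@measurable_pattern (F i.1)) predT.
have -> : [set w : hf_type (F i.1) | predT (pattern w)] = setT by apply/seteqP; split.
rewrite probability_setT => /eqP; rewrite eqe => /eqP ->.
by apply: eq_bigr => v _; rewrite mulr1.
Qed.

Lemma mu_collision i t x :
  \sum_v mu i v * (v (t, x))%:R = fine (collision (F i.1) (S x) (query_point t)).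
Proof.
have [_] := finite_valued (hf_prob (F i.1)) (@measurable_pattern (F i.1))
  (fun v : pattern_type => v (t, x)).
move=> e; rewrite /collision.
have -> : [set h | hf_eval h (S x) = hf_eval h (query_point t)] =
  [set w : hf_type (F i.1) | pattern w (t, x)].
  by apply/seteqP; split=> h /=; rewrite ffunE /= => /eqP.
by rewrite e.
Qed.

Definition tape_pattern (w : Omega) : {ffun index_type -> pattern_type} :=
  [ffun i : index_type => pattern (hs i.1 i.2 w)].

Definition tape_bits (w : Omega) : N.-tuple bool := [tuple coins i w | i < N].

Definition tape (w : Omega) := (tape_bits w, tape_pattern w).

Let idx : seq (nat * nat + nat) :=
  [seq inl (val i.1, val i.2) | i <- index_enum index_type] ++ [seq inr j | j <- iota 0 N].

Let uniq_idx : uniq idx.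
Proof.
rewrite /idx cat_uniq; apply/and3P; split.
- rewrite map_inj_uniq ?index_enum_uniq // => -[a b] [a' b'] /= [/val_inj -> /val_inj ->].
  by [].
- by apply/hasPn => _ /mapP[j _ ->]; apply/mapP => -[].
- by rewrite map_inj_uniq ?iota_uniq // => i j [].
Qed.

(** Tapes are numbered by natural numbers and patterns by ordinals; quantifying over the ordinals
    with given values imposes nothing outside of the range. *)
Let cyl (b : N.-tuple bool) (v : {ffun index_type -> pattern_type}) (i : nat * nat + nat) :
    set Omega :=
  match i with
  | inl fj => hs fj.1 fj.2 @^-1` [set h | forall (f' : 'I_k) (j' : 'I_H),
                val f' = fj.1 -> val j' = fj.2 -> pattern h = v (f', j')]
  | inr j => coins j @^-1` [set nth false b j]
  end.

Let cyl_in (b : N.-tuple bool) v (i : index_type) :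
  cyl b v (inl (val i.1, val i.2)) = hs i.1 i.2 @^-1` [set h | pattern h = v i].
Proof.
apply/seteqP; split=> w /=; first by move=> /(_ i.1 i.2 erefl erefl); case: i.
by move=> e f' j' /val_inj -> /val_inj ->; case: i e.
Qed.

Let tape_fiber b v : [set w | tape w = (b, v)] = \bigcap_(i in [set` idx]) cyl b v i.
Proof.
apply/seteqP; split=> w /=.
  case=> <- <- i; rewrite /= mem_cat => /orP[/mapP[j _ ->]|/mapP[j]].
    by rewrite cyl_in /= ffunE.
  rewrite mem_iota add0n /= => jN -> /=.
  by rewrite (nth_map (Ordinal jN)) ?size_enum_ord // nth_enum_ord.
move=> h; congr pair.
  apply: eq_from_tnth => j; rewrite tnth_mktuple (tnth_nth false).
  by apply: (h (inr (val j))); rewrite /= mem_cat; apply/orP; right; apply: map_f; rewrite mem_iota /=.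
apply/ffunP => i; rewrite ffunE.
have := h (inl (val i.1, val i.2)); rewrite cyl_in /=; apply.
by rewrite mem_cat; apply/orP; left; apply/mapP; exists i; rewrite ?mem_index_enum.
Qed.

Lemma tape_law b v : measurable [set w | tape w = (b, v)] /\
  fine (P [set w | tape w = (b, v)]) = 2^-1 ^+ N * \prod_i mu i (v i).
Proof.
case: tapes => hm hp cm cp ind.
have meas_in (i : index_type) : measurable (cyl b v (inl (val i.1, val i.2))).
  rewrite cyl_in -[X in measurable X]setTI; apply: hm => //.
  exact: measurable_pattern.
have meas_co j : measurable (cyl b v (inr j)).
  by rewrite /cyl -[X in measurable X]setTI; apply: cm.
have meas i : i \in idx -> measurable (cyl b v i).
  by rewrite mem_cat => /orP[/mapP[j _ ->]|/mapP[j _ ->]].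
split.
  rewrite tape_fiber; apply: fin_bigcap_measurable => //; exact: finite_seq.
rewrite tape_fiber ind //; last first.
  move=> i; rewrite mem_cat => /orP[/mapP[j _ ->]|/mapP[j _ ->]].
    by rewrite cyl_in; exists [set h | pattern h = v j]; [exact: measurable_pattern|].
  by exists [set nth false b j].
have P_in (i : index_type) : P (cyl b v (inl (val i.1, val i.2))) = (mu i (v i))%:E.
  rewrite cyl_in hp ?fineK ?fin_num_measure //; exact: measurable_pattern.
have P_co j : P (cyl b v (inr j)) = (2^-1)%:E.
  rewrite /cyl; case: (nth false b j); first exact: cp.
  have -> : coins j @^-1` [set false] = ~` (coins j @^-1` [set true]).
    by apply/seteqP; split=> w /=; case: (coins j w).
  rewrite probability_setC; last first.
    by rewrite -[X in measurable X]setTI; apply: cm.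
  by rewrite cp -EFinB; congr EFin; lra.
rewrite big_cat /= !big_map.
under eq_bigr => i _ do rewrite P_in.
under [X in (_ * X)%E]eq_bigr => i _ do rewrite P_co.
rewrite !prodEFin -EFinM /= mulrC; congr (_ * _).
by rewrite big_const_seq count_predT size_iota iter_mulr_1.
Qed.

(** The passage from the given probability space to finite averages: any event about the first [N]
    coins and the patterns is measurable and has the product probability. *)
Lemma tape_event (Phi : seq bool -> {ffun index_type -> pattern_type} -> bool) :
  measurable [set w | Phi (tape_bits w) (tape_pattern w)] /\
  P [set w | Phi (tape_bits w) (tape_pattern w)] =
    (avgs 2 N (fun s => Ex mu (fun v => (Phi (map odd s) v)%:R)))%:E.
Proof.
have meas bv : measurable [set w | tape w = bv] by case: bv => b v; case: (tape_law b v).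
have [m p] := finite_valued P meas (fun bv => Phi bv.1 bv.2).
split; first exact: m.
transitivity (P [set w | Phi (tape w).1 (tape w).2]); first by [].
rewrite p; congr EFin; rewrite -(tuple_avgs N (fun b => Ex mu (fun v => (Phi b v)%:R))) /Ex.
transitivity (\sum_b \sum_v fine (P [set w | tape w = (b, v)]) * (Phi b v)%:R).
  by rewrite pair_bigA; apply: eq_bigr => -[].
apply: eq_bigr => b _; rewrite mulr_sumr; apply: eq_bigr => v _.
by rewrite (tape_law b v).2 mulrA.
Qed.

End TapeLaw.

(** * From machine runs to the abstract game *)

Section Bridge.
Variables (m : machine) (k n J l G L T M : nat).
Variables (lab : nat -> nat) (near : nat -> nat -> bool) (col : nat -> nat -> nat -> bool).
Local Open Scope nat_scope.

Lemma stagesE a : stages M (iota 0 a) = mkseq (fun e => e %/ M) (a * M).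
Proof.
elim: a => [|a IH] //; rewrite -addn1 iotaD add0n /stages map_cat flatten_cat -/(stages _ _) IH.
rewrite mulnDl mul1n /mkseq iotaD map_cat add0n; congr (_ ++ _); rewrite /= cats0.
apply: (@eq_from_nth _ 0); rewrite size_nseq ?size_map ?size_iota // => i iM.
rewrite nth_nseq iM (nth_map 0) ?size_iota // nth_iota // divnMDl; last by lia.
by rewrite divn_small // addn0.
Qed.

Lemma query_ans_qrun i0 :
  query_ans m k n J l G L T M lab near col i0 =
  qrun k n l J near G L T lab col (stages M (iota 0 J.+1))
    (mkseq (fun e => bin (coinseq m (i0 + e * (J + l)) (J + l))) (J.+1 * M)).
Proof.
rewrite /qrun stagesE /mkseq /query_ans.
suff h a s : foldl (att_step m k n J l G L T M lab near col i0) a s =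
  foldl (qstep k n l J near G L T lab col) a (zip [seq e %/ M | e <- s]
    [seq bin (coinseq m (i0 + e * (J + l)) (J + l)) | e <- s]) by exact: h.
by elim: s a => //= e s IH a; rewrite IH.
Qed.

End Bridge.

(** Changing the query alters hash values at the number [n] only, while tables store data points:
    the memory left by one query is valid for the next. *)
Lemma data_congr k n J l G L T M bs Kf hv hv' lab f :
  (forall lev j x, (x < n)%N -> hv lev j x = hv' lev j x) ->
  data k n J l G L T M bs Kf hv lab f -> data k n J l G L T M bs Kf hv' lab f.
Proof.
move=> e [cf lf tf]; split=> // lev tau levk tauG p pn; rewrite -[RHS](tf lev tau levk tauG p pn).
have ek x : (x < n)%N -> key bs Kf hv' lev tau x = key bs Kf hv lev tau x.
  move=> xn; rewrite /key /lexkey; set g := fun acc a => _; set g' := fun acc a => _.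
  have -> : g = g' by apply/funext => acc; apply/funext => a; rewrite /g /g' e.
  by [].
congr (f (_ + _)%N); apply: eq_in_count => x; rewrite mem_iota add0n /= => xn.
by rewrite /below !ek.
Qed.

(* Labels have [pJ] bits; [2 ^ pl] is the capacity of the list of candidates; each level
   has [pG] groups of [pL] tables, [pT] entries of a group being read at most; each
   sampling rate is tried [pM] times; [pK i] hash functions of level [i], out of the
   [pH] stored ones, are concatenated in a table. *)
Record parameters := Tuning {
  pJ : nat; pl : nat; pG : nat; pL : nat; pT : nat; pM : nat; pH : nat; pbits : nat;
  pK : nat -> nat
}.

Section Algorithm.
Variables (R : realType) (k : nat) (c' r : R).

Definition words (n : nat) (p : parameters) : nat :=
  (43 + k + n + k * (pG p * pL p) * n + 2 ^ pl p)%N.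

(** Here 32 is [cN] and 43 is [NR]: the list follows the constants from [cN] to [cLB], and the key
    lengths come next. *)
Definition param_cell (n : nat) (p : parameters) (i : nat) : nat :=
  if (i < 32)%N then 0%N else
  if (43 <= i)%N then pK p (i - 43) else
  nth 0%N [:: n; pJ p; 2 ^ pl p; pM p; pG p; pL p; pT p; 2 ^ pJ p; pJ p + pl p;
    43 + k + n; 43 + k + n + k * (pG p * pL p) * n]%N (i - 32).

Definition lsh_algorithm (prm : nat -> nat -> R -> parameters) : algorithm R := {|
  preprocess := preproc_prog k;
  answer_query := query_prog k;
  radii := mkseq (fun i => r * c' ^+ i) k;
  families := mkseq (fun i => (c', r * c' ^+ i)) k;
  nparams := (43 + k)%N;
  params n Q delta := [tuple param_cell n (prm n Q delta) i | i < 43 + k];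
  wbits n Q delta := pbits (prm n Q delta);
  memsize n Q delta := words n (prm n Q delta);
  nhash n Q delta := pH (prm n Q delta)
|}.

Record valid_parameters (n : nat) (p : parameters) : Prop := ValidTuning {
  vp_bits : (0 < pbits p)%N;
  vp_mem : (words n p + pJ p + pl p + pM p + pT p + 2 < 2 ^ pbits p)%N;
  vp_tab : (pG p * pL p + pG p + pL p + 2 < 2 ^ pbits p)%N;
  vp_lev : (k * (pJ p + 1) + 2 < 2 ^ pbits p)%N;
  vp_hash : (pH p + 2 < 2 ^ pbits p)%N;
  vp_seg : (2 ^ (pJ p).+1 * n.+1 + 2 < 2 ^ pbits p)%N;
  vp_draw : (2 ^ (pJ p + pl p).+1 + 2 < 2 ^ pbits p)%N;
  vp_K : forall lev, (lev < k)%N -> (pK p lev < 2 ^ pbits p)%N;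
  vp_H : forall lev, (lev < k)%N -> (pG p * pL p * pK p lev <= pH p)%N;
  vp_H0 : (0 < pH p)%N;
  vp_n : (n <= 2 ^ pJ p)%N;
  vp_l : (0 < pl p)%N
}.

Lemma consts_initial prm n Q delta (p := prm n Q delta) : valid_parameters n p ->
  consts k n (pJ p) (pl p) (pG p) (pL p) (pT p) (pM p) (pK p)
    (fun a => (nth 0 (params (lsh_algorithm prm) n Q delta) a %% 2 ^ pbits p)%N).
Proof.
move=> vp; set f := fun a => _.
have fE a : (a < 43 + k)%N -> (param_cell n p a < 2 ^ pbits p)%N -> f a = param_cell n p a.
  move=> ak h; rewrite /f /= (nth_map (Ordinal ak)) ?size_enum_ord //.
  by rewrite nth_enum_ord // modn_small.
have := vp_mem vp; have := vp_tab vp; have := vp_seg vp; have := vp_draw vp.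
rewrite /words => h1 h2 h3 h4.
have j1 : (2 ^ pJ p <= 2 ^ (pJ p).+1 * n.+1)%N by rewrite expnS; nia.
split.
- split; (rewrite fE; [by []|by rewrite ltn_addr|by rewrite /param_cell /=; lia]).
- split; (rewrite fE; [by []|by rewrite ltn_addr|by rewrite /param_cell /=; lia]).
- by rewrite fE; [by []|by rewrite ltn_addr|rewrite /param_cell /=; lia].
move=> lev levk; rewrite fE /param_cell ?ltn_add2l ?leq_addr ?addKn //.
have -> : (43 + lev < 32)%N = false by lia.
exact: (vp_K vp).
Qed.

End Algorithm.

Section Run.
Variables (R : realType) (k n Q : nat) (c c' r delta : R) (prm : nat -> nat -> R -> parameters).
Let A := lsh_algorithm k c' r prm.
Let p := prm n Q delta.
Let J := pJ p. Let l := pl p. Let G := pG p. Let L := pL p. Let T := pT p.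
Let Mt := pM p. Let H := pH p. Let K := pK p.
Hypothesis vp : valid_parameters k n p.
Hypothesis k_gt0 : (0 < k)%N.
Hypothesis n_gt0 : (0 < n)%N.
Variables (M : metricType R) (d : nat) (fam : R -> R -> hash_family R M).
Variables (S : 'I_n -> M) (adv : adversary M).

(** The adversary being a function, the answers alone determine the queries; a history is therefore
    just a list of numbers at most [n]. *)
Definition transcript (h : seq nat) : seq (M * option M) :=
  foldl (fun hist a => rcons hist (adv hist, point_at S None a)) [::] h.

Definition query h : M := adv (transcript h).

Lemma transcript_rcons h a :
  transcript (rcons h a) = rcons (transcript h) (query h, point_at S None a).
Proof. by rewrite /transcript -cats1 foldl_cat. Qed.

Fixpoint histories (q : nat) : seq (seq nat) :=
  if q is q'.+1 then [::] :: [seq rcons h a | h <- histories q', a <- iota 0 n.+1] else [::].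

Lemma mem_histories q h : (size h < q)%N -> all (fun a => (a <= n)%N) h -> h \in histories q.
Proof.
elim: q h => // q IH; elim/last_ind => [|h a _]; first by rewrite mem_head.
rewrite size_rcons all_rcons ltnS => hq /andP[an ha].
rewrite inE; apply/orP; right; apply/allpairsP; exists (h, a); split=> //=.
  exact: IH.
by rewrite -[_ :: _]/(iota 0 n.+1) mem_iota.
Qed.

(** Every query that can ever be asked, along all conceivable answers. This list is finite and fixed
    before any tape is drawn, so the collision patterns can refer to it. *)
Definition queries : seq M := [seq query h | h <- histories Q].

Lemma mem_queries h : reachable n Q h -> query h \in queries.
Proof. by case/andP => hq ha; apply: map_f; apply: mem_histories. Qed.

Let V := pattern_type n queries.
Let H_gt0 : (0 < H)%N := vp_H0 vp.

Definition hash_index (lev j : nat) : index_type k H :=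
  (insubd (Ordinal k_gt0) lev, insubd (Ordinal H_gt0) j).

Definition index_number (i : index_type k H) : nat := i.2.

Lemma hash_indexK lev j : (lev < k)%N -> (j < H)%N -> index_number (hash_index lev j) = j.
Proof. by move=> _ jH; rewrite /index_number /= val_insubd jH. Qed.

Definition hits (q : M) (v : V) (x : nat) : bool :=
  if (insub (index q queries), insub x) is (Some t, Some i) then v (t, i) else false.

Definition near_point (q : M) (lev x : nat) : bool :=
  if insub x is Some i then mdist (S i) q <= r * c' ^+ lev else false.

Definition good_answer (q : M) (x : nat) : bool :=
  `[< ann_correct S c r q (point_at S None x) >].

Variable hs : forall f : nat, nat -> hf_type (family_of A fam f).
Variable coins : nat -> bool.

Definition hash_value (q : option M) (lev j x : nat) : nat :=
  if ((lev < k) && (j < H))%N then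
    if point_at S q x is Some u then hf_eval (hs lev j) u else 0%N
  else 0%N.

(** A base for [lexkey]. It depends on the hash functions drawn and is never known to the
    program. *)
Definition value_bound : nat :=
  (\max_(lev < k) \max_(j < H)
     maxn (\max_(i < n) hf_eval (hs lev j) (S i)) (\max_(q <- queries) hf_eval (hs lev j) q)).+1.

Lemma hash_value_lt q lev j x : (if q is Some q' then q' \in queries else true) ->
  (hash_value q lev j x < value_bound)%N.
Proof.
move=> qq; rewrite /hash_value /value_bound ltnS; case: ifP => // /andP[levk jH].
apply: (@leq_trans (\max_(j < H)
     maxn (\max_(i < n) hf_eval (hs lev j) (S i)) (\max_(q <- queries) hf_eval (hs lev j) q))); last first.
  by apply: (leq_bigmax (Ordinal levk)).
apply: leq_trans (leq_bigmax (Ordinal jH)) => /=.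
rewrite /point_at; case: insubP => [i _ _|_].
  by apply: leq_trans (leq_maxl _ _); apply: (leq_bigmax i).
case: q qq => [q qq|] //; apply: leq_trans (leq_maxr _ _).
by apply: (leq_bigmax_seq (F := fun q => hf_eval (hs lev j) q)).
Qed.

Let mach := machine_of d Q delta S hs coins.

Definition tape_labels := chunks J n (mkseq coins (n * J + Q * (J.+1 * Mt) * (J + l))).
Definition tape_draws := chunks (J + l) (Q * (J.+1 * Mt))
  (drop (n * J) (mkseq coins (n * J + Q * (J.+1 * Mt) * (J + l)))).

Definition pattern_of : {ffun index_type k H -> V} :=
  [ffun i : index_type k H => pattern S queries (hs i.1 i.2)].

Let lab := nth 0%N tape_labels.

Let lab_lt x : (lab x < 2 ^ J)%N.
Proof.
rewrite /lab; have [xn|xn] := ltnP x (size tape_labels); last first.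
  by rewrite nth_default // expn_gt0.
rewrite size_mkseq in xn; rewrite nth_mkseq //.
apply: leq_trans (bin_lt _) _; rewrite leq_exp2l // size_take_min.
exact: geq_minl.
Qed.

Let labE q x : (x < n)%N -> lab x = bin (coinseq (mach q) (0 + x * J) J).
Proof.
move=> xn; rewrite /lab nth_mkseq // /mkseq -map_drop -map_take drop_iota take_iota.
rewrite !add0n; congr (bin (map _ (iota _ _))).
have : (x * J + J <= n * J)%N by rewrite addnC -mulSn leq_mul2r xn orbT.
by clear; lia.
Qed.

Let hash_oracleE q lev j x y : (lev < k)%N -> (j < H)%N ->
  (if q is Some _ then true else (x < n)%N) -> (if q is Some _ then true else (y < n)%N) ->
  hash_oracle (mach q) lev j x y = (hash_value q lev j x <= hash_value q lev j y)%N.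
Proof.
move=> levk jH hx hy /=; rewrite /hash_value levk jH /=.
rewrite size_mkseq levk /=.
have pt z : (if q is Some _ then true else (z < n)%N) -> exists u, point_at S q z = Some u.
  rewrite /point_at; case: insubP => [i _ _ _|]; first by eexists.
  by case: q {hx hy} => [q _ _|/negPf ->] //; eexists.
by have [u ->] := pt _ hx; have [v ->] := pt _ hy.
Qed.

Variables (KM : nat) (tm : R).
Hypothesis KM_ge : forall lev, (lev < k)%N -> (K lev <= KM)%N.
Hypothesis tm_ge : (cQ (mach None) k J l G L T Mt KM)%:R <= tm.

Let N := words k n p.
Let B := (2 ^ pbits p)%N.
Let natt := (J.+1 * Mt)%N.
Let zs := tape_draws.
Let colv' q := colv (hits q) hash_index K pattern_of.
Let B_gt1 : (1 < B)%N.
Proof. by rewrite /B -[1%N](expn0 2) ltn_exp2l // (vp_bits vp). Qed.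

Let data' := data k n J l G L T Mt value_bound K.

Let point_atn q : point_at S q n = q.
Proof. by rewrite /point_at; case: insubP => // i; rewrite ltnn. Qed.

Lemma near_oracleE q lev x : (lev < k)%N -> (x < n)%N ->
  near_oracle (mach (Some q)) lev x n = near_point q lev x.
Proof.
move=> levk xn /=; rewrite point_atn /point_at /near_point.
by case: insubP => [i _ _|]; rewrite ?xn // size_mkseq levk nth_mkseq.
Qed.

Lemma colv_keys q lev tau x : q \in queries -> (lev < k)%N -> (tau < G * L)%N -> (x < n)%N ->
  colv' q lev tau x = (key value_bound K (hash_value (Some q)) lev tau x ==
                       key value_bound K (hash_value (Some q)) lev tau n).
Proof.
move=> qq levk tauG xn; rewrite /key lexkey_eq; last first.
  by move=> a _; split; apply: hash_value_lt.
apply: eq_in_all => a; rewrite mem_iota add0n /= => aK.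
have jH : (tau * K lev + a < H)%N.
  apply: leq_trans (vp_H vp levk); apply: (@leq_trans (tau.+1 * K lev)).
    by rewrite mulSn addnC ltn_add2r.
  by rewrite leq_mul2r tauG orbT.
rewrite /hash_value levk jH /= point_atn /hits /point_at.
have qi : (index q queries < size queries)%N by rewrite index_mem.
rewrite (insubT (fun t => (t < size queries)%N) qi) (insubT (fun t => (t < n)%N) xn).
rewrite !ffunE /= /query_point (tnth_nth q) /= nth_index //.
by rewrite !val_insubd /= levk jH.
Qed.

(** Simulation: the machine and [bad] consume the same coins, the counter [i] matching the part of
    the tape that [bad] has left. As long as the abstract game does not fail, the machine
    survives. *)
Lemma query_run h m' i f : (size h + m' <= Q)%N -> all (fun a => (a <= n)%N) h ->
  bounded B f -> data' (hash_value None) lab f ->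
  i = (n * J + size h * natt * (J + l))%N ->
  ~~ bad hash_index k n l J G L T Mt K query hits near_point good_answer m' h
     tape_labels pattern_of (drop (size h * natt) zs) ->
  survives (fun q => mach (Some q)) (query_prog k) S c r tm adv m'
    (transcript h) (mkseq f N, i).
Proof.
elim: m' h i f => //= m' IH h i f hm ha bf df iE nb.
have hQ : (size h < Q)%N by move: hm; clear; lia.
set q := query h in nb *; rewrite -[adv _]/q.
have qq : q \in queries by apply: mem_queries; rewrite /reachable hQ.
set a := answer _ _ _ _ _ _ _ _ _ _ _ _ _ _ _ _ in nb.
(* The numbers that the abstract game hands to this round are those the machine reads from coin [i]
   on. *)
have zsE : take natt (drop (size h * natt) zs) =
    mkseq (fun e => bin (coinseq (mach (Some q)) (i + e * (J + l)) (J + l))) (J.+1 * Mt).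
  have hn : (size h * natt + natt <= Q * natt)%N by rewrite addnC -mulSn leq_mul2r hQ orbT.
  rewrite /zs /tape_draws /chunks -/natt /mkseq -map_drop -map_take drop_iota take_iota add0n.
  have -> : minn natt (Q * natt - size h * natt) = natt by move: hn; clear; lia.
  rewrite -{1}[(size h * natt)%N]addn0 iotaDl -map_comp.
  apply/eq_in_map => e; rewrite mem_iota add0n /= => en.
  rewrite -!map_drop -map_take !drop_iota take_iota /coinseq; congr (bin (map _ (iota _ _))).
    by rewrite iE mulnDl addnA.
  have : ((size h * natt + e).+1 * (J + l) <= Q * natt * (J + l))%N.
    by rewrite leq_mul2r (leq_trans _ hn) ?orbT // ltn_add2l.
  by rewrite mulSn; clear; lia.
have run : runs (mach (Some q)) N B (query_prog k) f i (fun f' i' t =>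
    [/\ f' 0%N = a, data' (hash_value (Some q)) lab f', i' = (i + natt * (J + l))%N
      & (t <= cQ (mach None) k J l G L T Mt KM)%N]).
  apply: (queryP (m := mach (Some q)) (erefl B) B_gt1 (hv := hash_value (Some q)) (H := H)
    (dom := predT) _ _ (leqnn N) (vp_mem vp) (vp_tab vp) (vp_lev vp) (vp_hash vp) (vp_seg vp)
    (vp_draw vp) (vp_H vp) lab_lt (vp_n vp) n_gt0 _ (near_oracleE q) (col := colv' q) _ KM_ge k_gt0).
  - by move=> lev j x y levk jH _ _; apply: hash_oracleE.
  - by move=> lev j x _; apply: hash_value_lt.
  - by [].
  - by move=> lev tau x; apply: colv_keys.
  - apply: data_congr df => lev j x xn.
    by rewrite /hash_value /point_at; case: insubP => //; rewrite xn.
  move=> f' t f0 df' ht; split=> //.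
  by rewrite f0 query_ans_qrun -zsE.
have [f' [i' [t [ex bf' [f0 df' iE' ht]]]]] := run bf.
have outE : output S (mkseq f' N, i') = point_at S None a.
  by rewrite /output [_.1]/= nth_mkseq // f0.
have an : (a <= n)%N by apply: foldl_qstep_le.
exists (mkseq f' N, i'), t; rewrite outE.
have oka : good_answer q a by move: nb; case: (good_answer q a).
rewrite oka in nb; split=> //.
- by apply: le_trans tm_ge; rewrite ler_nat.
- exact/asboolP.
rewrite -transcript_rcons; apply: IH => //.
- by rewrite size_rcons addSnnS.
- by rewrite all_rcons an.
- apply: data_congr df' => lev j x xn.
  by rewrite /hash_value /point_at; case: insubP => //; rewrite xn.
- by rewrite iE' iE size_rcons mulSn mulnDl; clear; lia.
by move: nb; rewrite drop_drop size_rcons mulSn.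
Qed.

Lemma bad_good_run :
  ~~ bad hash_index k n l J G L T Mt K query hits near_point good_answer Q [::]
     tape_labels pattern_of zs ->
  good_run d Q delta S hs coins c r tm adv.
Proof.
move=> nb; set f0 := fun a => (nth 0 (params A n Q delta) a %% B)%N.
have bf0 : bounded B f0 by move=> a; rewrite /f0 ltn_mod /B expn_gt0.
have run : runs (mach None) N B (preproc_prog k) f0 0 (fun f' i' t =>
    data' (hash_value None) lab f' /\ i' = (0 + n * J)%N).
  apply: (preprocP (m := mach None) (erefl B) B_gt1 (hv := hash_value None) (H := H)
    (dom := fun x => (x < n)%N) _ _ (leqnn N) (vp_mem vp) (vp_tab vp) (vp_lev vp) (vp_hash vp)
    (vp_seg vp) (vp_draw vp) (vp_H vp) lab_lt (vp_n vp) n_gt0 k_gt0 _ (i0 := 0) _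
    (consts_initial c' r vp)).
  - by move=> lev j x y levk jH xn yn; apply: hash_oracleE.
  - by move=> lev j x _; apply: hash_value_lt.
  - by [].
  - by move=> x; apply: labE.
  by [].
have [f' [i' [t [ex bf' [df iE]]]]] := run bf0.
exists (mkseq f' N, i'), t; split=> //.
by apply: (query_run (h := [::])) => //; rewrite ?drop0 ?iE ?addn0.
Qed.

End Run.

(** * The algorithm against a metric space and its hash families *)

Section Robust.
Variables (R : realType) (k n Q : nat) (c c' r delta : R) (prm : nat -> nat -> R -> parameters).
Variables (p1 p2 : R -> R -> R).
Let A := lsh_algorithm k c' r prm.
Let p := prm n Q delta.
Let J := pJ p. Let l := pl p. Let G := pG p. Let L := pL p. Let T := pT p.
Let Mt := pM p. Let H := pH p. Let K := pK p.
Variable nu : nat.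
Hypothesis vp : valid_parameters k n p.
Hypothesis k_gt0 : (0 < k)%N.
Hypothesis n_gt0 : (0 < n)%N.
Hypothesis c'_gt1 : 1 < c'.
Hypothesis r_gt0 : 0 < r.
Hypothesis c_c' : c' ^+ k = c.
Hypothesis T_ge : (L * 2 ^ l + 4 * (4 * nu + L) <= T)%N.
Hypothesis p1_ge0 : forall r', 0 < r' -> 0 <= p1 c' r'.
Hypothesis p2_ge0 : forall r', 0 < r' -> 0 <= p2 c' r'.
Hypothesis L_ge : forall lev, (lev < k)%N -> 3 <= L%:R * p1 c' (r * c' ^+ lev) ^+ K lev.
Hypothesis K_ge : forall lev, (lev < k)%N -> n%:R * p2 c' (r * c' ^+ lev) ^+ K lev <= 1.
Let eps : R := (1 - (2 ^ l)%:R^-1) ^+ Mt.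
Hypothesis loss_le : Q%:R * loss k n l J G nu eps <= delta.
Variables (M : metricType R) (d : nat) (fam : R -> R -> hash_family R M).
Hypothesis fam_lsh : forall c' r' : R, 1 < c' -> 0 < r' ->
  is_monotone_lsh (fam c' r') c' r' (p1 c' r') (p2 c' r').
Variables (S : 'I_n -> M) (adv : adversary M).

Let qs := queries Q S adv.
Let F := family_of A fam.
Let idx := hash_index vp k_gt0.
Let V := pattern_type n qs.
Let mu0 := mu (k := k) (H := H) S (qs := qs) F.
Let hit := hits (Q := Q) (S := S) (adv := adv).
Let near := near_point c' r S.
Let ok := good_answer c r S.

Let radius_gt0 lev : 0 < r * c' ^+ lev.
Proof. by rewrite mulr_gt0 // exprn_gt0 // (lt_trans ltr01). Qed.

Let F_lsh lev : (lev < k)%N ->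
  is_monotone_lsh (F lev) c' (r * c' ^+ lev) (p1 c' (r * c' ^+ lev)) (p2 c' (r * c' ^+ lev)).
Proof.
move=> levk; rewrite /F /family_of /= nth_mkseq //=; exact: fam_lsh.
Qed.

Definition collision_prob (q : M) (lev x : nat) : R :=
  if insub x is Some i then fine (collision (F lev) (S i) q) else 0.

Let collision_fin lev x y : collision (F lev) x y \is a fin_num.
Proof. exact/fin_num_measure/measurable_collide. Qed.

Lemma fair_queries h : reachable n Q h ->
  fair_query mu0 idx k n L H K hit near ok collision_prob (query S adv h).
Proof.
move=> rh; set q := query S adv h; have qq : q \in qs by apply: mem_queries.
have qi : (index q qs < size qs)%N by rewrite index_mem.
have insx x : (x < n)%N -> exists2 i : 'I_n, insub x = Some i & val i = x.
  by move=> xn; exists (Ordinal xn) => //; rewrite insubT.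
split.
- move=> lev j x levk jH xn; have [i ix _] := insx x xn.
  rewrite /collision_prob ix.
  pose t := Ordinal qi.
  have hitE v : hit q v x = v (t, i).
    by rewrite /hit /hits ix (insubT (fun t => (t < size qs)%N) qi).
  under eq_bigr => v _ do rewrite hitE.
  rewrite mu_collision /= val_insubd levk /query_point (tnth_nth q) /= nth_index //.
- move=> lev x levk xn; have [i ix _] := insx x xn; rewrite /collision_prob ix.
  rewrite fine_ge0 ?measure_ge0 //= -lee_fin fineK //.
  exact/probability_le1/measurable_collide.
- move=> lev x levk xn; have [i ix _] := insx x xn; rewrite /collision_prob /near /near_point ix.
  move=> nx; have [h1 _ _] := F_lsh levk.
  apply: le_trans (L_ge levk) _; apply: ler_wpM2l => //; apply: lerXn2r.
  + by rewrite nnegrE p1_ge0.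
  + by rewrite nnegrE fine_ge0 ?measure_ge0.
  by rewrite -lee_fin fineK // h1.
- move=> lev x y levk xn yn; have [i ix _] := insx x xn; have [j jy _] := insx y yn.
  rewrite /collision_prob /near /near_point ix jy -ltNge => nx ny.
  have [_ _ h3] := F_lsh levk.
  by apply: fine_le => //; apply: h3; apply: le_trans nx (ltW ny).
(* The radius of level [lev + 1] is [c'] times that of level [lev], so a point outside the former is
   far for the family of the latter. *)
- move=> lev x levk xn; have [i ix _] := insx x xn; rewrite /collision_prob /near /near_point ix.
  rewrite -ltNge => nx; have [_ h2 _] := F_lsh levk.
  apply: le_trans (K_ge levk); apply: ler_wpM2l => //; apply: lerXn2r.
  + by rewrite nnegrE fine_ge0 ?measure_ge0.
  + by rewrite nnegrE p2_ge0.
  rewrite -lee_fin fineK // h2 //; apply: ltW; apply: le_lt_trans nx.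
  by rewrite mulrCA -exprS.
- move=> a b x ab; rewrite /near /near_point; case: insub => // i nx.
  apply: le_trans nx _; rewrite ler_pM2l //; apply: ler_weXn2l => //; exact: ltW.
- move=> lev x levk xn; have [i ix _] := insx x xn; rewrite /near /near_point ix => nx.
  (* Levels stop before [k] and [c'^k = c]: even the largest ball searched lies within the
     admissible radius. *)
  have nc : mdist (S i) q <= c * r.
    apply: le_trans nx _; rewrite -c_c' mulrC ler_pM2r //; apply: ler_weXn2l.
      exact: ltW.
    exact: ltnW.
  have pxE : point_at S None x = Some (S i) by rewrite /point_at ix.
  have ball : data_ball S q (c * r) (S i) by split=> //; exists i.
  apply/asboolP; rewrite pxE; split=> [_|e|y [<-]] //; first by exists (S i).
  by move: ball; rewrite e.
(* Level 0 has radius [r] exactly, so nothing near at that level makes the answer [None]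
   acceptable. *)
move=> none; have pnE : point_at S None n = None.
  by rewrite /point_at; case: insubP => // i; rewrite ltnn.
apply/asboolP; rewrite pnE; split=> // -[y [[i _ iy] dy]].
have := none i (ltn_ord i); rewrite /near /near_point valK => /negP[].
by rewrite expr0 mulr1 iy.
Qed.

Variables (KM : nat) (tm : R).
Hypothesis KM_ge : forall lev, (lev < k)%N -> (K lev <= KM)%N.
Hypothesis tm_ge : forall (hs : forall f : nat, nat -> hf_type (family_of A fam f)) coins,
  (cQ (machine_of d Q delta S hs coins None) k J l G L T Mt KM)%:R <= tm.
Variables (disp : measure_display) (Omega : measurableType disp) (P : probability Omega R).
Variables (hs : forall f : nat, nat -> Omega -> hf_type (family_of A fam f)).
Variables (coins : nat -> Omega -> bool).
Hypothesis tapes : random_tapes P hs coins.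

Let N := (n * J + Q * (J.+1 * Mt) * (J + l))%N.

Let failing (s : seq bool) (v : {ffun index_type k H -> V}) : bool :=
  bad idx k n l J G L T Mt K (query S adv) hit near ok Q [::]
    (chunks J n s) v (chunks (J + l) (Q * (J.+1 * Mt)) (drop (n * J) s)).

(** The tape consists of label bits followed by the draws of the queries. Averaging the draws first,
    with labels and patterns fixed, gives [W], which [game_bound] controls. *)
Lemma failing_le :
  avgs 2 N (fun s => Ex mu0 (fun v => (failing (map odd s) v)%:R)) <= delta.
Proof.
have m0 : forall i v, 0 <= mu0 i v by exact: mu_ge0.
have m1 : forall i, \sum_v mu0 i v = 1 by exact: mu_sum.
have D_gt0 : (0 < 2 ^ (J + l))%N by rewrite expn_gt0.
apply: le_trans loss_le.
have eps0 : 0 <= eps.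
  by rewrite exprn_ge0 // subr_ge0 invf_le1 ?ltr0n ?ler1n expn_gt0.
have G0 := game_bound m0 m1 (hash_indexK vp k_gt0) (vp_H vp) T_ge n_gt0 k_gt0 (vp_l vp) (vp_n vp)
  (@fair_queries) eps0 (lexx _) (m := Q) (h := [::]) (leqnn Q) isT.
apply: le_trans G0.
rewrite /N /failing (avgs_two_chunks _ _ _ _ (fun labs zs => Ex mu0 (fun v =>
  (bad idx k n l J G L T Mt K (query S adv) hit near ok Q [::] labs v zs)%:R))).
rewrite /avg_all; apply: (exp_le (avgs_expectation R n (expn_gt0 2 J))) => labs.
rewrite /Ex (exp_sum (avgs_expectation R _ D_gt0)) le_eqVlt; apply/orP; left; apply/eqP.
apply: eq_bigr => v _; rewrite (expZ (avgs_expectation R _ D_gt0)); congr (_ * _).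
by rewrite -avg_bad.
Qed.

Lemma robust_event : exists2 E : set Omega, measurable E &
  ((1 - delta)%:E <= P E)%E /\
  (forall w : Omega, E w ->
     good_run d Q delta S (fun f j => hs f j w) (coins ^~ w) c r tm adv).
Proof.
have [mb pb] := tape_event N S (qs := qs) (k := k) (H := H) tapes failing.
set B := [set w | _] in mb pb.
exists (~` B); first exact: measurableC.
split.
  rewrite probability_setC // pb -EFinB lee_fin lerB // failing_le //.
move=> w /negP nb; apply: (bad_good_run (hs := fun f j => hs f j w) (coins := coins ^~ w)
  (vp := vp) (k_gt0 := k_gt0) n_gt0 KM_ge (tm_ge _ _)).
have bE : val (tape_bits N coins w) = mkseq (coins ^~ w) N.
  by rewrite /= /mkseq -val_enum_ord -map_comp.
by move: nb; rewrite /failing bE.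
Qed.

End Robust.

(** * Parameters and resource bounds *)

Section SoftBounds.
Variable R : realType.

Lemma expR_half_le2 : expR (2^-1) <= 2 :> R.
Proof.
have := expR_ge1Dx (- 2^-1 : R); rewrite expRN => h.
have e0 : 0 < expR (2^-1 : R) by apply: expR_gt0.
have : 2^-1 <= (expR (2^-1))^-1 :> R by apply: le_trans h; lra.
by rewrite lef_pV2 ?posrE.
Qed.

Lemma ln2_ge_half : 2^-1 <= ln 2 :> R.
Proof. by rewrite -[leLHS]expRK ler_ln ?posrE ?expR_gt0 //; exact: expR_half_le2. Qed.

Lemma ln2_le1 : ln 2 <= 1 :> R.
Proof.
by rewrite -[leRHS]expRK ler_ln ?posrE ?expR_gt0 //; have := expR_ge1Dx (1 : R); lra.
Qed.

Variables (n Q : nat) (delta : R).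
Hypotheses (n_gt0 : (0 < n)%N) (Q_gt0 : (0 < Q)%N) (delta_gt0 : 0 < delta).

Definition size_sum : R := 3 + n%:R + Q%:R + delta^-1.

Let n1 : 1 <= n%:R :> R. Proof. by rewrite ler1n. Qed.
Let Q1 : 1 <= Q%:R :> R. Proof. by rewrite ler1n. Qed.
Let d0 : 0 < delta^-1. Proof. by rewrite invr_gt0. Qed.

Lemma size_sum_ge5 : 5 <= size_sum.
Proof. by rewrite /size_sum; move: n1 Q1 d0; lra. Qed.

Lemma logf_ge1 : 1 <= logf n Q delta.
Proof.
rewrite /logf -/size_sum -[leLHS]expRK ler_ln ?posrE ?expR_gt0 //; last first.
  by apply: lt_le_trans size_sum_ge5.
(* Squaring the bound 2 for the half exponent gives [e <= 4], below the lower bound 5 of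
   [size_sum]. *)
have -> : expR 1 = expR 2^-1 ^+ 2 :> R by rewrite expr2 -expRD; congr expR; lra.
have := expR_half_le2; have := expR_gt0 (2^-1 : R); have := size_sum_ge5.
move: (expR _) => e; nra.
Qed.

(** A single integer [y] of logarithmic size such that [2^y] dominates [n], [Q] and [delta^-1]; all
    tuning is expressed in it. *)
Definition bits_of : nat := up_log 2 (Num.truncn size_sum).+1.

Lemma bits_of_ge : size_sum <= (2 ^ bits_of)%:R.
Proof.
apply: (@le_trans _ _ (Num.truncn size_sum).+1%:R); first exact/ltW/truncnS_gt.
by rewrite ler_nat up_logP.
Qed.

Lemma bits_of_gt0 : (0 < bits_of)%N.
Proof.
rewrite up_log_gt0 /= ltnS truncn_gt0; have := size_sum_ge5; lra.
Qed.

Lemma ln_pow2 (e : nat) : ln (2 ^ e)%:R = e%:R * ln 2 :> R.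
Proof. by rewrite natrX lnXn // mulr_natl. Qed.

Lemma bits_of_le : bits_of%:R <= 5 * logf n Q delta.
Proof.
have s5 := size_sum_ge5.
have s1 : (1 < (Num.truncn size_sum).+1)%N by rewrite ltnS truncn_gt0; lra.
have := up_log_gtn (isT : 1 < 2)%N s1; rewrite -/bits_of => h.
have t0 : 0 < size_sum by lra.
(* The square is generous; with [ln 2 >= 1/2] it yields [bits_of - 1 <= 4 * logf], and [logf >= 1]
   absorbs the last unit into the constant 5. *)
have h2 : (2 ^ bits_of.-1)%:R <= size_sum ^+ 2.
  apply: (@le_trans _ _ (Num.truncn size_sum)%:R); first by rewrite ler_nat -ltnS.
  have : (Num.truncn size_sum)%:R <= size_sum by rewrite truncn_le ltW.
  by rewrite expr2; nra.
have : ln (2 ^ bits_of.-1)%:R <= ln (size_sum ^+ 2).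
  by rewrite ler_ln ?posrE ?ltr0n ?expn_gt0 // exprn_gt0.
rewrite ln_pow2 lnXn // -[ln size_sum]/(logf n Q delta) => h3.
have bE : bits_of%:R = bits_of.-1%:R + 1 :> R by rewrite natr1 prednK // bits_of_gt0.
have b0 : 0 <= bits_of.-1%:R :> R by [].
have := ln2_ge_half; have := logf_ge1; rewrite bE; move: h3; rewrite -[logf _ _ _ *+ 2]mulr_natr.
move: (ln 2) (bits_of.-1%:R) (logf _ _ _) b0 => a b x b0; nra.
Qed.

End SoftBounds.

Section SoftO.
Variable R : realType.

(** A calculus for soft-O, with constants uniform in [n], [Q] and [delta] and no power of [Q]. The
    power of the logarithm stays existential, which makes it stable under sums and products. *)
Definition soft (e : R) (f : nat -> nat -> R -> nat) : Prop :=
  exists (C : R) (a : nat), 0 <= C /\ forall n Q delta, (0 < n)%N -> (0 < Q)%N -> 0 < delta ->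
    (f n Q delta)%:R <= C * logf n Q delta ^+ a * n%:R `^ e.

Lemma soft_weaken e e' f : e <= e' -> soft e f -> soft e' f.
Proof.
move=> ee [C [a [C0 h]]]; exists C, a; split=> // n Q delta n0 Q0 d0.
apply: le_trans (h _ _ _ n0 Q0 d0) _; apply: ler_wpM2l.
  by rewrite mulr_ge0 // exprn_ge0 // (le_trans ler01) // logf_ge1.
by apply: ler_powR => //; rewrite ler1n.
Qed.

Lemma soft_le e f g : (forall n Q delta, (0 < n)%N -> (0 < Q)%N -> 0 < delta ->
  (f n Q delta <= g n Q delta)%N) -> soft e g -> soft e f.
Proof.
move=> fg [C [a [C0 h]]]; exists C, a; split=> // n Q delta n0 Q0 d0.
by apply: le_trans (h _ _ _ n0 Q0 d0); rewrite ler_nat fg.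
Qed.

Lemma soft_cst c : soft 0 (fun _ _ _ => c).
Proof.
exists c%:R, 0%N; split=> // n Q delta n0 Q0 d0; by rewrite expr0 powRr0 !mulr1.
Qed.

Lemma soft_size : soft 1 (fun n _ _ => n).
Proof.
exists 1, 0%N; split=> // n Q delta n0 Q0 d0; by rewrite expr0 powRr1 // !mul1r.
Qed.

Lemma soft_add e f g : soft e f -> soft e g -> soft e (fun n Q d => f n Q d + g n Q d)%N.
Proof.
move=> [C [a [C0 h]]] [C' [a' [C'0 h']]]; exists (C + C'), (maxn a a').
split=> [|n Q delta n0 Q0 d0]; first exact: addr_ge0.
have lg1 := logf_ge1 n0 Q0 d0.
rewrite natrD !mulrDl; apply: lerD.
  apply: le_trans (h _ _ _ n0 Q0 d0) _; rewrite ler_wpM2r ?powR_ge0 // ler_wpM2l //.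
  by rewrite ler_weXn2l // leq_maxl.
apply: le_trans (h' _ _ _ n0 Q0 d0) _; rewrite ler_wpM2r ?powR_ge0 // ler_wpM2l //.
by rewrite ler_weXn2l // leq_maxr.
Qed.

Lemma soft_mul e e' f g : soft e f -> soft e' g ->
  soft (e + e') (fun n Q d => f n Q d * g n Q d)%N.
Proof.
move=> [C [a [C0 h]]] [C' [a' [C'0 h']]]; exists (C * C'), (a + a')%N.
split=> [|n Q delta n0 Q0 d0]; first exact: mulr_ge0.
rewrite natrM; apply: le_trans (ler_pM _ _ (h _ _ _ n0 Q0 d0) (h' _ _ _ n0 Q0 d0)) _ => //.
rewrite exprD powRD; first by rewrite le_eqVlt; apply/orP; left; apply/eqP; ring.
by apply/implyP => _; rewrite pnatr_eq0 -lt0n.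
Qed.

Lemma soft_mul0 e f g : soft e f -> soft 0 g -> soft e (fun n Q d => f n Q d * g n Q d)%N.
Proof. by move=> hf hg; rewrite -[e]addr0; apply: soft_mul. Qed.

Lemma soft_mul0l e f g : soft 0 f -> soft e g -> soft e (fun n Q d => f n Q d * g n Q d)%N.
Proof. by move=> hf hg; rewrite -[e]add0r; apply: soft_mul. Qed.

(** The logarithm of a soft bound is linear in [logf], without an unknown power, as the word size
    requires. *)
Lemma soft_up_log e f : 0 <= e -> soft e f ->
  exists C : R, forall n Q delta, (0 < n)%N -> (0 < Q)%N -> 0 < delta ->
    (up_log 2 (f n Q delta))%:R <= C * logf n Q delta.
Proof.
move=> e0 [C [a [C0 h]]]; pose C1 := C + 1.
have C1_1 : 1 <= C1 by rewrite lerDr.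
have C1_0 : 0 < C1 by apply: lt_le_trans C1_1.
exists (1 + 2 * (ln C1 + a%:R + e)) => n Q delta n0 Q0 d0.
have lg1 := logf_ge1 n0 Q0 d0; set x := logf _ _ _ in lg1 *.
have x0 : 0 < x by apply: lt_le_trans lg1.
have lnC : 0 <= ln C1 by apply: ln_ge0.
have K0 : 0 <= ln C1 + a%:R + e by rewrite !addr_ge0.
have [f1|f1] := leqP (f n Q delta) 1.
  have -> : up_log 2 (f n Q delta) = 0%N by apply/eqP; rewrite up_log_eq0 f1 orbT.
  by rewrite mulr_ge0 // ?(ltW x0) // addr_ge0 // mulr_ge0.
have := up_log_gtn (isT : 1 < 2)%N f1; set u := up_log _ _ => uf.
have u0 : (0 < u)%N by rewrite up_log_gt0.
have n0' : 0 < n%:R :> R by rewrite ltr0n.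
have pos : 0 < C1 * x ^+ a * n%:R `^ e by rewrite !mulr_gt0 ?exprn_gt0 ?powR_gt0.
have : ln (2 ^ u.-1)%:R <= ln (C1 * x ^+ a * n%:R `^ e).
  rewrite ler_ln ?posrE ?ltr0n ?expn_gt0 //.
  apply: (@le_trans _ _ (f n Q delta)%:R); first by rewrite ler_nat ltnW.
  apply: le_trans (h _ _ _ n0 Q0 d0) _; rewrite ler_wpM2r ?powR_ge0 // ler_wpM2r ?exprn_ge0 ?ltW //.
  by rewrite ltrDl.
rewrite ln_pow2 !lnM ?posrE ?mulr_gt0 ?exprn_gt0 ?powR_gt0 // lnXn // ln_powR -mulr_natl.
have lnx : ln x <= x.
  have h1 : ln (1 + (x - 1)) <= x - 1 by apply: le_ln1Dx; lra.
  by move: h1; rewrite addrC subrK; lra.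
have lnn : ln n%:R <= x.
  rewrite /x /logf ler_ln ?posrE //; last by rewrite !addr_gt0 ?ltr0n ?invr_gt0.
  have : 0 < delta^-1 by rewrite invr_gt0.
  have : 0 <= Q%:R :> R by []. lra.
have uE : u%:R = u.-1%:R + 1 :> R by rewrite natr1 prednK.
have up0 : 0 <= u.-1%:R :> R by [].
have lh := ln2_ge_half R.
have h1 : a%:R * ln x <= a%:R * x by apply: ler_wpM2l.
have h2 : e * ln n%:R <= e * x by apply: ler_wpM2l.
have h3 : ln C1 <= ln C1 * x by rewrite ler_peMr.
have h4 : u.-1%:R * 2^-1 <= u.-1%:R * ln 2 :> R by apply: ler_wpM2l.
move=> h5; rewrite uE mulrDl mul1r -mulrA !mulrDl; lra.
Qed.

End SoftO.

Section Loss.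
Variable R : realType.

Lemma miss_half l : (0 < l)%N -> (1 - l%:R^-1) ^+ l <= 2^-1 :> R.
Proof.
move=> l0; have l0' : 0 < l%:R :> R by rewrite ltr0n.
have h : 1 - l%:R^-1 <= expR (- l%:R^-1) :> R by apply: expR_ge1Dx.
have p : 0 <= 1 - l%:R^-1 :> R by rewrite subr_ge0 invf_le1 // ler1n.
apply: (@le_trans _ _ (expR (- l%:R^-1) ^+ l)); first by apply: lerXn2r; rewrite ?nnegrE ?expR_ge0.
rewrite -expRM_natr mulNr mulVf ?gt_eqF // expRN lef_pV2 ?posrE ?expR_gt0 //.
by have := expR_ge1Dx (1 : R); lra.
Qed.

(** With [z = 2^-y], the constants bound the three terms of a segment by [z^4 / 8], [z^4 / 16] and
    [z^4 / 8]. The factors [2^J] and [J + 1], each at most [1 / z], leave [z^2 / 2]; the failing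
    attempts add as much, and the factor [Q <= 1 / z] leaves [z <= delta]. *)
Lemma loss_small k n Q J l (y : nat) (delta : R) (rr := ((J + 1) %/ k).+1) :
  (Q <= 2 ^ y)%N -> (n <= 2 ^ y)%N -> (J <= y)%N -> ((2 ^ y)%:R)^-1 <= delta ->
  (4 * y + 6 <= 2 ^ l)%N ->
  Q%:R * loss k n l J (5 * y + 3) (2 * 2 ^ rr + (4 * y + 3))
    ((1 - (2 ^ l)%:R^-1) ^+ (2 ^ l * (2 * y + 1))) <= delta.
Proof.
move=> Qy ny Jy dy ly; rewrite /loss /stage_loss -/rr; apply: le_trans dy.
set Z : R := (2 ^ y)%:R; have Z0 : 0 < Z by rewrite ltr0n expn_gt0.
set z := Z^-1; have z0 : 0 < z by rewrite invr_gt0.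
have Zz : Z * z = 1 by rewrite mulfV ?gt_eqF.
have zE : z = 2^-1 ^+ y by rewrite exprVn /z /Z natrX.
have i1 : 4 ^+ 2 / 2 ^+ (2 ^ l).+1 <= z ^+ 4 / 8 :> R.
  have -> : z ^+ 4 / 8 = 4 ^+ 2 / 2 ^+ (4 * y + 7) :> R.
    by rewrite zE -exprM mulnC exprD invfM -exprVn; field.
  rewrite ler_pM2l ?exprn_gt0 // lef_pV2 ?posrE ?exprn_gt0 // ler_weXn2l ?ler1n //.
  by move: ly; clear; lia.
have i2 : 4 ^+ (2 ^ rr) / 2 ^+ (2 * 2 ^ rr + (4 * y + 3)).+1 = z ^+ 4 / 16 :> R.
  have -> : 4 = 2 ^+ 2 :> R by rewrite -natrX.
  rewrite -exprM -addnS exprD invfM mulrA mulfV ?mul1r ?expf_neq0 //.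
  by rewrite zE -exprM [(y * 4)%N]mulnC -addnS exprD invfM -exprVn; field.
have i3 : n%:R * 2^-1 ^+ (5 * y + 3) <= z ^+ 4 / 8 :> R.
  apply: (@le_trans _ _ (Z * 2^-1 ^+ (5 * y + 3))).
    by rewrite ler_wpM2r ?exprn_ge0 // ler_nat.
  rewrite exprD [(5 * y)%N]mulnC exprM -zE [z ^+ 5]exprS !mulrA Zz mul1r.
  by rewrite le_eqVlt; apply/orP; left; apply/eqP; field.
have i4 : (1 - (2 ^ l)%:R^-1) ^+ (2 ^ l * (2 * y + 1)) <= z ^+ 2 / 2 :> R.
  have -> : z ^+ 2 / 2 = 2^-1 ^+ (2 * y + 1) :> R.
    by rewrite zE -exprM mulnC [in RHS]exprD expr1.
  rewrite exprM; apply: lerXn2r; rewrite ?nnegrE ?exprn_ge0 ?miss_half ?expn_gt0 //.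
  by rewrite subr_ge0 invf_le1 ?ler1n ?ltr0n ?expn_gt0.
have JZ : J.+1%:R <= Z.
  by rewrite ler_nat; apply: leq_trans (ltn_expl J (isT : 1 < 2)%N) _; rewrite leq_exp2l.
have J2Z : (2 ^ J)%:R <= Z by rewrite ler_nat leq_exp2l.
have QZ : Q%:R <= Z by rewrite ler_nat.
move: i1 i3 i4; rewrite i2.
set a := 4 ^+ 2 / _; set b := n%:R * _; set e := (1 - _) ^+ _ => i1 i3 i4.
have z4 : 0 <= z ^+ 4 by rewrite exprn_ge0 ?ltW.
have s1 : a + z ^+ 4 / 16 + b <= z ^+ 4 / 2 by lra.
have a0 : 0 <= a by rewrite divr_ge0 // exprn_ge0.
have b0 : 0 <= b by rewrite mulr_ge0 // exprn_ge0.
have s2 : (2 ^ J)%:R * (a + z ^+ 4 / 16 + b) <= z ^+ 3 / 2.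
  have -> : z ^+ 3 / 2 = Z * (z ^+ 4 / 2) by rewrite [z ^+ 4]exprS 2!mulrA Zz mul1r.
  by apply: ler_pM => //; rewrite !addr_ge0 ?divr_ge0.
have s3 : J.+1%:R * ((2 ^ J)%:R * (a + z ^+ 4 / 16 + b)) <= z ^+ 2 / 2.
  have -> : z ^+ 2 / 2 = Z * (z ^+ 3 / 2) by rewrite [z ^+ 3]exprS 2!mulrA Zz mul1r.
  by apply: ler_pM => //; rewrite mulr_ge0 // !addr_ge0 ?divr_ge0.
have e0 : 0 <= e.
  by rewrite exprn_ge0 // subr_ge0 invf_le1 ?ler1n ?ltr0n ?expn_gt0.
rewrite [leRHS](_ : _ = Z * z ^+ 2); last by rewrite expr2 mulrA Zz mul1r.
apply: ler_pM => //; first by rewrite addr_ge0 // !mulr_ge0 // !addr_ge0 ?divr_ge0.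
lra.
Qed.

End Loss.

(** * Choice of the parameters *)

Section Choice.
Variables (R : realType) (k : nat) (beta rho0 : R) (p1 p2 : nat -> R).
Hypothesis k_gt0 : (0 < k)%N.
Hypothesis p2_gt0 : forall i, 0 < p2 i.
Hypothesis p2_lt : forall i, p2 i < p1 i.
Hypothesis p1_lt1 : forall i, p1 i < 1.
Hypothesis rho0E : forall i, rho0 = ln (p1 i)^-1 / ln (p2 i)^-1.
Hypothesis rho0_le : rho0 <= beta.
Hypothesis k_le : k%:R^-1 <= beta.

(** The logarithm of [n] to the base [1 / p2], rounded up: far points then collide with probability
    at most [1 / n] in a table. *)
Definition hash_len (n i : nat) : nat := (Num.truncn (ln n%:R / ln (p2 i)^-1)).+1.
(** The 3 is the one of [fq_near], and [1 / p1] pays for rounding the key length up; the sum serves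
    all levels at once. *)
Definition table_const : nat := (Num.truncn (\sum_(i < k) 3 / p1 i)).+1.
(** One extra unit rounds the sum up, the other covers the successor in [hash_len]. *)
Definition hash_const : nat := (Num.truncn (\sum_(i < k) (ln (p2 i)^-1)^-1)).+2.
Definition powb (n : nat) : nat := (Num.truncn (n%:R `^ beta)).+1.

Definition par_J (n : nat) : nat := up_log 2 n.
Definition par_l n Q (delta : R) : nat := up_log 2 (4 * bits_of n Q delta + 6).
Definition par_G n Q (delta : R) : nat := (5 * bits_of n Q delta + 3)%N.
Definition par_L n : nat := (table_const * powb n)%N.
Definition par_nu n Q (delta : R) : nat :=
  (2 * 2 ^ ((par_J n + 1) %/ k).+1 + (4 * bits_of n Q delta + 3))%N.
Definition par_T n Q (delta : R) : nat :=
  (par_L n * 2 ^ par_l n Q delta + 4 * (4 * par_nu n Q delta + par_L n))%N.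
Definition par_M n Q (delta : R) : nat := (2 ^ par_l n Q delta * (2 * bits_of n Q delta + 1))%N.
Definition par_K n Q (delta : R) : nat := (hash_const * bits_of n Q delta)%N.
Definition par_H n Q (delta : R) : nat := (par_G n Q delta * par_L n * par_K n Q delta + 1)%N.
Definition par_words n Q (delta : R) : nat :=
  (43 + k + n + k * (par_G n Q delta * par_L n) * n + 2 ^ par_l n Q delta)%N.
(** The sum of everything that has to fit into a word, so that one logarithm yields a word size
    meeting all overflow conditions. *)
Definition par_total n Q (delta : R) : nat :=
  ((par_words n Q delta + par_J n + par_l n Q delta + par_M n Q delta + par_T n Q delta + 2) +
   (par_G n Q delta * par_L n + par_G n Q delta + par_L n + 2) + (k * (par_J n + 1) + 2) +
   (par_H n Q delta + 2) + (2 ^ (par_J n).+1 * n.+1 + 2) + (2 ^ (par_J n + par_l n Q delta).+1 + 2) +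
   par_K n Q delta)%N.

Definition lsh_parameters n Q (delta : R) : parameters := {|
  pJ := par_J n; pl := par_l n Q delta; pG := par_G n Q delta; pL := par_L n; pT := par_T n Q delta;
  pM := par_M n Q delta; pH := par_H n Q delta; pbits := (up_log 2 (par_total n Q delta)).+1;
  pK := hash_len n |}.

Section Fixed.
Variables (n Q : nat) (delta : R).
Hypotheses (n_gt0 : (0 < n)%N) (Q_gt0 : (0 < Q)%N) (delta_gt0 : 0 < delta).
Let y := bits_of n Q delta.

Let n1 : 1 <= n%:R :> R. Proof. by rewrite ler1n. Qed.
Let d0 : 0 < delta^-1. Proof. by rewrite invr_gt0. Qed.

Lemma size_le : (n <= 2 ^ y)%N.
Proof.
rewrite -(ler_nat R); apply: le_trans (bits_of_ge n Q delta).
by rewrite /size_sum; have : 0 <= Q%:R :> R by []; move: d0; lra.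
Qed.

Lemma queries_le : (Q <= 2 ^ y)%N.
Proof.
rewrite -(ler_nat R); apply: le_trans (bits_of_ge n Q delta).
by rewrite /size_sum; move: d0 n1; lra.
Qed.

Lemma delta_ge : ((2 ^ y)%:R)^-1 <= delta.
Proof.
rewrite invf_ple ?posrE ?ltr0n ?expn_gt0 //; apply: le_trans (bits_of_ge n Q delta).
by rewrite /size_sum; have : 0 <= Q%:R :> R by []; move: d0 n1; lra.
Qed.

Lemma par_J_le : (par_J n <= y)%N.
Proof. by apply: up_log_min => //; exact: size_le. Qed.

Let y_gt0 : (0 < y)%N. Proof. exact: bits_of_gt0. Qed.

Let a i := ln (p2 i)^-1.
Let a_gt0 i : 0 < a i.
Proof.
rewrite /a ln_gt0 // invf_gt1 // (lt_trans (p2_lt i)) //.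
Qed.

Let lnn_ge0 : 0 <= ln n%:R :> R. Proof. exact: ln_ge0. Qed.

Let quot_ge0 i : 0 <= ln n%:R / a i.
Proof. by rewrite divr_ge0 // ltW. Qed.

Let p1_gt0 i : 0 < p1 i. Proof. exact: lt_trans (p2_lt i). Qed.

Lemma hash_len_le i : (i < k)%N -> (hash_len n i <= par_K n Q delta)%N.
Proof.
move=> ik; rewrite /hash_len /par_K -/y -/(a i).
have lnn : ln n%:R <= y%:R :> R.
  apply: (@le_trans _ _ (ln (2 ^ y)%:R)).
    by rewrite ler_ln ?posrE ?ltr0n ?expn_gt0 // ler_nat size_le.
  by rewrite ln_pow2 ler_piMr // ln2_le1.
set s := \sum_(i < k) (a i)^-1.
have ai : (a i)^-1 <= s.
  rewrite /s (bigD1 (Ordinal ik)) //= lerDl; apply: sumr_ge0 => j _.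
  by rewrite invr_ge0 ltW.
have s0 : 0 <= s by apply: sumr_ge0 => j _; rewrite invr_ge0 ltW.
have : (Num.truncn (ln n%:R / a i) <= (Num.truncn s).+1 * y)%N.
  rewrite -(ler_nat R); apply: (@le_trans _ _ (ln n%:R / a i)).
    by rewrite truncn_le quot_ge0.
  rewrite natrM mulrC; apply: ler_pM => //.
  - by rewrite invr_ge0 ltW.
  by apply: le_trans ai _; apply/ltW/truncnS_gt.
rewrite /hash_const -/s [((_).+2 * _)%N]mulSn => h.
by rewrite -add1n leq_add.
Qed.

Lemma far_le i : n%:R * p2 i ^+ hash_len n i <= 1.
Proof.
have n0 : 0 < n%:R :> R by rewrite ltr0n.
rewrite -ler_pdivlMl // mulr1 -[p2 i]lnK ?posrE // -expRM_natr -[X in _ <= X]lnK ?posrE ?invr_gt0 //.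
rewrite ler_expR lnV ?posrE // lerNr -mulNr -lnV ?posrE // -/(a i).
by rewrite -ler_pdivrMl // mulrC; apply/ltW/truncnS_gt.
Qed.

(** As [ln (1 / p1) = rho0 * ln (1 / p2)], the collision probability is at least [p1 * n^-rho0],
    hence at least [p1 * n^-beta]. The factor [powb n] cancels the power and [table_const] the
    factor [p1]. *)
Lemma near_ge i : (i < k)%N -> 3 <= (par_L n)%:R * p1 i ^+ hash_len n i.
Proof.
move=> ik; have n0 : 0 < n%:R :> R by rewrite ltr0n.
have b0 : 0 <= ln (p1 i)^-1 by rewrite ln_ge0 // invf_ge1 // ltW.
have kl : (hash_len n i)%:R <= ln n%:R / a i + 1.
  by rewrite /hash_len -natr1 lerD2r truncn_le quot_ge0.
have h1 : p1 i * (n%:R `^ beta)^-1 <= p1 i ^+ hash_len n i.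
  rewrite -powRN -[in leLHS](lnK (x := p1 i)) ?posrE // /powR gt_eqF // -expRD.
  rewrite -[in leRHS](lnK (x := p1 i)) ?posrE // -expRM_natr ler_expR.
  have -> : ln (p1 i) = - ln (p1 i)^-1 by rewrite lnV ?posrE // opprK.
  have h2 : ln (p1 i)^-1 * (hash_len n i)%:R <= ln (p1 i)^-1 * (ln n%:R / a i + 1).
    exact: ler_wpM2l.
  have h3 : rho0 * ln n%:R <= beta * ln n%:R by rewrite ler_wpM2r // ln_ge0.
  have h4 : ln (p1 i)^-1 * (ln n%:R / a i + 1) = rho0 * ln n%:R + ln (p1 i)^-1.
    by rewrite (rho0E i) -/(a i); field; rewrite gt_eqF.
  by rewrite !mulNr; move: h2 h3 h4; lra.
have N0 : 0 < n%:R `^ beta by apply: powR_gt0.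
apply: (@le_trans _ _ ((par_L n)%:R * (p1 i * (n%:R `^ beta)^-1))); last exact: ler_wpM2l.
have h5 : 3 / p1 i <= table_const%:R.
  apply: (@le_trans _ _ (\sum_(i < k) 3 / p1 i)); last exact/ltW/truncnS_gt.
  rewrite (bigD1 (Ordinal ik)) //= lerDl; apply: sumr_ge0 => j _.
  by rewrite divr_ge0 // ltW.
have h6 : n%:R `^ beta <= (powb n)%:R by apply/ltW/truncnS_gt.
rewrite /par_L natrM mulrACA.
have h7 : 3 <= table_const%:R * p1 i by rewrite -ler_pdivrMr.
have h8 : 1 <= (powb n)%:R * (n%:R `^ beta)^-1 by rewrite ler_pdivlMr // mul1r.
by rewrite -[leLHS]mulr1; apply: ler_pM.
Qed.

Lemma lsh_parameters_valid : valid_parameters k n (lsh_parameters n Q delta).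
Proof.
have tot : (par_total n Q delta < 2 ^ pbits (lsh_parameters n Q delta))%N.
  rewrite /= expnS mul2n -addnn; apply: leq_trans (leq_add (up_logP _ (isT : 1 < 2)%N)
    (up_logP (par_total n Q delta) (isT : 1 < 2)%N)).
  have : (0 < par_total n Q delta)%N by rewrite /par_total; clear; lia.
  by clear; lia.
have part x : (x <= par_total n Q delta)%N -> (x < 2 ^ pbits (lsh_parameters n Q delta))%N.
  by move=> h; apply: leq_ltn_trans tot.
split=> //.
- apply: (part (par_words n Q delta + par_J n + par_l n Q delta + par_M n Q delta + par_T n Q delta + 2)%N).
  by rewrite /par_total; clear; lia.
- by apply: part; rewrite /par_total /=; clear; lia.
- by apply: part; rewrite /par_total /=; clear; lia.
- by apply: part; rewrite /par_total /=; clear; lia.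
- by apply: part; rewrite /par_total /=; clear; lia.
- by apply: part; rewrite /par_total /=; clear; lia.
- by move=> i ik; apply: part; apply: leq_trans (hash_len_le ik) _; rewrite /par_total; clear; lia.
- move=> i ik; rewrite /= /par_H; apply: leq_trans (leq_addr _ _).
  by rewrite leq_mul2l hash_len_le ?orbT.
- by rewrite /= /par_H addn1.
- exact: up_logP.
by rewrite /= /par_l up_log_gt0 /=; clear; lia.
Qed.

Lemma lsh_loss : Q%:R * loss k n (par_l n Q delta) (par_J n) (par_G n Q delta) (par_nu n Q delta)
   ((1 - (2 ^ par_l n Q delta)%:R^-1) ^+ par_M n Q delta) <= delta.
Proof.
apply: loss_small; [exact: queries_le|exact: size_le|exact: par_J_le|exact: delta_ge|].
exact: up_logP.
Qed.

End Fixed.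

End Choice.

Definition unit_machine : machine :=
  Machine 1 0 (fun _ _ _ => false) (fun _ _ _ _ => false) (fun _ => false).

(** The cost is affine in the dimension with non-negative coefficients, so it is at most the
    dimension times its value at dimension 1. *)
Lemma cQ_dimension m k J l G L T M KM : (0 < dimension m)%N ->
  (cQ m k J l G L T M KM <= dimension m * cQ unit_machine k J l G L T M KM)%N.
Proof.
move=> d0; set d := dimension m.
have aff x y a b : (x <= d * y)%N -> (a * x + b <= d * (a * y + b))%N.
  move=> xy; rewrite mulnDr mulnCA leq_add //; first by rewrite leq_mul2l xy orbT.
  by rewrite leq_pmull.
have aff2 x y a b b' : (x <= d * y)%N -> (a * x + b + b' <= d * (a * y + b + b'))%N.
  by move=> xy; rewrite -!addnA aff.
have kK : (cK m k <= d * cK unit_machine k)%N by rewrite /cK -/d /=; clear aff aff2; nia.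
have kE : (cE m k l <= d * cE unit_machine k l)%N.
  by rewrite /cE /cP -/d /= ; move: (2 ^ l)%N; clear aff aff2; nia.
have kJ : (J.+1 * (KM * cK m k + 200) <= d * (J.+1 * (KM * cK unit_machine k + 200)))%N.
  by rewrite [leqRHS]mulnCA leq_mul2l aff ?orbT.
have kA : (cAM m k J l G L T KM <= d * cAM unit_machine k J l G L T KM)%N.
  rewrite /cAM; apply: aff; rewrite [leqRHS]mulnDr leq_add ?leq_pmull //.
  rewrite [leqRHS]mulnDr leq_add //; last by rewrite [leqRHS]mulnCA leq_mul2l kE orbT.
  by rewrite [leqRHS]mulnCA leq_mul2l aff2 ?orbT.
rewrite /cQ; apply: (aff); apply: (aff).
by have := aff2 _ _ 1%N ((J + l) * 40)%N 100%N kA; rewrite !mul1n.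
Qed.

Section SoftParameters.
Variables (R : realType) (k : nat) (beta : R) (p1 p2 : nat -> R).
Hypothesis k_gt0 : (0 < k)%N.
Hypothesis k_le : k%:R^-1 <= beta.

Let beta_ge0 : 0 <= beta.
Proof. by apply: le_trans k_le; rewrite invr_ge0. Qed.

Let soft_0b f : soft 0 f -> soft beta f. Proof. exact: soft_weaken. Qed.
Let soft_cstb (c : nat) : soft beta (fun _ _ _ => c). Proof. exact/soft_0b/soft_cst. Qed.

Lemma soft_bits : soft (0 : R) (@bits_of R).
Proof.
exists 5, 1%N; split=> // n Q delta n0 Q0 d0; rewrite powRr0 mulr1 expr1.
exact: bits_of_le.
Qed.

Lemma soft_pow_par_l : soft (0 : R) (fun n Q d => 2 ^ par_l n Q d)%N.
Proof.
apply: (soft_le (g := fun n Q d => 2 * (4 * bits_of n Q d + 6))%N).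
  move=> n Q d n0 Q0 d0; rewrite /par_l; set x := (4 * _ + 6)%N.
  have x1 : (1 < x)%N by rewrite /x; clear; lia.
  have := up_log_gtn (isT : 1 < 2)%N x1.
  have : (0 < up_log 2 x)%N by rewrite up_log_gt0.
  by case: up_log => // u _ /= h; rewrite expnS leq_mul2l ltnW.
apply: soft_mul0; first exact: soft_cst.
apply: soft_add; last exact: soft_cst.
by apply: soft_mul0; [exact: soft_cst|exact: soft_bits].
Qed.

Lemma soft_par_l : soft (0 : R) (@par_l R).
Proof.
by apply: soft_le soft_pow_par_l => n Q d _ _ _; apply/ltnW/ltn_expl.
Qed.

Lemma soft_par_J : soft (0 : R) (fun n _ _ => par_J n).
Proof. by apply: soft_le soft_bits => n Q d n0 Q0 d0; apply: par_J_le. Qed.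

Lemma pow_par_J_le n : (0 < n)%N -> (2 ^ par_J n <= 2 * n)%N.
Proof.
move=> n0; have [n1|n1] := leqP n 1.
  by have -> : n = 1%N by move: n0 n1; clear; lia.
have := up_log_gtn (isT : 1 < 2)%N n1.
have : (0 < up_log 2 n)%N by rewrite up_log_gt0.
by rewrite /par_J; case: up_log => // u _ /= h; rewrite expnS leq_mul2l ltnW.
Qed.

Lemma soft_pow_par_J : soft (1 : R) (fun n _ _ => 2 ^ par_J n)%N.
Proof.
apply: (soft_le (g := fun n Q d => 2 * n)%N); first by move=> n Q d n0 _ _; apply: pow_par_J_le.
apply: soft_mul0l; [exact: soft_cst|exact: soft_size].
Qed.

Lemma soft_par_G : soft (0 : R) (@par_G R).
Proof.
apply: soft_add; last exact: soft_cst.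
by apply: soft_mul0; [exact: soft_cst|exact: soft_bits].
Qed.

Lemma soft_par_L : soft beta (fun n _ _ => par_L k beta p1 n).
Proof.
apply: soft_mul0l; first exact: soft_cst.
exists 2, 0%N; split=> // n Q d n0 _ _; rewrite expr0 mulr1 /powb.
have h : 1 <= n%:R `^ beta.
  by rewrite -[leLHS](powRr0 (n%:R : R)); apply: ler_powR; rewrite ?ler1n.
have : (Num.truncn (n%:R `^ beta))%:R <= n%:R `^ beta by rewrite truncn_le powR_ge0.
rewrite -natr1; lra.
Qed.

(** The [k]-th power is at most [2^(J + 1) <= 4 n], so the quantity is at most [4 n^(1/k)]. This is
    the term of the query time that makes [1 / k] enter [beta]. *)
Lemma soft_root : soft beta (fun n _ _ => 2 ^ ((par_J n + 1) %/ k))%N.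
Proof.
exists 4, 0%N; split=> // n Q d n0 _ _; rewrite expr0 mulr1.
set x : R := (_ ^ _)%:R; have x0 : 0 <= x by [].
have n1 : 1 <= n%:R :> R by rewrite ler1n.
have k0 : 0 < k%:R :> R by rewrite ltr0n.
have k1 : k%:R^-1 <= 1 :> R by rewrite invf_le1 // ler1n.
have xk : x ^+ k <= 4 * n%:R.
  rewrite /x -natrX -expnM -[4]/(4%:R) -natrM ler_nat.
  apply: (@leq_trans (2 ^ (par_J n + 1))); first by rewrite leq_exp2l // leq_divM.
  by rewrite addn1 expnS; have := pow_par_J_le n0; clear; lia.
have -> : x = (x ^+ k) `^ k%:R^-1.
  by rewrite -powR_mulrn // -powRrM mulfV ?gt_eqF // powRr1.
apply: (@le_trans _ _ ((4 * n%:R) `^ k%:R^-1)).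
  apply: ge0_ler_powR => //; rewrite ?nnegrE ?invr_ge0 ?exprn_ge0 ?mulr_ge0 //.
rewrite powRM //; apply: ler_pM; rewrite ?powR_ge0 //; first by apply: ler1_powR => //; lra.
exact: ler_powR.
Qed.

Lemma soft_par_nu : soft beta (@par_nu R k).
Proof.
apply: soft_add.
  apply: soft_mul0l; first exact: soft_cst.
  apply: (soft_le (g := fun n _ _ => 2 * 2 ^ ((par_J n + 1) %/ k))%N).
    by move=> n Q d _ _ _; rewrite expnS.
  apply: soft_mul0l; [exact: soft_cst|exact: soft_root].
apply: soft_0b; apply: soft_add; last exact: soft_cst.
by apply: soft_mul0; [exact: soft_cst|exact: soft_bits].
Qed.

Lemma soft_par_T : soft beta (par_T k beta p1).
Proof.
apply: soft_add; first by apply: soft_mul0; [exact: soft_par_L|exact: soft_pow_par_l].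
apply: soft_mul0l; first exact: soft_cst.
apply: soft_add; last exact: soft_par_L.
by apply: soft_mul0l; [exact: soft_cst|exact: soft_par_nu].
Qed.

Lemma soft_par_M : soft (0 : R) (@par_M R).
Proof.
apply: soft_mul0; first exact: soft_pow_par_l.
apply: soft_add; last exact: soft_cst.
by apply: soft_mul0; [exact: soft_cst|exact: soft_bits].
Qed.

Lemma soft_par_K : soft (0 : R) (par_K k p2).
Proof. by apply: soft_mul0; [exact: soft_cst|exact: soft_bits]. Qed.

Lemma soft_par_H : soft beta (par_H k beta p1 p2).
Proof.
apply: soft_add; last exact: soft_cstb.
apply: soft_mul0; last exact: soft_par_K.
by apply: soft_mul0l; [exact: soft_par_G|exact: soft_par_L].
Qed.

Lemma soft_par_words : soft (1 + beta) (par_words k beta p1).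
Proof.
have b1 : (0 : R) <= 1 + beta by rewrite addr_ge0.
apply: soft_add; last exact: soft_weaken soft_pow_par_l.
apply: soft_add; last first.
  rewrite addrC; apply: soft_mul; last exact: soft_size.
  apply: soft_mul0l; first exact: soft_cst.
  by apply: soft_mul0l; [exact: soft_par_G|exact: soft_par_L].
apply: soft_add; last by apply: soft_weaken (soft_size R); rewrite lerDl.
exact: soft_weaken (soft_cst R (43 + k)).
Qed.

Lemma soft_space : soft (1 + beta) (fun n Q d => n + k * par_H k beta p1 p2 n Q d + par_words k beta p1 n Q d)%N.
Proof.
apply: soft_add; last exact: soft_par_words.
apply: soft_add; first by apply: soft_weaken (soft_size R); rewrite lerDl.
apply: soft_mul0l; first exact: soft_cst.
by apply: soft_weaken soft_par_H; rewrite lerDr.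
Qed.

Lemma soft_par_total : soft (2 + beta) (par_total k beta p1 p2).
Proof.
have w0 f : soft (0 : R) f -> soft (2 + beta) f by apply: soft_weaken; rewrite addr_ge0.
have wb f : soft beta f -> soft (2 + beta) f by apply: soft_weaken; rewrite lerDr.
have w1 f : soft (1 + beta) f -> soft (2 + beta) f by apply: soft_weaken; rewrite lerD2r; lra.
have w2 f : soft (1 + 1) f -> soft (2 + beta) f by apply: soft_weaken; have := beta_ge0; lra.
have c0 c : soft (2 + beta) (fun _ _ _ => c) by apply/w0/soft_cst.
apply: soft_add; last exact/w0/soft_par_K.
apply: soft_add; last first.
  apply: soft_add => //.
  apply/w2; apply: (soft_le (g := fun n Q d => 2 * 2 ^ par_J n * 2 ^ par_l n Q d)%N).
    by move=> n Q d _ _ _; rewrite expnS expnD mulnA.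
  apply: soft_mul0; last exact: soft_pow_par_l.
  apply: soft_mul0l; first exact: soft_cst.
  by apply: soft_weaken soft_pow_par_J; lra.
apply: soft_add; last first.
  apply: soft_add => //; apply/w2/soft_mul.
    apply: (soft_le (g := fun n _ _ => 2 * 2 ^ par_J n)%N).
      by move=> n Q d _ _ _; rewrite expnS.
    by apply: soft_mul0l; [exact: soft_cst|exact: soft_pow_par_J].
  apply: (soft_le (g := fun n _ _ => n + n)%N).
    by move=> n Q d n0 _ _; rewrite -addn1 leq_add2l.
  by apply: soft_add; exact: soft_size.
apply: soft_add; last by apply: soft_add => //; exact/wb/soft_par_H.
apply: soft_add; last first.
  apply: soft_add => //; apply/w0/soft_mul0; first exact: soft_cst.
  by apply: soft_add; [exact: soft_par_J|exact: soft_cst].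
apply: soft_add; last first.
  apply: soft_add => //; apply: soft_add; last exact/wb/soft_par_L.
  apply: soft_add; last exact/w0/soft_par_G.
  by apply/wb/soft_mul0l; [exact: soft_par_G|exact: soft_par_L].
apply: soft_add => //; apply: soft_add; last exact/wb/soft_par_T.
apply: soft_add; last exact/w0/soft_par_M.
apply: soft_add; last exact/w0/soft_par_l.
apply: soft_add; last exact/w0/soft_par_J.
exact/w1/soft_par_words.
Qed.

Lemma soft_cost : soft beta (fun n Q d => cQ unit_machine k (par_J n) (par_l n Q d) (par_G n Q d)
  (par_L k beta p1 n) (par_T k beta p1 n Q d) (par_M n Q d) (par_K k p2 n Q d)).
Proof.
have J1 : soft (0 : R) (fun n _ _ => (par_J n).+1).
  apply: (soft_le (g := fun n _ _ => par_J n + 1)%N); first by move=> *; rewrite addn1.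
  by apply: soft_add; [exact: soft_par_J|exact: soft_cst].
apply: soft_add => //; apply: soft_mul0l => //; apply: soft_add => //.
apply: soft_mul0l; first exact: soft_par_M.
apply: soft_add => //; apply: soft_add; last first.
  apply/soft_0b/soft_mul0; last exact: soft_cst.
  by apply: soft_add; [exact: soft_par_J|exact: soft_par_l].
apply: soft_add => //; apply: soft_mul0l; first exact: soft_par_G.
apply: soft_add => //; apply: soft_add; last first.
  apply: soft_mul0; first exact: soft_par_T.
  apply: soft_add; last exact: soft_cst.
  apply: soft_add; last exact: soft_cst.
  apply: soft_add; first exact: soft_cst.
  by apply: soft_mul0; [exact: soft_pow_par_l|exact: soft_cst].
apply: soft_mul0; first exact: soft_par_L.
do 2 (apply: soft_add; last exact: soft_cst).
apply: soft_mul0; first exact: soft_cst.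
apply: soft_mul0 => //; apply: soft_add; last exact: soft_cst.
by apply: soft_mul0; [exact: soft_par_K|exact: soft_cst].
Qed.

End SoftParameters.

Theorem theorem3 (R : realType) (c r beta : R) (rho : R -> R)
    (p1 p2 : R -> R -> R)
    (c_gt1 : 1 < c) (r_gt0 : 0 < r)
    (p_rho : forall c' r' : R, 1 < c' -> 0 < r' ->
       [/\ 0 < p2 c' r', p2 c' r' < p1 c' r', p1 c' r' < 1
         & rho c' = ln (p1 c' r')^-1 / ln (p2 c' r')^-1])
    (beta_min : is_min_exponent rho c beta) :
  exists (A : algorithm R) (C : R) (a : nat),
  forall (n Q : nat) (delta : R), (0 < n)%N -> (0 < Q)%N -> 0 < delta ->
    [/\ (space_used A n Q delta)%:R
          <= C * logf n Q delta ^+ a * (Num.sqrt Q%:R * n%:R `^ (1 + beta)),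
        (wbits A n Q delta)%:R <= C * logf n Q delta
      & forall (M : metricType R) (d : nat) (fam : R -> R -> hash_family R M),
        (0 < d)%N ->
        (forall c' r' : R, 1 < c' -> 0 < r' ->
           is_monotone_lsh (fam c' r') c' r' (p1 c' r') (p2 c' r')) ->
        forall (disp : measure_display) (Omega : measurableType disp)
          (P : probability Omega R)
          (hs : forall f : nat, nat -> Omega -> hf_type (family_of A fam f))
          (coins : nat -> Omega -> bool),
        random_tapes P hs coins ->
        forall (S : 'I_n -> M) (adv : adversary M), injective S ->
        exists2 E : set Omega, measurable E &
          ((1 - delta)%:E <= P E)%E /\
          (forall w : Omega, E w ->
             good_run d Q delta S (fun f j => hs f j w) (coins ^~ w) c r
               (C * logf n Q delta ^+ a * (d%:R * n%:R `^ beta)) adv)].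
Proof.
have [[k k_gt0 betaE] _] := beta_min.
have c0 : 0 < c by apply: lt_trans c_gt1.
pose c' := c `^ k%:R^-1.
have c'k : c' ^+ k = c.
  by rewrite /c' -powR_mulrn ?powR_ge0 // -powRrM mulVf ?powRr1 ?ltW // pnatr_eq0 -lt0n.
have c'0 : 0 <= c' by apply: powR_ge0.
have c'_gt1 : 1 < c'.
  by rewrite ltNge; apply/negP => c'1; have := exprn_ile1 k c'0 c'1; rewrite c'k leNgt c_gt1.
have rc i : 0 < r * c' ^+ i by rewrite mulr_gt0 // exprn_gt0 // (lt_trans ltr01).
pose q1 i := p1 c' (r * c' ^+ i); pose q2 i := p2 c' (r * c' ^+ i).
have q2_gt0 i : 0 < q2 i by case: (p_rho _ _ c'_gt1 (rc i)).
have q2_lt i : q2 i < q1 i by case: (p_rho _ _ c'_gt1 (rc i)).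
have q1_lt1 i : q1 i < 1 by case: (p_rho _ _ c'_gt1 (rc i)).
have rhoE i : rho c' = ln (q1 i)^-1 / ln (q2 i)^-1 by case: (p_rho _ _ c'_gt1 (rc i)).
have rho_le : rho c' <= beta by rewrite betaE /max_exponent le_max lexx.
have k_le : k%:R^-1 <= beta by rewrite betaE /max_exponent le_max lexx orbT.
have beta_ge0 : 0 <= beta by apply: le_trans k_le; rewrite invr_ge0.
have [C1 [a1 [C1_ge0 space_le]]] := soft_space q1 q2 k_le.
have [C2 words_le] : exists C : R, forall n Q delta, (0 < n)%N -> (0 < Q)%N -> 0 < delta ->
    (up_log 2 (par_total k beta q1 q2 n Q delta))%:R <= C * logf n Q delta.
  by apply: soft_up_log (soft_par_total q1 q2 k_gt0 k_le); rewrite addr_ge0.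
have [C3 [a3 [C3_ge0 cost_le]]] := soft_cost q1 q2 k_gt0 k_le.
(* One constant for space, word size and time; [C2] may be negative, and the 1 covers the successor
   in [pbits]. *)
pose C := C1 + `|C2| + 1 + C3.
have leC (x : R) : x <= C1 \/ x <= C3 -> x <= C.
  by rewrite /C; have := normr_ge0 C2; case; lra.
exists (lsh_algorithm k c' r (lsh_parameters k beta q1 q2)), C, (a1 + a3)%N.
move=> n Q delta n0 Q0 d0; have lg1 := logf_ge1 n0 Q0 d0.
set x := logf n Q delta in lg1 *.
have x0 : 0 <= x by apply: le_trans lg1.
have grow (D : R) b : 0 <= D -> D <= C -> (b <= a1 + a3)%N -> D * x ^+ b <= C * x ^+ (a1 + a3).
  by move=> D0 DC ba; apply: ler_pM; rewrite ?exprn_ge0 // ler_weXn2l.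
split.
- rewrite /space_used /= size_mkseq; apply: le_trans (space_le n Q delta n0 Q0 d0) _.
  apply: ler_pM; rewrite ?powR_ge0 ?mulr_ge0 ?exprn_ge0 //.
    by apply: grow; [|apply: leC; left|exact: leq_addr].
  (* The space obtained is polylogarithmic in [Q]; the factor [sqrt Q] is inserted because it is at
     least 1. *)
  rewrite ler_peMl ?powR_ge0 // -[leLHS]sqrtr1; apply: ler_wsqrtr; by rewrite ler1n.
- rewrite /= -natr1; apply: le_trans (lerD (words_le n Q delta n0 Q0 d0) lg1) _; rewrite -/x.
  rewrite -[X in _ + X]mul1r -mulrDl; apply: ler_wpM2r => //.
  by rewrite /C; have := ler_norm C2; lra.
move=> M d fam d_gt0 fam_lsh disp Omega P hs coins tapes S adv _.
apply: (robust_event (lsh_parameters_valid k beta q2_gt0 q2_lt q1_lt1 n0 Q0 d0)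
  k_gt0 n0 c'_gt1 r_gt0 c'k (nu := par_nu k n Q delta) (p1 := p1) (p2 := p2)
  _ _ _ _ _ _ fam_lsh adv (KM := par_K k q2 n Q delta) _ _ tapes).
- by [].
- by move=> r' r'0; case: (p_rho _ _ c'_gt1 r'0) => /ltW h /ltW h' _ _; apply: le_trans h'.
- by move=> r' r'0; case: (p_rho _ _ c'_gt1 r'0) => /ltW.
- by move=> i ik; apply: (near_ge q2_gt0 q2_lt q1_lt1 rhoE rho_le n0 ik).
- by move=> i _; apply: (far_le q2_gt0 q2_lt q1_lt1 n0).
- exact: lsh_loss.
- by move=> i ik; apply: (hash_len_le q2_gt0 q2_lt q1_lt1 n0 Q0 d0 ik).
move=> hs' coins'; set m := machine_of _ _ _ _ _ _ _.
apply: (@le_trans _ _ (d%:R * (C3 * x ^+ a3 * n%:R `^ beta))).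
  apply: (@le_trans _ _ (d * cQ unit_machine k (par_J n) (par_l n Q delta) (par_G n Q delta)
    (par_L k beta q1 n) (par_T k beta q1 n Q delta) (par_M n Q delta) (par_K k q2 n Q delta))%:R).
    by rewrite ler_nat; apply: cQ_dimension.
  by rewrite natrM; apply: ler_wpM2l => //; apply: cost_le.
rewrite [leRHS]mulrCA; apply: ler_wpM2l => //; apply: ler_wpM2r; first exact: powR_ge0.
by apply: grow; [|apply: leC; right|exact: leq_addl].
Qed.
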